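(* Let $X$ be a compact Riemann surface of genus $g\geq 2$, let $L\to X$ be a holomorphic line bundle of degree $d_L$, and fix $\alpha\in\mathbb{R}$. If $(V,\gamma)$ is an $\alpha$-semistable $L$-quadric bundle of type $(n,d)$ over $X$, then \[ n\alpha\leq d\leq \frac{\mathrm{rk}(\gamma)\,d_L}{2}+(n-\mathrm{rk}(\gamma))\,\alpha . \] In particular, if $\alpha>d_L/2$, then the moduli space $\mathcal{N}_\alpha(n,d)$ of $\alpha$-polystable $L$-quadric bundles of type $(n,d)$ is empty for any $(n,d)$; and if $\alpha\leq d_L/2$, then $\mathcal{N}_\alpha(n,d)$ is empty whenever $d>nd_L/2$.
   Context: An $L$-quadric bundle over $X$ is a pair $(V,\gamma)$ with $V$ a holomorphic vector bundle on $X$ and $\gamma$ a non-zero holomorphic section of $S^2V^*\otimes L$, viewed also as a symmetric map $\gamma:V\to V^*\otimes L$. Its type is $(n,d)$ if $n=\mathrm{rk}(V)\geq 1$ and $d=\deg(V)$. $\mathrm{rk}(\gamma)$ denotes the (generic) rank of $\gamma:V\to V^*\otimes L$. Two quadric bundles $(V_1,\gamma_1)$, $(V_2,\gamma_2)$ are isomorphic if there is an isomorphism $f:V_1\to V_2$ with $(f^t\otimes \mathrm{Id}_L)\gamma_2 f=\gamma_1$. For a subbundle $V'\subseteq V$, $V'^\perp$ denotes the kernel of $V^*\to V'^*$. Below, proper subbundles are non-zero and different from $V$. Semistability. $(V,\gamma)$ of type $(n,d)$ is $\alpha$-semistable if $\alpha\leq d/n$ and: (1) for any proper subbundle $V'\subsetneq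 V$: (a) if $\gamma(V')\not\subseteq V'^\perp\otimes L$, then $\deg(V')\leq d+\alpha(\mathrm{rk}(V')-n)$; (b) if $\gamma(V')\subseteq V'^\perp\otimes L$, then $\deg(V')\leq \frac d2+\alpha(\mathrm{rk}(V')-\frac n2)$; (c) if $\gamma(V')=0$, then $\deg(V')\leq\alpha\,\mathrm{rk}(V')$; (2) for any strict filtration $0\subsetneq V'\subsetneq V''\subsetneq V$ by subbundles with $\gamma(V')\subseteq V''^\perp\otimes L$ and $\gamma(V'')\not\subseteq V''^\perp\otimes L$, one has $\deg(V')+\deg(V'')\leq d+\alpha(\mathrm{rk}(V')+\mathrm{rk}(V'')-n)$. Polystability. $(V,\gamma)$ is $\alpha$-polystable if it is $\alpha$-semistable and: (1) for any proper subbundle $V'\subsetneq V$: (a) if $\gamma(V')\not\subseteq V'^\perp\otimes L$ and equality holds in (1)(a), then there is a subbundle $V''\subsetneq V$ with $V\cong V'\oplus V''$ and $\gamma=\left(\begin{smallmatrix}\gamma'&0\\0&0\end{smallmatrix}\right)$ with $0\neq\gamma'\in H^0(X,S^2V'^*\otimes L)$; (b) if $\gamma(V')\subseteq V'^\perp\otimes L$ and equality holds in (1)(b), then there is a subbundle $V''\subsetneq V$ with $V\cong V'\oplus V''$ and $\gamma=\left(\begin{smallmatrix}0&\gamma'\\ \gamma'^t&0\end{smallmatrix}\right)$ with $0\neq\gamma'\in H^0(X,V'^*\otimes V''^*\otimes L)$; (c) if $\gamma(V')=0$ and equality holds in (1)(c), then there is a subbundle $V''\subsetneq V$ with $V\cong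 V'\oplus V''$ and $\gamma=\left(\begin{smallmatrix}0&0\\0&\gamma'\end{smallmatrix}\right)$ with $0\neq\gamma'\in H^0(X,S^2V''^*\otimes L)$; (2) if a filtration as in (2) of semistability attains equality, then $V\cong V'\oplus V''/V'\oplus V/V''$ and $\gamma=\left(\begin{smallmatrix}0&0&\gamma'^t\\0&\gamma''&0\\ \gamma'&0&0\end{smallmatrix}\right)$ with $\gamma'\in H^0(X,V'^*\otimes (V/V'')^*\otimes L)$ and $\gamma''\in H^0(X,S^2(V''/V')^*\otimes L)$, not both zero. $\mathcal{N}_\alpha(n,d)$ is the moduli space of $\alpha$-polystable $L$-quadric bundles over $X$ of type $(n,d)$ (constructed by Gómez–Sols and Schmitt); its points are the isomorphism classes of such quadric bundles. *)

(* Defs.v *)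
From HB Require Import structures.
From mathcomp Require Import all_boot all_order all_algebra.
From mathcomp Require Import all_classical all_reals all_analysis.
From mathcomp Require Import complex.

Set Implicit Arguments.
Unset Strict Implicit.
Unset Printing Implicit Defensive.

Import Order.TTheory GRing.Theory Num.Theory.
Import numFieldNormedType.Exports.

Local Open Scope classical_set_scope.
Local Open Scope ring_scope.

(* A Riemann surface is given by an atlas, not necessarily maximal.  The chart
   [chart i] is only meaningful on [chart_dom i], and its inverse [chart_inv i]
   only on the open set [chart i @` chart_dom i].  Functions of one complex
   variable are holomorphic when they are complex differentiable at every point
   of an open set; since [R[i]] is taken as the field of scalars,
   [derivable f z 1] is complex differentiability at [z]. *)
Record riemann_surface (R : realType) := RiemannSurface {
  rs_space :> topologicalType;
  rs_nonempty : [set: rs_space] !=set0;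
  rs_hausdorff : hausdorff_space rs_space;
  rs_connected : connected [set: rs_space];
  chart_idx : Type;
  chart_dom : chart_idx -> set rs_space;
  chart : chart_idx -> rs_space -> R[i];
  chart_inv : chart_idx -> R[i] -> rs_space;
  chart_dom_open : forall i, open (chart_dom i);
  chart_cover : forall x, exists i, chart_dom i x;
  chart_img_open : forall i, open (chart i @` chart_dom i : set R[i]^o);
  chartK : forall i x, chart_dom i x -> chart_inv i (chart i x) = x;
  chart_continuous : forall i x, chart_dom i x ->
    {for x, continuous (chart i : rs_space -> R[i]^o)};
  chart_inv_continuous : forall i x, chart_dom i x ->
    {for chart i x, continuous (chart_inv i : R[i]^o -> rs_space)};
  chart_transition : forall i j x, chart_dom i x -> chart_dom j x ->
    derivable (chart j \o chart_inv i : R[i]^o -> R[i]^o) (chart i x) 1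
}.

Section Bundles.
Variables (R : realType) (X : riemann_surface R).
Local Notation C := (R[i]).

(* [A] is meant to be open. *)
Definition holomorphic_on (A : set X) (f : X -> C) : Prop :=
  forall (i : chart_idx X) x, A x -> chart_dom i x ->
    derivable (f \o chart_inv i : C^o -> C^o) (chart i x) 1.

(* [f = z ^ m * h] on a punctured neighbourhood of [p], where [z] is a local
   coordinate vanishing at [p] and [h] is holomorphic at [p].  The value of [f]
   at [p] itself is irrelevant. *)
Definition mero_form_at (f : X -> C) (p : X) (m : int) (h : X -> C) : Prop :=
  exists (i : chart_idx X) (U : set X),
    [/\ open_nbhs p U, chart_dom i p, holomorphic_on U h &
        forall x, U x -> chart_dom i x -> x <> p ->
          f x = (chart i x - chart i p) ^ m * h x].

Definition meromorphic_at (f : X -> C) (p : X) : Prop :=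
  exists m h, mero_form_at f p m h.

Definition order_at (f : X -> C) (p : X) (m : int) : Prop :=
  exists2 h, mero_form_at f p m h & h p != 0.

(* A holomorphic 1-form is a family of coefficients [w i], standing for
   [w i dz_i] on the domain of the chart [z_i]. *)
Definition holomorphic_form (w : chart_idx X -> X -> C) : Prop :=
  (forall i, holomorphic_on (chart_dom i) (w i)) /\
  (forall i j x, chart_dom i x -> chart_dom j x ->
    w i x = w j x * 'D_1 (chart j \o chart_inv i : C^o -> C^o) (chart i x)).

(* The genus is the dimension of the space of holomorphic 1-forms; every form
   is a unique combination of the basis [b]. *)
Definition has_genus (g : nat) : Prop :=
  exists b : 'I_g -> chart_idx X -> X -> C,
    (forall a, holomorphic_form (b a)) /\
    (forall w, holomorphic_form w ->
      exists! c : 'rV[C]_g, forall i x, chart_dom i x ->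
        w i x = \sum_(a < g) c ord0 a * b a i x).

(* A holomorphic vector bundle: a family of vector spaces with fibrewise linear
   local trivialisations whose transition matrices are holomorphic. *)
Record vbundle := VBundle {
  fiber :> X -> vectType C;
  rk : nat;
  triv_idx : Type;
  triv_dom : triv_idx -> set X;
  triv : triv_idx -> forall x, 'Hom(fiber x, 'rV[C]_rk);
  triv_dom_open : forall j, open (triv_dom j);
  triv_cover : forall x, exists j, triv_dom j x;
  triv_bij : forall j x, triv_dom j x -> bijective (triv j x);
  triv_transition : forall j k, exists g : X -> 'M[C]_rk,
    (forall a b, holomorphic_on (triv_dom j `&` triv_dom k) (fun x => g x a b))
    /\ (forall x (v : fiber x), triv_dom j x -> triv_dom k x ->
          triv k x v = triv j x v *m g x)
}.

Definition section (V : vbundle) := forall x : X, V x.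

Definition holomorphic_section (V : vbundle) (A : set X) (s : section V) :=
  forall (j : triv_idx V) (a : 'I_(rk V)),
    holomorphic_on (A `&` triv_dom j) (fun x => triv j x (s x) ord0 a).

Definition local_frame (V : vbundle) (r : nat)
    (W : forall x, {vspace V x}) (A : set X) (e : 'I_r -> section V) : Prop :=
  (forall a, holomorphic_section A (e a)) /\
  (forall x, A x -> basis_of (W x) [tuple e a x | a < r]).

Record subbundle (V : vbundle) := SubBundle {
  sub_fiber :> forall x, {vspace V x};
  sub_rk : nat;
  sub_frame : forall p, exists (U : set X) (e : 'I_sub_rk -> section V),
    open_nbhs p U /\ local_frame sub_fiber U e
}.

(* [s] is a meromorphic frame of the rank [r] subbundle [W] of [V], and [D] is
   the divisor of the meromorphic section [s_1 /\ ... /\ s_r] of [det W]: its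
   order at [p] is that of the determinant of the matrix expressing [s] in a
   local holomorphic frame [e] at [p]. *)
Definition frame_divisor (V : vbundle) (r : nat) (W : forall x, {vspace V x})
    (s : 'I_r -> section V) (D : X -> int) : Prop :=
  forall p, exists (U : set X) (e : 'I_r -> section V) (A : X -> 'M[C]_r),
    [/\ open_nbhs p U, local_frame W U e,
        forall a b, meromorphic_at (fun x => A x a b) p,
        forall x a, U x -> x <> p -> s a x = \sum_b A x a b *: e b x &
        order_at (fun x => \det (A x)) p (D p)].

(* The degree is the degree of the divisor of a meromorphic section of the
   determinant, this section being induced by a meromorphic frame; on a compact
   Riemann surface meromorphic frames exist, and the degree does not depend on
   the frame.  The sum is over the finite support of [D]. *)
Definition frame_degree (V : vbundle) (r : nat) (W : forall x, {vspace V x})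
    (d : int) : Prop :=
  (exists (s : 'I_r -> section V) D, frame_divisor W s D) /\
  (forall (s : 'I_r -> section V) D, frame_divisor W s D ->
     \sum_(p \in [set: X]) D p = d).

Definition has_degree (V : vbundle) (d : int) : Prop :=
  @frame_degree V (rk V) (fun x => fullv) d.

Definition sub_degree (V : vbundle) (W : subbundle V) (d : int) : Prop :=
  @frame_degree V (sub_rk W) W d.

(* Non-zero and different from [V]. *)
Definition proper_sub (V : vbundle) (W : subbundle V) : Prop :=
  (0 < sub_rk W < rk V)%N.

Definition sub_le (V : vbundle) (W1 W2 : subbundle V) : Prop :=
  forall x, (W1 x <= W2 x)%VS.

(* [W = W1 (+) W2] as bundles. *)
Definition is_direct_sum (V : vbundle) (W : forall x, {vspace V x})
    (W1 W2 : subbundle V) : Prop :=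
  forall x, (W1 x + W2 x)%VS = W x /\ (W1 x :&: W2 x)%VS = 0%VS.

(* [gamma x] is the map [V_x -> V_x^* (x) L_x = Hom(V_x, L_x)]. *)
Record quadric_bundle (L : vbundle) := QuadricBundle {
  qb_bundle :> vbundle;
  gamma : forall x, 'Hom(qb_bundle x, 'Hom(qb_bundle x, L x));
  qb_rk_gt0 : (0 < rk qb_bundle)%N;
  gamma_sym : forall x u v, gamma x u v = gamma x v u;
  gamma_holo : forall (A : set X) (s t : section qb_bundle), open A ->
    holomorphic_section A s -> holomorphic_section A t ->
    @holomorphic_section L A (fun x => gamma x (s x) (t x));
  gamma_neq0 : exists x, gamma x != 0
}.

Section Quadric.
Variable L : vbundle.

(* The rank of [gamma x] on a dense open set of points [x]; [0] is a dummy
   value, as such a rank always exists and is unique. *)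
Definition qrk (Q : quadric_bundle L) : nat :=
  xget 0%N [set r | exists A : set X,
    [/\ open A, dense A & forall x, A x -> \dim (limg (gamma Q x)) = r]].

(* [gamma(W1)] is contained in [W2^perp (x) L]. *)
Definition gamma_perp (Q : quadric_bundle L) (W1 W2 : subbundle Q) : Prop :=
  forall x u v, u \in W1 x -> v \in W2 x -> gamma Q x u v = 0.

(* [gamma(W) = 0]. *)
Definition gamma_null (Q : quadric_bundle L) (W : subbundle Q) : Prop :=
  forall x u, u \in W x -> gamma Q x u = 0.

Definition has_type (n : nat) (d : int) (Q : quadric_bundle L) : Prop :=
  rk Q = n /\ has_degree Q d.

(* The hypotheses of condition (2) on a filtration [0 < W1 < W2 < V]. *)
Definition critical_filtration (Q : quadric_bundle L) (W1 W2 : subbundle Q) :=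
  [/\ (0 < sub_rk W1 < sub_rk W2)%N /\ (sub_rk W2 < rk Q)%N, sub_le W1 W2,
      gamma_perp W1 W2 & ~ gamma_perp W2 W2].

(* Right-hand sides of the inequalities; [r] stands for the rank of a subbundle,
   or for the sum of two ranks in the case of a filtration. *)
Definition bound_a (alpha : R) (n : nat) (d : int) (r : nat) : R :=
  d%:~R + alpha * (r%:R - n%:R).
Definition bound_b (alpha : R) (n : nat) (d : int) (r : nat) : R :=
  d%:~R / 2 + alpha * (r%:R - n%:R / 2).
Definition bound_c (alpha : R) (r : nat) : R := alpha * r%:R.

Definition semistable (alpha : R) (n : nat) (d : int) (Q : quadric_bundle L) :=
  [/\ has_type n d Q, alpha <= d%:~R / n%:R,
      forall (W : subbundle Q) (e : int), proper_sub W -> sub_degree W e ->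
        [/\ ~ gamma_perp W W -> e%:~R <= bound_a alpha n d (sub_rk W),
            gamma_perp W W -> e%:~R <= bound_b alpha n d (sub_rk W) &
            gamma_null W -> e%:~R <= bound_c alpha (sub_rk W)] &
      forall (W1 W2 : subbundle Q) (e1 e2 : int),
        critical_filtration W1 W2 -> sub_degree W1 e1 -> sub_degree W2 e2 ->
        e1%:~R + e2%:~R <= bound_a alpha n d (sub_rk W1 + sub_rk W2)].

(* In the last condition, [A] and [B] are the images of [W2 / W1] and [V / W2]
   under the splitting of the filtration. *)
Definition polystable (alpha : R) (n : nat) (d : int) (Q : quadric_bundle L) :=
  [/\ semistable alpha n d Q,
      forall (W : subbundle Q) (e : int), proper_sub W -> sub_degree W e ->
        [/\ ~ gamma_perp W W -> e%:~R = bound_a alpha n d (sub_rk W) ->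
            exists W' : subbundle Q,
              [/\ proper_sub W', is_direct_sum (fun x => fullv) W W',
                  gamma_perp W W', gamma_perp W' W' & ~ gamma_perp W W],
            gamma_perp W W -> e%:~R = bound_b alpha n d (sub_rk W) ->
            exists W' : subbundle Q,
              [/\ proper_sub W', is_direct_sum (fun x => fullv) W W',
                  gamma_perp W W, gamma_perp W' W' & ~ gamma_perp W W'] &
            gamma_null W -> e%:~R = bound_c alpha (sub_rk W) ->
            exists W' : subbundle Q,
              [/\ proper_sub W', is_direct_sum (fun x => fullv) W W',
                  gamma_perp W W, gamma_perp W W' & ~ gamma_perp W' W']] &
      forall (W1 W2 : subbundle Q) (e1 e2 : int),
        critical_filtration W1 W2 -> sub_degree W1 e1 -> sub_degree W2 e2 ->
        e1%:~R + e2%:~R = bound_a alpha n d (sub_rk W1 + sub_rk W2) ->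
        exists A B : subbundle Q,
          [/\ is_direct_sum W2 W1 A, is_direct_sum (fun x => fullv) W2 B,
              [/\ gamma_perp W1 W1, gamma_perp W1 A, gamma_perp A B &
                  gamma_perp B B] &
              ~ (gamma_perp W1 B /\ gamma_perp A A)]].

Definition quadric_iso (Q1 Q2 : quadric_bundle L) : Prop :=
  exists f : forall x, 'Hom(Q1 x, Q2 x),
    [/\ forall x, bijective (f x),
        forall (A : set X) (s : section Q1), open A ->
          holomorphic_section A s ->
          @holomorphic_section Q2 A (fun x => f x (s x)) &
        forall x u v, gamma Q2 x (f x u) (f x v) = gamma Q1 x u v].

(* The points of the moduli space: isomorphism classes of polystable objects.
   This is a plain predicate, as [set (quadric_bundle L)] is rejected for
   universe reasons. *)
Definition moduli (alpha : R) (n : nat) (d : int)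
    (c : quadric_bundle L -> Prop) : Prop :=
  exists2 Q, polystable alpha n d Q & c = (fun Q' => quadric_iso Q' Q).

Definition moduli_empty (alpha : R) (n : nat) (d : int) : Prop :=
  ~ exists c, moduli alpha n d c.

End Quadric.
End Bundles.

(* Main.v *)
(* Let r be the generic rank of gamma and N the saturation of its generic kernel,
   a subbundle of rank k = n - r killed by gamma, so that semistability gives
   deg N <= alpha k (trivially if k = 0).  It remains to see that
   2 (deg V - deg N) <= r deg L.  Choose a meromorphic frame s of V whose first k
   sections span N generically; up to the factor t, the Gram matrix of gamma in s
   is diag(0, G).  Near p, write s = A e with e a holomorphic frame adapted to N,
   so that A is block lower triangular with diagonal blocks A1, A2, where det A1
   defines the divisor D_N and det A1 det A2 defines D_V.  In e the Gram matrix is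
   diag(0, H) with H holomorphic and A2 H A2^T = G up to the change of frame of L;
   taking determinants and using ord (det H) >= 0,
   2 (D_V - D_N) <= r D_L + div (det G).
   Principal divisors have degree 0, because the degree of V does not depend on the
   frame, so that one of the sections of s may be multiplied by any meromorphic
   function.  Summing over p gives the claim.

   The order of vanishing of a complex differentiable function is obtained without
   power series.  Bisecting rectangles gives a primitive; such a function and its
   divided differences satisfy the maximum principle, hence can be divided
   repeatedly by z, and vanish identically if this never stops. *)

(* The divisor calculus needs every complex differentiable function that is not locally zero to be a
   power of z times a nonvanishing differentiable function, while differentiability is only given
   pointwise. The maximum principle is obtained by averaging a second-order expansion. A function f
   is not known to have one, but its primitive F is: so F is divided by z, and the factorisation of
   F is differentiated to reach f. Each division loses the expansion at the point of division, which
   forces a maximum principle with finitely many exceptional points. On the global side, the change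
   of frame producing diag(0, G) starts from a constant matrix chosen at one point, where the rank
   of the Gram matrix is maximal among the points at which its entries are holomorphic. The identity
   theorem carries the invertibility of G from there to a punctured neighbourhood of every point.
   Since gamma is non-zero, r is positive; this makes the upper bound on d fall strictly below n
   alpha when alpha > d_L/2. *)
Require Import Defs.
From HB Require Import structures.
From mathcomp Require Import all_boot all_order all_algebra.
From mathcomp Require Import all_classical all_reals all_analysis.
From mathcomp Require Import complex.
From mathcomp Require Import ring lra zify.
Set Implicit Arguments.
Unset Strict Implicit.
Unset Printing Implicit Defensive.
Import Order.TTheory GRing.Theory Num.Theory.
Import numFieldNormedType.Exports.
Local Open Scope classical_set_scope.
Local Open Scope ring_scope.

(** * Complex differentiable functions of one variable *)

Section ComplexAnalysis.
Variable R : realType.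
Local Notation C := (R[i]).
Local Notation nm := (@ComplexField.Normc.normc R).
Implicit Types (z w : C) (f g u : C^o -> C^o).

Lemma norm_nm z : `|z| = (nm z)%:C%C. Proof. by []. Qed.
Lemma nm_ge0 z : 0 <= nm z. Proof. by rewrite -lecR -norm_nm normr_ge0. Qed.
Lemma nmM z w : nm (z * w) = nm z * nm w. Proof. exact: ComplexField.Normc.normcM. Qed.
Lemma nmD z w : nm (z + w) <= nm z + nm w.
Proof. exact: (@le_normcD R). Qed.
Lemma nmN z : nm (- z) = nm z. Proof. exact: (@normcN R). Qed.
Lemma nm0 : nm 0 = 0. Proof. exact: ComplexField.Normc.normc0. Qed.
Lemma nm1 : nm 1 = 1. Proof. exact: ComplexField.Normc.normc1. Qed.
Lemma nmV z : nm z^-1 = (nm z)^-1. Proof. exact: ComplexField.Normc.normcV. Qed.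
Lemma nmX z n : nm (z ^+ n) = nm z ^+ n.
Proof. by elim: n => [|n IH]; rewrite ?expr0 ?nm1 // !exprS nmM IH. Qed.
Lemma nm_eq0 z : (nm z == 0) = (z == 0).
Proof. by apply/eqP/eqP => [/ComplexField.Normc.eq0_normc|->//]; rewrite ?nm0. Qed.
Lemma nm_gt0 z : (0 < nm z) = (z != 0).
Proof. by rewrite lt_neqAle nm_ge0 andbT eq_sym nm_eq0. Qed.
Lemma nmB z w : nm (z - w) = nm (w - z). Proof. by rewrite -nmN opprB. Qed.
Lemma nmBD z w : nm z - nm w <= nm (z - w).
Proof. by rewrite lerBlDr (le_trans _ (nmD _ _)) // subrK. Qed.
Lemma nmR (x : R) : nm x%:C%C = `|x|.
Proof. by rewrite /= expr0n addr0 sqrtr_sqr. Qed.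
Lemma nm_sqr z : nm z ^+ 2 = complex.Re z ^+ 2 + complex.Im z ^+ 2.
Proof. by case: z => x y /=; rewrite sqr_sqrtr // addr_ge0 ?sqr_ge0. Qed.
Lemma nm_ReIm z : nm z <= `|complex.Re z| + `|complex.Im z|.
Proof.
rewrite -(@ler_pXn2r _ 2) ?nnegrE ?nm_ge0 ?addr_ge0 // nm_sqr.
by rewrite sqrrD !real_normK ?num_real // addrAC lerDl mulrn_wge0 // mulr_ge0.
Qed.
Lemma nm_Re z : `|complex.Re z| <= nm z.
Proof.
by rewrite -(@ler_pXn2r _ 2) ?nnegrE ?nm_ge0 // nm_sqr real_normK ?num_real // lerDl sqr_ge0.
Qed.
Lemma nm_Im z : `|complex.Im z| <= nm z.
Proof.
by rewrite -(@ler_pXn2r _ 2) ?nnegrE ?nm_ge0 // nm_sqr real_normK ?num_real // lerDr sqr_ge0.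
Qed.

Lemma nbhsCP (a : C) (P : set C^o) :
  nbhs (a : C^o) P <-> exists2 d : R, 0 < d & forall z, nm (z - a) < d -> P z.
Proof.
split => [/nbhs_ballP [[d di] /= /andP[/eqP/= -> d0] aP]|[d d0 aP]].
  exists d => // z zd; apply: aP; rewrite /ball /= distrC norm_nm ltcR //.
apply/nbhs_ballP; exists d%:C%C; first by rewrite /= ltcR.
by move=> z; rewrite /ball /= distrC norm_nm ltcR => /aP.
Qed.

Lemma contCP (f : C^o -> C^o) (a : C) : {for a, continuous f} <->
  forall e : R, 0 < e -> exists2 d : R, 0 < d &
    forall z, nm (z - a) < d -> nm (f z - f a) < e.
Proof.
split=> [fa e e0|fa P].
  have /fa /nbhsCP : nbhs (f a : C^o) [set w | nm (w - f a) < e].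
    by apply/nbhsCP; exists e.
  by [].
move=> /nbhsCP [e /fa [d d0 H] HP]; apply/nbhsCP; exists d => // z /H; exact: HP.
Qed.

(* Caratheodory's formulation of complex differentiability. *)
Definition cdiff f (a : C) (l : C) := exists g : C^o -> C^o,
  [/\ {for a, continuous g}, g a = l & forall z, f z = f a + (z - a) * g z].

Lemma derivableCP f (a : C) : derivable f a 1 <-> exists l, cdiff f a l.
Proof.
split=> [/cvg_ex[l fl]|[l [g [ga gl fE]]]].
  exists l, (fun z => if z == a then l else (f z - f a) / (z - a)).
  split; last 2 first.
  - by rewrite eqxx.
  - move=> z; case: eqVneq => [->|za]; first by rewrite subrr mul0r addr0.
    by rewrite mulrC divfK ?subr_eq0 // addrC subrK.
  apply/contCP => e e0; rewrite eqxx.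
  have /fl : nbhs (l : C^o) [set w | nm (w - l) < e] by apply/nbhsCP; exists e.
  move=> /nbhsCP [d d0 H]; exists d => // z zd.
  case: eqVneq => [_|za]; first by rewrite subrr nm0.
  have := H (z - a); rewrite subr0 => /(_ zd); rewrite subr_eq0 => /(_ za) /=.
  by rewrite /GRing.scale /= mulr1 subrK mulrC.
apply/cvg_ex; exists (g a); move=> P /nbhsCP [e e0 HP].
have /contCP/(_ _ e0) [d d0 H] := ga.
apply/nbhsCP; exists d => // h; rewrite subr0 => hd h0; apply: HP.
rewrite /= [h%:A]mulr1 fE addrK addrAC subrr add0r.
by rewrite [_ *: _]mulKf //; apply: H; rewrite addrK.
Qed.

(** For [0 <= r], a 1-Lipschitz retraction of the line onto [[- r, r]]. Composing with it extends a
    function known to be continuous only on that interval, as [real_primitive_affine] asks for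
    continuity everywhere. *)
Definition clamp (r x : R) : R := Num.max (- r) (Num.min r x).

Lemma clampE r x : `|x| <= r -> clamp r x = x.
Proof. by rewrite ler_norml /clamp => /andP[h1 h2]; rewrite min_r // max_r. Qed.

Lemma clamp_le r x : 0 <= r -> `|clamp r x| <= r.
Proof.
by move=> r0; rewrite ler_norml /clamp le_max lexx ge_max ge_min lexx /= andbT; lra.
Qed.

Lemma clamp_lip r x y : `|clamp r x - clamp r y| <= `|x - y|.
Proof.
have H (a b c : R) : `|Num.max c a - Num.max c b| <= `|a - b|.
  have [?|?] := leP c a; have [?|?] := leP c b;
    rewrite ?subrr ?normr_ge0 // ler_norml; have := ler_norm (a - b);
    have := ler_norm (b - a); rewrite (distrC b); lra.
have H' (a b c : R) : `|Num.min c a - Num.min c b| <= `|a - b|.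
  have [?|?] := leP c a; have [?|?] := leP c b;
    rewrite ?subrr ?normr_ge0 // ler_norml; have := ler_norm (a - b);
    have := ler_norm (b - a); rewrite (distrC b); lra.
exact: le_trans (H _ _ _) (H' _ _ _).
Qed.

(* The primitive [P] is only used through its exactness on affine functions and
   the resulting estimate. *)
Lemma real_primitive_affine (g : R -> R) (r : R) : 0 < r -> continuous g ->
  exists P : R -> R, forall x0 x1 a b e : R, `|x0| <= r -> `|x1| <= r ->
    (forall x, Num.min x0 x1 <= x <= Num.max x0 x1 -> `|g x - (a + b * x)| <= e) ->
    `|P x1 - P x0 - (a * (x1 - x0) + b * (x1 ^+ 2 - x0 ^+ 2) / 2)| <= e * `|x1 - x0|.
Proof.
move=> r0 gc.
(* The base point lies strictly to the left of [- r], so that the fundamental theorem of calculus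
   gives a two-sided derivative on all of [[- r, r]], endpoints included. *)
pose P x := (\int[lebesgue_measure]_(t in `[- r - 1, x]) g t)%R.
have dP (x : R) : `|x| <= r -> is_derive x (1 : R) P (g x).
  rewrite ler_norml => /andP[x1 x2].
  have xu : x < r + 1 by lra.
  have [] := @continuous_FTC1_closed R g (- r - 1) x (r + 1) xu.
  - apply: continuous_compact_integrable; first exact: segment_compact.
    by move=> y; apply: continuous_subspaceT.
  - by lra.
  - exact: gc.
  move=> d1; rewrite derive1E => d2; exact: (DeriveDef d1 d2).
exists P.
have main (x0 x1 a b e : R) : x0 <= x1 -> `|x0| <= r -> `|x1| <= r ->
    (forall x, x0 <= x <= x1 -> `|g x - (a + b * x)| <= e) ->
    `|P x1 - P x0 - (a * (x1 - x0) + b * (x1 ^+ 2 - x0 ^+ 2) / 2)| <= e * `|x1 - x0|.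
  move=> x01 x0r x1r H.
  (* Subtracting the exact primitive of the affine function leaves a derivative bounded by [e]; the
     mean value theorem concludes. *)
  pose G := P - (fun x => a * x + b / 2 * x ^+ 2) : R -> R.
  have dG (x : R) : x0 <= x <= x1 -> is_derive x (1:R) G (g x - (a + b * x)).
    move=> /andP[xa xb].
    have xr : `|x| <= r by move: x0r x1r; rewrite !ler_norml; lra.
    have Px := dP _ xr.
    apply: is_deriveB.
    apply: is_derive_eq; rewrite /GRing.scale /= ; by field.
  have [c cx cE] : exists2 c, c \in `[x0, x1] & G x1 - G x0 = (g c - (a + b * c)) * (x1 - x0).
    apply: MVT_segment => //.
      by move=> x; rewrite in_itv /= => /andP[xa xb]; apply: dG; rewrite !ltW.
    apply: derivable_within_continuous => x; rewrite in_itv /= => xx.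
    by have [] := dG _ xx.
  have -> : P x1 - P x0 - (a * (x1 - x0) + b * (x1 ^+ 2 - x0 ^+ 2) / 2) = G x1 - G x0.
    by rewrite /G !fctE; field.
  by rewrite cE normrM ler_wpM2r // H // -[_ <= _ <= _]/(c \in `[x0, x1]) .
move=> x0 x1 a b e; have [x01|/ltW x10] := leP x0 x1 => x0r x1r H.
  exact: main.
rewrite [`|x1 - x0|]distrC.
have -> : P x1 - P x0 - (a * (x1 - x0) + b * (x1 ^+ 2 - x0 ^+ 2) / 2) =
  - (P x0 - P x1 - (a * (x0 - x1) + b * (x0 ^+ 2 - x1 ^+ 2) / 2)) by field.
by rewrite normrN; exact: main.
Qed.

Definition mkC (x y : R) : C := (x +i* y)%C.

Lemma mkC_eta z : mkC (complex.Re z) (complex.Im z) = z. Proof. by case: z. Qed.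

(** The factor 2 is the price of treating real and imaginary parts separately. *)
Lemma line_primitive_affine (g : R -> C) (r : R) : 0 < r ->
  (forall x, `|x| <= r -> forall e, 0 < e -> exists2 d, 0 < d &
     forall x', `|x'| <= r -> `|x' - x| < d -> nm (g x' - g x) < e) ->
  exists P : R -> C, forall (x0 x1 : R) (a b : C) (e : R), `|x0| <= r -> `|x1| <= r ->
    (forall x, Num.min x0 x1 <= x <= Num.max x0 x1 -> nm (g x - (a + b * x%:C%C)) <= e) ->
    nm (P x1 - P x0 - (a * (x1 - x0)%:C%C + b * ((x1 ^+ 2 - x0 ^+ 2) / 2)%:C%C))
      <= 2 * e * `|x1 - x0|.
Proof.
move=> r0 gc.
have cont (p : C -> R) : (forall z w, `|p z - p w| <= nm (z - w)) ->
    continuous (p \o g \o clamp r : R -> R).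
  move=> pl x; apply/(@cvgrPdist_lt _ R) => e e0.
  have [d d0 H] := gc _ (clamp_le x (ltW r0)) _ e0.
  apply/nbhs_ballP; exists d => // y; rewrite /ball /= => xy.
  apply: (le_lt_trans (pl _ _)); rewrite nmB; apply: H; first exact: clamp_le (ltW r0).
  by apply: le_lt_trans (clamp_lip _ _ _) _; rewrite distrC.
have [|P HP] := real_primitive_affine r0 (cont (@complex.Re R) _).
  by move=> z w; rewrite -raddfB; exact: nm_Re.
have [|Q HQ] := real_primitive_affine r0 (cont (@complex.Im R) _).
  by move=> z w; rewrite -raddfB; exact: nm_Im.
exists (fun x => mkC (P x) (Q x)) => x0 x1 [a1 a2] [b1 b2] e x0r x1r H.
have xr x : Num.min x0 x1 <= x <= Num.max x0 x1 -> `|x| <= r.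
  move=> /andP[]; rewrite ge_min le_max => h1 h2.
  by move: x0r x1r; rewrite !ler_norml; lra.
apply: le_trans (nm_ReIm _) _; rewrite -mulrA [2 * _]mulrDl mul1r; apply: lerD.
  set l := (X in `|X| <= _).
  have -> : l = P x1 - P x0 - (a1 * (x1 - x0) + b1 * (x1 ^+ 2 - x0 ^+ 2) / 2).
    by rewrite /l /=; ring.
  apply: HP => // x xx; apply: le_trans (H x xx).
  apply: le_trans (nm_Re _); rewrite /= clampE; last exact: xr.
  by case: (g x) => u v /=; rewrite mulr0 subr0.
set l := (X in `|X| <= _).
have -> : l = Q x1 - Q x0 - (a2 * (x1 - x0) + b2 * (x1 ^+ 2 - x0 ^+ 2) / 2).
  by rewrite /l /=; ring.
apply: HQ => // x xx; apply: le_trans (H x xx).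
apply: le_trans (nm_Im _); rewrite /= clampE; last exact: xr.
by case: (g x) => u v /=; rewrite mulr0 add0r.
Qed.

Definition square (r : R) : set C := [set z | `|complex.Re z| <= r /\ `|complex.Im z| <= r].

(** * Bisection of rectangles *)

Lemma nested_intervals (a b : nat -> R) : (forall n, a n <= a n.+1) ->
  (forall n, b n.+1 <= b n) -> (forall n, a n <= b n) ->
  exists x, forall n, a n <= x <= b n.
Proof.
move=> am bm ab.
have amono m n : (m <= n)%N -> a m <= a n by move/nondecreasing_seqP: am; apply.
have bmono m n : (m <= n)%N -> b n <= b m by move/nonincreasing_seqP: bm; apply.
have abmn m n : a m <= b n.
  apply: le_trans (amono m (maxn m n) (leq_maxl _ _)) _.
  exact: le_trans (ab _) (bmono _ _ (leq_maxr _ _)).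
have hs : has_sup (range a).
  by split; [exists (a 0%N), 0%N|exists (b 0%N) => _ [m _ <-]].
exists (sup (range a)) => n; apply/andP; split.
  by apply: ub_le_sup; [case: hs|exists n].
by apply: ge_sup; [case: hs|move=> _ [m _ <-]].
Qed.

(** [bad] will be the failure of an estimate on a rectangle: a property inherited by one of the four
    quarters accumulates at a point. *)
Lemma bisection (bad : R -> R -> R -> R -> Prop) (x0 x1 y0 y1 : R) :
  x0 <= x1 -> y0 <= y1 -> bad x0 x1 y0 y1 ->
  (forall x0 x1 y0 y1, x0 <= x1 -> y0 <= y1 -> bad x0 x1 y0 y1 ->
    let m := (x0 + x1) / 2 in let n := (y0 + y1) / 2 in
    [\/ bad x0 m y0 n, bad x0 m n y1, bad m x1 y0 n | bad m x1 n y1]) ->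
  exists x y, [/\ x0 <= x <= x1, y0 <= y <= y1 & forall d, 0 < d ->
    exists a0 a1 b0 b1, [/\ x0 <= a0 /\ a1 <= x1, y0 <= b0 /\ b1 <= y1,
      a0 <= x <= a1 /\ a1 - a0 < d, b0 <= y <= b1 /\ b1 - b0 < d & bad a0 a1 b0 b1]].
Proof.
move=> x01 y01 bad0 step.
pose T := (R * R * (R * R))%type.
pose ok (s : T) := [/\ s.1.1 <= s.1.2, s.2.1 <= s.2.2 & bad s.1.1 s.1.2 s.2.1 s.2.2].
pose half (s t : T) := [/\ s.1.1 <= t.1.1, t.1.2 <= s.1.2, s.2.1 <= t.2.1, t.2.2 <= s.2.2 &
  t.1.2 - t.1.1 = (s.1.2 - s.1.1) / 2 /\ t.2.2 - t.2.1 = (s.2.2 - s.2.1) / 2].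
(* Choice needs a successor for every quadruple; those that are not [ok] are sent to themselves. *)
have /choice[nxt nxtP] : forall s, exists t, ok s -> ok t /\ half s t.
  move=> [[p q] [u v]]; have [[/= pq uv b]|no] := pselect (ok (p, q, (u, v))); last first.
    by exists (p, q, (u, v)).
  have [] := step p q u v pq uv b => b'.
  - exists ((p, (p + q) / 2), (u, (u + v) / 2)) => _; split; split; rewrite //=; lra.
  - exists ((p, (p + q) / 2), ((u + v) / 2, v)) => _; split; split; rewrite //=; lra.
  - exists (((p + q) / 2, q), (u, (u + v) / 2)) => _; split; split; rewrite //=; lra.
  - exists (((p + q) / 2, q), ((u + v) / 2, v)) => _; split; split; rewrite //=; lra.
pose s n : T := iter n nxt (x0, x1, (y0, y1)).
have oks n : ok (s n) by elim: n => [|n IH]; [split|case: (nxtP _ IH)].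
have hs n : half (s n) (s n.+1) by case: (nxtP _ (oks n)).
have [x xP] : exists x, forall n, (s n).1.1 <= x <= (s n).1.2.
  by apply: nested_intervals => n; [case: (hs n)|case: (hs n)|case: (oks n)].
have [y yP] : exists y, forall n, (s n).2.1 <= y <= (s n).2.2.
  by apply: nested_intervals => n; [case: (hs n)|case: (hs n)|case: (oks n)].
exists x, y; split; [exact: (xP 0%N)|exact: (yP 0%N)|move=> d d0].
have lens n : (s n).1.2 - (s n).1.1 = (x1 - x0) / 2 ^+ n /\
    (s n).2.2 - (s n).2.1 = (y1 - y0) / 2 ^+ n.
  elim: n => [|n [IH1 IH2]]; first by rewrite expr0 !divr1.
  have [_ _ _ _ [-> ->]] := hs n.
  by rewrite IH1 IH2 exprS !invfM; split; ring.
have bds n : [/\ x0 <= (s n).1.1, (s n).1.2 <= x1, y0 <= (s n).2.1 & (s n).2.2 <= y1].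
  elim: n => [|n [i1 i2 i3 i4]]; first by rewrite /s /= !lexx.
  have [j1 j2 j3 j4 _] := hs n.
  by rewrite (le_trans i1) // (le_trans j2) // (le_trans i3) // (le_trans j4).
have [N NP] : exists N, (x1 - x0) / 2 ^+ N < d /\ (y1 - y0) / 2 ^+ N < d.
  pose M := (x1 - x0) + (y1 - y0).
  have [N NM] : exists N, M / d < N%:R by exists (Num.bound (M / d)); apply: archi_boundP; apply: divr_ge0; rewrite /M; lra.
  exists N; rewrite !ltr_pdivrMr ?exprn_gt0 //.
  have : (N%:R : R) <= 2 ^+ N by rewrite -natrX ler_nat ltnW // ltn_expl.
  move: NM; rewrite ltr_pdivrMr // => NM N2.
  have : M < d * 2 ^+ N by rewrite mulrC (lt_le_trans NM) // ler_pM2r.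
  rewrite /M; lra.
exists (s N).1.1, (s N).1.2, (s N).2.1, (s N).2.2.
have [i1 i2 i3 i4] := bds N; have [l1 l2] := lens N.
have [n1 n2] := NP; have [_ _ bN] := oks N.
by split; rewrite ?l1 ?l2.
Qed.

Lemma cdiff_continuous f (a l : C) : cdiff f a l -> {for a, continuous f}.
Proof.
move=> fa; have /derivable1_diffP : derivable f a 1 by apply/derivableCP; exists l.
exact: differentiable_continuous.
Qed.

Lemma cdiff_affine f (a l : C) : cdiff f a l -> forall e : R, 0 < e ->
  exists2 d : R, 0 < d & forall z, nm (z - a) < d ->
    nm (f z - (f a - l * a + l * z)) <= e * nm (z - a).
Proof.
move=> [g [/contCP gc ga fE]] e /gc[d d0 H]; exists d => // z zd.
have -> : f z - (f a - l * a + l * z) = (g z - g a) * (z - a) by rewrite fE ga; ring.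
by rewrite nmM ler_wpM2r ?nm_ge0 // ltW // H.
Qed.

(** A notion between differentiability and analyticity: a primitive of a complex differentiable
    function can be shown to satisfy it, and it suffices for the averaging argument behind the
    maximum principle. *)
Definition expand2 f (a l : C) := exists k : C^o -> C^o,
  {for 0, continuous k} /\ forall h, f (a + h) = f a + l * h + h ^+ 2 * k h.

Let imC : C := ('i)%C.

Let nm_imC : nm imC = 1. Proof. by rewrite /= expr0n expr1n add0r sqrtr1. Qed.

Let mkCE x y : mkC x y = x%:C%C + imC * y%:C%C.
Proof. by apply/eqP; rewrite eq_complex /=; apply/andP; split; apply/eqP; ring. Qed.

Let imC2 : imC * imC = -1.
Proof. by apply/eqP; rewrite eq_complex /=; apply/andP; split; apply/eqP; ring. Qed.

(** * Goursat's theorem and primitives on a square *)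

Section Goursat.
Variables (f : C^o -> C^o) (r : R) (r0 : 0 < r).
Hypothesis fdiff : forall z, square r z -> exists l, cdiff f z l.
(** [P y] and [Q x] play the parts of primitives of [f] along the horizontal line at height [y] and
    the vertical line at abscissa [x]; [line_primitive_affine] will provide them. *)
Variables (P Q : R -> R -> C).
Hypothesis PP : forall y, `|y| <= r -> forall (x0 x1 : R) (a b : C) (e : R),
  `|x0| <= r -> `|x1| <= r ->
  (forall x, Num.min x0 x1 <= x <= Num.max x0 x1 -> nm (f (mkC x y) - (a + b * x%:C%C)) <= e) ->
  nm (P y x1 - P y x0 - (a * (x1 - x0)%:C%C + b * ((x1 ^+ 2 - x0 ^+ 2) / 2)%:C%C))
    <= 2 * e * `|x1 - x0|.
Hypothesis QP : forall x, `|x| <= r -> forall (y0 y1 : R) (a b : C) (e : R),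
  `|y0| <= r -> `|y1| <= r ->
  (forall y, Num.min y0 y1 <= y <= Num.max y0 y1 -> nm (f (mkC x y) - (a + b * y%:C%C)) <= e) ->
  nm (Q x y1 - Q x y0 - (a * (y1 - y0)%:C%C + b * ((y1 ^+ 2 - y0 ^+ 2) / 2)%:C%C))
    <= 2 * e * `|y1 - y0|.

(* The integral of [f] along the boundary of a rectangle. *)
Let B (x0 x1 y0 y1 : R) : C := (P y0 x1 - P y0 x0) - (P y1 x1 - P y1 x0)
  + imC * (Q x1 y1 - Q x1 y0) - imC * (Q x0 y1 - Q x0 y0).

Let half_sqr (p q : R) :
  ((q ^+ 2 - p ^+ 2) / 2)%:C%C = (q%:C%C ^+ 2 - p%:C%C ^+ 2) / 2 :> C.
Proof.
by rewrite (rmorphM (real_complex R)) rmorphB !rmorphXn fmorphV (rmorph_nat _ 2).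
Qed.

Let hor (p q y : R) (a b : C) (e : R) : `|y| <= r -> `|p| <= r -> `|q| <= r ->
  (forall x, Num.min p q <= x <= Num.max p q -> nm (f (mkC x y) - (a + b * mkC x y)) <= e) ->
  nm (P y q - P y p - ((a + b * (imC * y%:C%C)) * (q%:C%C - p%:C%C)
      + b * ((q%:C%C ^+ 2 - p%:C%C ^+ 2) / 2))) <= 2 * e * `|q - p|.
Proof.
move=> yr pr qr H.
have := @PP y yr p q (a + b * (imC * y%:C%C)) b e pr qr _.
rewrite half_sqr (rmorphB (real_complex R)).
apply=> x xx; apply: le_trans (H x xx).
by rewrite [X in _ <= nm (_ - (_ + _ * X))]mkCE le_eqVlt; apply/orP; left; apply/eqP; congr nm; ring.
Qed.

Let ver (p q x : R) (a b : C) (e : R) : `|x| <= r -> `|p| <= r -> `|q| <= r ->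
  (forall y, Num.min p q <= y <= Num.max p q -> nm (f (mkC x y) - (a + b * mkC x y)) <= e) ->
  nm (Q x q - Q x p - ((a + b * x%:C%C) * (q%:C%C - p%:C%C)
      + b * imC * ((q%:C%C ^+ 2 - p%:C%C ^+ 2) / 2))) <= 2 * e * `|q - p|.
Proof.
move=> yr pr qr H.
have := @QP x yr p q (a + b * x%:C%C) (b * imC) e pr qr _.
rewrite half_sqr (rmorphB (real_complex R)).
apply=> y yy; apply: le_trans (H y yy).
by rewrite [X in _ <= nm (_ - (_ + _ * X))]mkCE le_eqVlt; apply/orP; left; apply/eqP; congr nm; ring.
Qed.

(** An affine function integrates to 0 around the rectangle, which is the identity checked by [ring]
    below. Only the errors on the four sides remain, each at most [2 * e] times the length of the
    side. *)
Let B_affine (x0 x1 y0 y1 : R) (a b : C) (e : R) : x0 <= x1 -> y0 <= y1 ->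
  `|x0| <= r -> `|x1| <= r -> `|y0| <= r -> `|y1| <= r ->
  (forall x y, x0 <= x <= x1 -> y0 <= y <= y1 -> nm (f (mkC x y) - (a + b * mkC x y)) <= e) ->
  nm (B x0 x1 y0 y1) <= 4 * e * ((x1 - x0) + (y1 - y0)).
Proof.
move=> x01 y01 x0r x1r y0r y1r H.
have y0y : y0 <= y0 <= y1 by rewrite lexx. have y1y : y0 <= y1 <= y1 by rewrite lexx y01.
have x0x : x0 <= x0 <= x1 by rewrite lexx. have x1x : x0 <= x1 <= x1 by rewrite lexx x01.
have := @hor x0 x1 y0 a b e y0r x0r x1r; have := @hor x0 x1 y1 a b e y1r x0r x1r.
have := @ver y0 y1 x0 a b e x0r y0r y1r; have := @ver y0 y1 x1 a b e x1r y0r y1r.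
rewrite !(min_l x01) !(max_r x01) !(min_l y01) !(max_r y01) !ger0_norm ?subr_ge0 //.
set E1 := _ - _ - _ => /(_ (fun y yy => H x1 y x1x yy)) h1.
set E2 := _ - _ - _ => /(_ (fun y yy => H x0 y x0x yy)) h2.
set E3 := _ - _ - _ => /(_ (fun x xx => H x y1 xx y1y)) h3.
set E4 := _ - _ - _ => /(_ (fun x xx => H x y0 xx y0y)) h4.
have -> : B x0 x1 y0 y1 = E4 - E3 + imC * (E1 - E2).
  by rewrite /B /E1 /E2 /E3 /E4; ring.
apply: le_trans (nmD _ _) _; rewrite nmM nm_imC mul1r.
apply: le_trans (lerD (nmD _ _) (nmD _ _)) _; rewrite !nmN; lra.
Qed.

Let B_eq0_le (x0 x1 y0 y1 : R) : x0 <= x1 -> y0 <= y1 ->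
  `|x0| <= r -> `|x1| <= r -> `|y0| <= r -> `|y1| <= r -> B x0 x1 y0 y1 = 0.
Proof.
move=> x01 y01 x0r x1r y0r y1r.
(* The square of the half-perimeter is additive over the four quarters, so a failure of this
   estimate is inherited by one of them. Dividing [e] by [M ^+ 2 + 1] then absorbs the size of the
   rectangle. *)
suff small (e : R) : 0 < e -> nm (B x0 x1 y0 y1) <= e * ((x1 - x0) + (y1 - y0)) ^+ 2.
  apply/eqP; rewrite -nm_eq0 eq_le nm_ge0 andbT; apply/ler_addgt0Pl => e e0.
  rewrite addr0; set M := (x1 - x0) + (y1 - y0) in small.
  have M2 : 0 < M ^+ 2 + 1 by rewrite ltr_wpDl ?sqr_ge0.
  apply: le_trans (small (e / (M ^+ 2 + 1)) _) _; first by rewrite divr_gt0.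
  by rewrite mulrAC ler_pdivrMr // ler_pM2l // lerDl.
move=> e0; rewrite leNgt; apply/negP => bad0.
pose bad (p q u v : R) := e * ((q - p) + (v - u)) ^+ 2 < nm (B p q u v).
have [|x [y [xx yy H]]] := @bisection bad x0 x1 y0 y1 x01 y01 bad0.
  move=> p q u v pq uv b m n; rewrite /bad in b *.
  have [?|h1] := ltP (e * ((m - p) + (n - u)) ^+ 2) (nm (B p m u n)); first exact: Or41.
  have [?|h2] := ltP (e * ((m - p) + (v - n)) ^+ 2) (nm (B p m n v)); first exact: Or42.
  have [?|h3] := ltP (e * ((q - m) + (n - u)) ^+ 2) (nm (B m q u n)); first exact: Or43.
  have [?|h4] := ltP (e * ((q - m) + (v - n)) ^+ 2) (nm (B m q n v)); first exact: Or44.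
  have BE : B p q u v = (B p m u n + B p m n v) + (B m q u n + B m q n v).
    by rewrite /B; ring.
  move: b; rewrite BE ltNge => /negP[].
  apply: le_trans (nmD _ _) _; apply: le_trans (lerD (nmD _ _) (nmD _ _)) _.
  have -> : e * ((q - p) + (v - u)) ^+ 2 = e * ((m - p) + (n - u)) ^+ 2 +
    e * ((m - p) + (v - n)) ^+ 2 + (e * ((q - m) + (n - u)) ^+ 2 +
    e * ((q - m) + (v - n)) ^+ 2) by rewrite /m /n; field.
  by rewrite !lerD.
have zr : square r (mkC x y) by move: x0r x1r y0r y1r xx yy; rewrite /square /= !ler_norml; lra.
have [l fl] := fdiff zr.
(* With [s] the half-perimeter, the affine error is at most [e / 4 * s], and the factor 4 of
   [B_affine] turns it into exactly [e * s ^+ 2]. *)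
have e4 : 0 < e / 4 by lra.
have [d d0 Hd] := cdiff_affine fl e4.
have d2 : 0 < d / 2 by lra.
have [p [q [u [v [[p1 q1] [u1 v1] [xpq qp] [yuv vu]]]]]] := H _ d2.
rewrite /bad ltNge => /negP; apply.
have -> : e * ((q - p) + (v - u)) ^+ 2 =
  4 * (e / 4 * ((q - p) + (v - u))) * ((q - p) + (v - u)) by field.
move/andP: xpq => [px xq]; move/andP: yuv => [uy yv].
apply: B_affine; try by move: x0r x1r y0r y1r; rewrite !ler_norml; lra.
move=> s t /andP[ps sq] /andP[ut tv].
have nmst : nm (mkC s t - mkC x y) <= (q - p) + (v - u).
  by apply: le_trans (nm_ReIm _) _; apply: lerD; rewrite /= ler_norml; lra.
apply: le_trans (Hd (mkC s t) _) _; first lra.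
by rewrite ler_pM2l.
Qed.

Let B_eq0 (x0 x1 y0 y1 : R) :
  `|x0| <= r -> `|x1| <= r -> `|y0| <= r -> `|y1| <= r -> B x0 x1 y0 y1 = 0.
Proof.
move=> x0r x1r y0r y1r.
have [x01|/ltW x01] := leP x0 x1; have [y01|/ltW y01] := leP y0 y1.
- exact: B_eq0_le.
- have -> : B x0 x1 y0 y1 = - B x0 x1 y1 y0 by rewrite /B; ring.
  by rewrite B_eq0_le ?oppr0.
- have -> : B x0 x1 y0 y1 = - B x1 x0 y0 y1 by rewrite /B; ring.
  by rewrite B_eq0_le ?oppr0.
- have -> : B x0 x1 y0 y1 = B x1 x0 y1 y0 by rewrite /B; ring.
  by rewrite B_eq0_le ?oppr0.
Qed.

(** The integral of [f] from 0 to [z], along the real axis and then vertically. *)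
Let F (z : C) : C := P 0 (complex.Re z) + imC * (Q (complex.Re z) (complex.Im z) - Q (complex.Re z) 0).

(** The vanishing of [B] on the rectangle with abscissas [p], [x] and heights 0, [q] moves the
    horizontal part of the path up to height [q]. *)
Let F_increment (p q x y : R) : `|p| <= r -> `|q| <= r -> `|x| <= r -> `|y| <= r ->
  F (mkC x y) - F (mkC p q) = P q x - P q p + imC * (Q x y - Q x q).
Proof.
move=> pr qr xr yr; have r00 : `|0 : R| <= r by rewrite normr0 ltW.
have := B_eq0 pr xr r00 qr; rewrite /B => B0; rewrite /F /=.
by rewrite -[LHS]subr0 -B0; ring.
Qed.

(** Near [z] the function [f] is affine up to [o(|h|)]. Integrating the affine part along the two
    sides of the path gives [f z * h + l / 2 * h ^+ 2], and the rest is [o(|h|^2)]; hence the value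
    [l / 2] of the remainder at 0. *)
Lemma primitive_expand2 z : `|complex.Re z| < r -> `|complex.Im z| < r -> expand2 F z (f z).
Proof.
move=> zx zy.
have zr : square r z by split; exact: ltW.
have [l fl] := fdiff zr.
exists (fun h => if h == 0 then l / 2 else (F (z + h) - F z - f z * h) / h ^+ 2); split; last first.
  move=> h; case: eqVneq => [->|h0]; first by rewrite addr0 expr0n mul0r mulr0 !addr0.
  by rewrite mulrCA divff ?expf_eq0 // mulr1; ring.
apply/contCP => e e0; rewrite eqxx.
(* The path stays within [2 * nm h] of [z], hence [d / 2] below. The error on the path is
   [e / 16 * (2 * nm h)]; the line estimates double it, and the two sides add up to
   [e / 2 * nm h ^+ 2]. *)
have e16 : 0 < e / 16 by lra.
have [d d0 Hd] := cdiff_affine fl e16.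
pose d' := Num.min (d / 2) (Num.min (r - `|complex.Re z|) (r - `|complex.Im z|)).
exists d'; first by rewrite /d' !lt_min; lra.
move=> h; rewrite subr0 /d' !lt_min => /and3P[hd hx hy].
case: eqVneq => [_|h0]; first by rewrite subrr nm0.
have nh0 : 0 < nm h by rewrite nm_gt0.
move: (nm_Re h) (nm_Im h); set hr := complex.Re h; set hi := complex.Im h => nhr nhi.
set p := complex.Re z in zx hx; set q := complex.Im z in zy hy.
have zE : z = mkC p q by rewrite mkC_eta.
have zhE : z + h = mkC (p + hr) (q + hi) by rewrite {1}zE -[h]mkC_eta.
have tri (x y : R) : `|x + y| <= `|x| + `|y| by exact: ler_normD.
have xr : `|p + hr| <= r by have := tri p hr; lra.
have yr : `|q + hi| <= r by have := tri q hi; lra.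
have pr : `|p| <= r by exact: ltW.
have qr : `|q| <= r by exact: ltW.
set e' := e / 16 * (2 * nm h).
have path (s t : R) : `|s - p| <= `|hr| -> `|t - q| <= `|hi| ->
    nm (f (mkC s t) - (f z - l * z + l * mkC s t)) <= e'.
  move=> sp tq; have st : nm (mkC s t - z) <= 2 * nm h.
    by rewrite zE; apply: le_trans (nm_ReIm _) _ => /=; lra.
  by apply: le_trans (Hd _ _) _; [lra|rewrite /e' ler_pM2l].
have between (s t u : R) : Num.min s (s + t) <= u <= Num.max s (s + t) -> `|u - s| <= `|t|.
  move=> /andP[]; rewrite ge_min le_max => h1 h2.
  have := ler_norm t; have := ler_norm (- t); rewrite normrN ler_norml; lra.
have := @hor p (p + hr) q (f z - l * z) l e' qr pr xr; set E1 := _ - _ - _ => H1.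
have {}H1 : nm E1 <= 2 * e' * nm h.
  apply: le_trans (H1 _) _.
    by move=> x /between xx; apply: path => //; rewrite subrr normr0.
  have -> : p + hr - p = hr by ring.
  by rewrite ler_wpM2l // /e'; nra.
have := @ver q (q + hi) (p + hr) (f z - l * z) l e' xr qr yr; set E2 := _ - _ - _ => H2.
have {}H2 : nm E2 <= 2 * e' * nm h.
  apply: le_trans (H2 _) _.
    by move=> x /between xx; apply: path => //; have -> : p + hr - p = hr by ring.
  have -> : q + hi - q = hi by ring.
  by rewrite ler_wpM2l // /e'; nra.
have FE : F (z + h) - F z - f z * h - l / 2 * h ^+ 2 = E1 + imC * E2.
  have -> : F (z + h) - F z = P q (p + hr) - P q p + imC * (Q (p + hr) (q + hi) - Q (p + hr) q).
    by rewrite zhE [in F z]zE F_increment.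
  have hE : h = hr%:C%C + imC * hi%:C%C by rewrite -mkCE mkC_eta.
  have zE' : z = p%:C%C + imC * q%:C%C by rewrite -mkCE mkC_eta.
  rewrite /E1 /E2 !(rmorphD (real_complex R)) /=.
  have -> : f z * h = (f z - l * z) * h + l * z * h by ring.
  move: (f z - l * z) => c; rewrite hE zE'.
  by field.
have -> : (F (z + h) - F z - f z * h) / h ^+ 2 - l / 2 = (E1 + imC * E2) / h ^+ 2.
  by rewrite -FE [in RHS]mulrBl mulfK // expf_eq0.
rewrite nmM nmV nmX ltr_pdivrMr ?exprn_gt0 //.
apply: le_lt_trans (nmD _ _) _; rewrite nmM nm_imC mul1r.
apply: le_lt_trans (lerD H1 H2) _; rewrite /e'.
have -> : 2 * (e / 16 * (2 * nm h)) * nm h + 2 * (e / 16 * (2 * nm h)) * nm h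
  = e / 2 * nm h ^+ 2 by field.
by rewrite ltr_pM2r ?exprn_gt0 //; lra.
Qed.
End Goursat.

Lemma holomorphic_primitive (f : C^o -> C^o) (r : R) : 0 < r ->
  (forall z, square r z -> exists l, cdiff f z l) ->
  exists F : C^o -> C^o, forall z, `|complex.Re z| < r -> `|complex.Im z| < r ->
    expand2 F z (f z).
Proof.
move=> r0 fd.
have fc z : square r z -> {for z, continuous f}.
  by move=> /fd[l]; exact: cdiff_continuous.
have /choice[P HP] (y : R) : exists p : R -> C, `|y| <= r -> forall (x0 x1 : R) (a b : C) (e : R),
  `|x0| <= r -> `|x1| <= r ->
  (forall x, Num.min x0 x1 <= x <= Num.max x0 x1 -> nm (f (mkC x y) - (a + b * x%:C%C)) <= e) ->
  nm (p x1 - p x0 - (a * (x1 - x0)%:C%C + b * ((x1 ^+ 2 - x0 ^+ 2) / 2)%:C%C))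
    <= 2 * e * `|x1 - x0|.
  have [yr|yr] := leP `|y| r; last by exists (fun=> 0).
  have [|p Hp] := @line_primitive_affine (fun x => f (mkC x y)) r r0; last by exists p => _.
  move=> x xr e e0; have /contCP/(_ _ e0)[d d0 H] := fc (mkC x y) (conj xr yr).
  exists d => // x' _ xx; apply: H.
  by apply: le_lt_trans xx; apply: le_trans (nm_ReIm _) _; rewrite /= subrr normr0 addr0.
have /choice[Q HQ] (x : R) : exists p : R -> C, `|x| <= r -> forall (x0 x1 : R) (a b : C) (e : R),
  `|x0| <= r -> `|x1| <= r ->
  (forall y, Num.min x0 x1 <= y <= Num.max x0 x1 -> nm (f (mkC x y) - (a + b * y%:C%C)) <= e) ->
  nm (p x1 - p x0 - (a * (x1 - x0)%:C%C + b * ((x1 ^+ 2 - x0 ^+ 2) / 2)%:C%C))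
    <= 2 * e * `|x1 - x0|.
  have [xr|xr] := leP `|x| r; last by exists (fun=> 0).
  have [|p Hp] := @line_primitive_affine (fun y => f (mkC x y)) r r0; last by exists p => _.
  move=> y yr e e0; have /contCP/(_ _ e0)[d d0 H] := fc (mkC x y) (conj xr yr).
  exists d => // y' _ yy; apply: H.
  by apply: le_lt_trans yy; apply: le_trans (nm_ReIm _) _; rewrite /= subrr normr0 add0r.
exists (fun z => P 0 (complex.Re z)
  + imC * (Q (complex.Re z) (complex.Im z) - Q (complex.Re z) 0)).
exact: (primitive_expand2 r0 fd HP HQ).
Qed.

(** * Algebra of second-order expansions *)

Local Notation cont f a := {for a, continuous (f : C^o -> C^o)}.

Lemma cont_eq (f g : C^o -> C^o) (a : C) : f =1 g -> cont f a -> cont g a.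
Proof. by move=> /funext->. Qed.

Lemma contD (f g : C^o -> C^o) (a : C) : {for a, continuous f} -> {for a, continuous g} ->
  cont (fun z => f z + g z) a.
Proof. exact: continuousD. Qed.

Lemma contM (f g : C^o -> C^o) (a : C) : {for a, continuous f} -> {for a, continuous g} ->
  cont (fun z => f z * g z) a.
Proof. exact: continuousM. Qed.

Lemma contc (c a : C) : cont (fun=> c) a.
Proof. exact: cst_continuous. Qed.

Lemma contid (a : C) : {for a, continuous (fun z : C^o => z)}.
Proof. by []. Qed.

Lemma contB (f g : C^o -> C^o) (a : C) : {for a, continuous f} -> {for a, continuous g} ->
  cont (fun z => f z - g z) a.
Proof. exact: continuousB. Qed.

Lemma contX (f : C^o -> C^o) n (a : C) : {for a, continuous f} ->
  cont (fun z => f z ^+ n) a.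
Proof.
move=> fa; elim: n => [|n IH].
  exact: contc.
by apply: (@cont_eq (fun z => f z * f z ^+ n)) => [z|]; [rewrite exprS|exact: contM].
Qed.

Lemma contV (f : C^o -> C^o) (a : C) : f a != 0 -> {for a, continuous f} ->
  cont (fun z => (f z)^-1) a.
Proof. by move=> fa0 fa; apply: continuousV. Qed.

Definition has_expand2 f (a : C) := exists l, expand2 f a l.

Lemma has_expand2_cdiff f (a l : C) : expand2 f a l -> cdiff f a l.
Proof.
move=> [k [kc fE]]; exists (fun z => l + (z - a) * k (z - a)); split.
- apply: contD; first exact: contc.
  apply: contM; first by apply: contB; [exact: contid|exact: contc].
  apply: (@continuous_comp _ _ _ (fun z : C^o => z - a : C^o) k); last by rewrite /= subrr.
  by apply: contB; [exact: contid|exact: contc].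
- by rewrite subrr mul0r addr0.
- by move=> z; have := fE (z - a); rewrite (addrC a) subrK => ->; ring.
Qed.

Lemma has_expand2_affine (c s a : C) : has_expand2 (fun z => c * (z - s)) a.
Proof. by exists c, (fun=> 0); split; [exact: contc|move=> h; ring]. Qed.

Lemma has_expand2_cst (c a : C) : has_expand2 (fun=> c) a.
Proof. by exists 0, (fun=> 0); split; [exact: contc|move=> h; ring]. Qed.

Lemma has_expand2M f g (a : C) : has_expand2 f a -> has_expand2 g a -> has_expand2 (fun z => f z * g z) a.
Proof.
move=> [l [k [kc fE]]] [m [j [jc gE]]].
exists (l * g a + m * f a), (fun h => k h * g a + f a * j h + l * m
  + h * (l * j h + m * k h) + h ^+ 2 * (k h * j h)); split; last first.
  by move=> h; rewrite fE gE; ring.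
have hc := @contid 0.
have cc c := @contc c 0.
exact: (contD (contD (contD (contD (contM kc (cc (g a))) (contM (cc (f a)) jc)) (cc (l * m)))
  (contM hc (contD (contM (cc l) jc) (contM (cc m) kc)))) (contM (@contX id 2 0 hc) (contM kc jc))).
Qed.

Lemma has_expand2B f g (a : C) : has_expand2 f a -> has_expand2 g a -> has_expand2 (fun z => f z - g z) a.
Proof.
move=> [l [k [kc fE]]] [m [j [jc gE]]].
exists (l - m), (fun h => k h - j h); split; last first.
  by move=> h; rewrite fE gE; ring.
exact: (contB kc jc).
Qed.

Lemma has_expand2X f n (a : C) : has_expand2 f a -> has_expand2 (fun z => f z ^+ n) a.
Proof.
move=> fa; elim: n => [|n IH].
  by under eq_fun do rewrite expr0; exact: has_expand2_cst.
by under eq_fun do rewrite exprS; exact: has_expand2M.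
Qed.

Lemma has_expand2_subV (s a : C) : a != s -> has_expand2 (fun z => (z - s)^-1) a.
Proof.
move=> as0; have c0 : a - s != 0 by rewrite subr_eq0.
(* The expansion must hold for every [h], even at [h = s - a], where the inverse of 0 is 0 by
   convention; this forces the special value of [k] there. *)
exists (- (a - s) ^- 2), (fun h => if h == s - a then - 2 * (a - s) ^- 3 else ((a - s) ^+ 2 * (a - s + h))^-1).
split.
  have : cont (fun h : C^o => ((a - s) ^+ 2 * (a - s + h))^-1) 0.
    apply: contV; first by rewrite addr0 mulf_neq0 // expf_eq0.
    apply: contM; first exact: contc.
    by apply: contD; [exact: contc|exact: contid].
  have sa0 : 0 != s - a by rewrite eq_sym subr_eq0 eq_sym.
  move=> /contCP H; apply/contCP => e /H[d d0 Hd].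
  exists (Num.min d (nm (s - a))); first by rewrite lt_min d0 nm_gt0 eq_sym.
  move=> z; rewrite lt_min subr0 (negbTE sa0) => /andP[zd zs].
  case: eqVneq zs => [->|_ _]; first by rewrite ltxx.
  by apply: Hd; rewrite subr0.
move=> h; case: eqVneq => [->|h0].
  have -> : a + (s - a) - s = 0 by ring.
  by rewrite invr0; field.
have : a + h - s != 0 by apply: contra h0 => /eqP H; apply/eqP; rewrite -[LHS]subr0 -H; ring.
move=> H; field.
by rewrite c0 (addrAC a (- s)) H.
Qed.

Lemma has_expand2_prod (S : seq C) (a : C) : has_expand2 (fun z => \prod_(s <- S) (z - s)) a.
Proof.
elim: S => [|s S IH].
  by under eq_fun do rewrite big_nil; exact: has_expand2_cst.
under eq_fun do rewrite big_cons; apply: has_expand2M => //.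
by have := has_expand2_affine 1 s a; under eq_fun do rewrite mul1r.
Qed.

Let dot (z w : C) : R := complex.Re z * complex.Re w + complex.Im z * complex.Im w.

Let nmD_sqr z w : nm (z + w) ^+ 2 = nm z ^+ 2 + 2 * dot z w + nm w ^+ 2.
Proof. by rewrite !nm_sqr /dot !raddfD /=; ring. Qed.

Let dot_le z w : `|dot z w| <= nm z * nm w.
Proof.
rewrite -(@ler_pXn2r _ 2) ?nnegrE ?mulr_ge0 ?nm_ge0 //.
rewrite real_normK ?num_real // exprMn !nm_sqr /dot.
set a := complex.Re z; set b := complex.Im z; set c := complex.Re w; set d := complex.Im w.
have -> : (a ^+ 2 + b ^+ 2) * (c ^+ 2 + d ^+ 2) = (a * c + b * d) ^+ 2 + (a * d - b * c) ^+ 2 by ring.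
by rewrite lerDl sqr_ge0.
Qed.

(* Averaging over [h = t, -t, it, -it] kills the terms of degree 1 and 2 of the
   expansion of [u], so that [|u|^2 + e |z|^2] has no local maximum. *)
Lemma no_local_max (u : C^o -> C^o) (z0 : C) (e d : R) : has_expand2 u z0 -> 0 < e -> 0 < d ->
  exists2 h, nm h < d &
    nm (u z0) ^+ 2 + e * nm z0 ^+ 2 < nm (u (z0 + h)) ^+ 2 + e * nm (z0 + h) ^+ 2.
Proof.
move=> [a [k [/contCP kc uE]]] e0 d0.
(* Chosen so that with [eta = e / M] one has [8 * (nm (u z0) + nm a) * eta < e]: the four remainders
   together stay below [e * t ^+ 2]. *)
set M := 8 * nm (u z0) + 16 * nm a + 1.
have M0 : 0 < M by rewrite /M; have := nm_ge0 (u z0); have := nm_ge0 a; lra.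
have eM : 0 < e / M by rewrite divr_gt0.
have [d1 d10 H] := kc _ eM.
pose t := Num.min 1 (Num.min (d / 2) (d1 / 2)).
have t0 : 0 < t by rewrite /t !lt_min; lra.
have [t1 td td1] : [/\ t <= 1, t < d & t < d1].
  have : t <= 1 /\ t <= d / 2 /\ t <= d1 / 2.
    by rewrite /t !ge_min !lexx !orbT.
  by move=> [? [? ?]]; split; lra.
apply: contrapT => /forall2NP no.
have {}no h : nm h = t -> nm (u (z0 + h)) ^+ 2 + e * nm (z0 + h) ^+ 2 <= nm (u z0) ^+ 2 + e * nm z0 ^+ 2.
  by move=> ht; case: (no h) => [|/negP]; [rewrite ht td|rewrite -leNgt].
have {}H h : nm h = t -> nm (k h - k 0) <= e / M.
  by move=> ht; apply/ltW/H; rewrite subr0 ht.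
pose T : C := t%:C%C.
have nT : nm T = t by rewrite nmR gtr0_norm.
have nT2 : nm (imC * T) = t by rewrite nmM nm_imC mul1r.
have nN : nm (- T) = t by rewrite nmN.
have nN2 : nm (- (imC * T)) = t by rewrite nmN.
have := no _ nT; have := no _ nT2; have := no _ nN; have := no _ nN2.
have := H _ nT; have := H _ nT2; have := H _ nN; have := H _ nN2.
rewrite !uE.
set k1 := k T; set k2 := k (imC * T); set k3 := k (- T); set k4 := k (- (imC * T)).
set k0 := k 0; move=> K4 K3 K2 K1.
have iT2 : (imC * T) ^+ 2 = - T ^+ 2 by rewrite exprMn [imC ^+ 2]imC2 mulN1r.
rewrite !sqrrN iT2 !mulNr !mulrN.
set U := u z0; set A := a * T; have -> : a * (imC * T) = imC * A by rewrite /A; ring.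
have nA : nm A <= nm a.
  by rewrite nmM nT ler_piMr ?nm_ge0.
have dotT (x y : C) : dot x (T ^+ 2 * y) = t ^+ 2 * dot x y.
  by rewrite -rmorphXn /dot; case: y => y1 y2 /=; ring.
have dotB (x y z : C) : dot x (y - z) = dot x y - dot x z by rewrite /dot !raddfB /=; ring.
have dotN (x y : C) : dot x (- y) = - dot x y by rewrite /dot !raddfN /=; ring.
have dotD (x y z : C) : dot (x + y) z = dot x z + dot y z by rewrite /dot !raddfD /=; ring.
have dotNl (x y : C) : dot (- x) y = - dot x y by rewrite /dot !raddfN /=; ring.
have t2 : 0 < t ^+ 2 by rewrite exprn_gt0.
set eta := e / M; have eta0 : 0 < eta := eM.
have err (x k' : C) : nm (k' - k0) <= eta -> `|dot x k' - dot x k0| <= nm x * eta.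
  by move=> kk; rewrite -dotB; apply: le_trans (dot_le _ _) _; rewrite ler_wpM2l ?nm_ge0.
have plus (x k' : C) : nm (k' - k0) <= eta -> nm x <= nm U + nm a ->
    nm x ^+ 2 + 2 * t ^+ 2 * (dot x k0 - (nm U + nm a) * eta) <= nm (x + T ^+ 2 * k') ^+ 2.
  move=> /(err x); rewrite ler_norml => /andP[h1 h2] hx; rewrite nmD_sqr dotT.
  have hxe : nm x * eta <= (nm U + nm a) * eta by rewrite ler_pM2r.
  have := sqr_ge0 (nm (T ^+ 2 * k')).
  have : 0 <= t ^+ 2 * (dot x k' - (dot x k0 - (nm U + nm a) * eta)).
    by apply: mulr_ge0; [exact: ltW|lra].
  lra.
have minus (x k' : C) : nm (k' - k0) <= eta -> nm x <= nm U + nm a ->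
    nm x ^+ 2 + 2 * t ^+ 2 * (- dot x k0 - (nm U + nm a) * eta) <= nm (x - T ^+ 2 * k') ^+ 2.
  move=> /(err x); rewrite ler_norml => /andP[h1 h2] hx; rewrite nmD_sqr dotN dotT nmN.
  have hxe : nm x * eta <= (nm U + nm a) * eta by rewrite ler_pM2r.
  have := sqr_ge0 (nm (T ^+ 2 * k')).
  have : 0 <= t ^+ 2 * (dot x k0 + (nm U + nm a) * eta - dot x k').
    by apply: mulr_ge0; [exact: ltW|lra].
  lra.
have nUA (x : C) : nm x <= nm a -> nm (U + x) <= nm U + nm a.
  by move=> xa; apply: le_trans (nmD _ _) _; rewrite lerD2l.
have niA : nm (imC * A) <= nm a by rewrite nmM nm_imC mul1r.
have nNA : nm (- A) <= nm a by rewrite nmN.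
have nNiA : nm (- (imC * A)) <= nm a by rewrite nmN.
(* In the sum of the four inequalities the first-order terms cancel in opposite pairs, the terms in
   [k0] cancel because [(imC * T) ^+ 2 = - T ^+ 2], and the added quadratic term gains
   [4 * e * t ^+ 2], more than the remainders can absorb. *)
move=> B4 B3 B2 B1.
have := le_trans (lerD (plus _ _ K1 (nUA _ nA)) (lexx (e * nm (z0 + T) ^+ 2))) B1.
have := le_trans (lerD (minus _ _ K2 (nUA _ niA)) (lexx (e * nm (z0 + imC * T) ^+ 2))) B2.
have := le_trans (lerD (plus _ _ K3 (nUA _ nNA)) (lexx (e * nm (z0 - T) ^+ 2))) B3.
have := le_trans (lerD (minus _ _ K4 (nUA _ nNiA)) (lexx (e * nm (z0 - imC * T) ^+ 2))) B4.
rewrite !nmD_sqr !nmN !dotD !dotNl !dotN nT nT2.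
have -> : nm (imC * A) = nm A by rewrite nmM nm_imC mul1r.
have : 8 * (nm U + nm a) * eta < e.
  rewrite /eta mulrA ltr_pdivrMr // mulrC ltr_pM2l // /M -/U.
  by have := nm_ge0 U; have := nm_ge0 a; lra.
rewrite -(ltr_pM2l t2) => He.
have e4 : 0 < e * t ^+ 2 by rewrite mulr_gt0.
have := sqr_ge0 (nm A).
lra.
Qed.

(** * The maximum principle on a square *)

Definition inside (r : R) (z : C) := `|complex.Re z| < r /\ `|complex.Im z| < r.

Lemma inside_square r z : inside r z -> square r z.
Proof. by move=> [? ?]; split; exact: ltW. Qed.

Lemma square_max (u : C^o -> C^o) (r e : R) : 0 < r ->
  (forall z, square r z -> cont u z) ->
  exists2 z0, square r z0 & forall z, square r z ->
    nm (u z) ^+ 2 + e * nm z ^+ 2 <= nm (u z0) ^+ 2 + e * nm z0 ^+ 2.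
Proof.
move=> r0 uc.
pose phi (p : R * R) : R := let z := mkC p.1 p.2 in nm (u z) ^+ 2 + e * nm z ^+ 2.
pose A : set (R * R) := `[- r, r] `*` `[- r, r].
have AE p : A p <-> square r (mkC p.1 p.2).
  by rewrite /A /square /= !in_itv /= !ler_norml.
have nmcont (v : C^o -> C^o) (p : R * R) : cont v (mkC p.1 p.2) ->
    {for p, continuous (fun q : R * R => nm (v (mkC q.1 q.2)) : R)}.
  move=> /contCP vc; apply/(@cvgrPdist_lt _ R) => eps /vc[d d0 H].
  have d2 : 0 < d / 2 by rewrite divr_gt0.
  exists (ball p.1 (d / 2), ball p.2 (d / 2)); first by split; exact: nbhsx_ballx.
  move=> q [/= q1 q2]; rewrite /ball /= in q1 q2.
  have {}H : nm (v (mkC q.1 q.2) - v (mkC p.1 p.2)) < eps.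
    apply: H; apply: le_lt_trans (nm_ReIm _) _ => /=.
    by rewrite [`|q.1 - _|]distrC [`|q.2 - _|]distrC; lra.
  apply: le_lt_trans H; rewrite ler_norml.
  have := nmBD (v (mkC q.1 q.2)) (v (mkC p.1 p.2)).
  have := nmBD (v (mkC p.1 p.2)) (v (mkC q.1 q.2)); rewrite nmB; lra.
have phic : {within A, continuous phi}.
  apply: continuous_in_subspaceT => p /set_mem /AE /uc up.
  have c1 := nmcont u p up; have c2 := nmcont id p (@contid _).
  have ce : {for p, continuous (fun=> e : R)} by exact: cst_continuous.
  exact: (continuousD (continuousM c1 c1) (continuousM ce (continuousM c2 c2))).
have A0 : A !=set0 by exists (0, 0); rewrite /A /= in_itv /= oppr_le0 ltW.
have Ac : compact A by apply: compact_setX; exact: segment_compact.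
have [[x y] /set_mem/AE xyA H] := compact_EVT_max A0 Ac phic.
exists (mkC x y) => // z; rewrite -(mkC_eta z) => zr.
by apply: (H (complex.Re z, complex.Im z)); apply/mem_set/AE.
Qed.

Lemma square_nm r z : square r z -> nm z <= 2 * r.
Proof. by move=> [? ?]; apply: le_trans (nm_ReIm z) _; lra. Qed.

(** If [u] exceeded [M], a small multiple of [nm z ^+ 2] could be added while keeping the maximum
    inside, against [no_local_max]. A zero of [u] cannot be that maximum, so no expansion is asked
    for there; [max_modulus] produces such zeros on purpose. *)
Lemma max_modulus0 (u : C^o -> C^o) (r M : R) : 0 < r -> 0 <= M ->
  (forall z, square r z -> cont u z) ->
  (forall z, inside r z -> has_expand2 u z \/ u z = 0) ->
  (forall z, square r z -> ~ inside r z -> nm (u z) <= M) ->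
  forall z, square r z -> nm (u z) <= M.
Proof.
move=> r0 M0 uc uexp ubd z zr; rewrite leNgt; apply/negP => Mz.
have Mz2 : M ^+ 2 < nm (u z) ^+ 2 by rewrite ltr_pXn2r ?nnegrE ?nm_ge0.
(* As [nm w <= 2 * r] on the square, the added term is at most half of the gap
   [nm (u z) ^+ 2 - M ^+ 2]. *)
pose e := (nm (u z) ^+ 2 - M ^+ 2) / (8 * r ^+ 2).
have r2 : 0 < 8 * r ^+ 2 by rewrite mulr_gt0 ?exprn_gt0.
have e0 : 0 < e by rewrite divr_gt0 // subr_gt0.
have er : e * (8 * r ^+ 2) = nm (u z) ^+ 2 - M ^+ 2 by rewrite divfK ?gt_eqF.
have [z0 z0r z0max] := square_max e r0 uc.
have zz0 := z0max _ zr.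
have ez : 0 <= e * nm z ^+ 2 by rewrite mulr_ge0 ?sqr_ge0 ?ltW.
have ez0 : e * nm z0 ^+ 2 <= e * (4 * r ^+ 2).
  rewrite ler_pM2l //; have -> : 4 * r ^+ 2 = (2 * r) ^+ 2 by ring.
  by rewrite ler_pXn2r ?nnegrE ?nm_ge0 ?square_nm // mulr_ge0 ?ltW.
have z0in : inside r z0.
  apply: contrapT => /(ubd _ z0r) b.
  have : nm (u z0) ^+ 2 <= M ^+ 2 by rewrite ler_pXn2r ?nnegrE ?nm_ge0.
  lra.
have [z0e|uz0] := uexp _ z0in; last first.
  by move: zz0; rewrite uz0 nm0 expr0n /=; have := sqr_ge0 M; lra.
pose d := Num.min (r - `|complex.Re z0|) (r - `|complex.Im z0|).
have d0 : 0 < d by case: z0in => ? ?; rewrite lt_min; lra.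
have [h hd] := no_local_max z0e e0 d0.
rewrite ltNge z0max //.
move: hd; rewrite lt_min => /andP[hx hy]; have := nm_Re h; have := nm_Im h => hi hr.
split; rewrite raddfD; apply: le_trans (ler_normD _ _) _; lra.
Qed.

(** If [M < x], the powers of [x / M] are unbounded by Bernoulli's inequality. The exponents start
    at 1, so that the case [M = 0] is covered too. *)
Lemma geometric_domination (x c M D : R) : 0 < c -> 0 <= M ->
  (forall n, x ^+ n.+1 * c <= M ^+ n.+1 * D) -> x <= M.
Proof.
move=> c0 M0 H; rewrite leNgt; apply/negP => Mx.
have x0 : 0 < x by exact: le_lt_trans Mx.
have D0 : 0 < D.
  rewrite ltNge; apply/negP => D0; have := H 0%N; rewrite !expr1.
  by have := mulr_gt0 x0 c0; have := mulr_ge0_le0 M0 D0; lra.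
have [/eqP M0'|M0'] := boolP (M == 0).
  by have := H 0%N; rewrite M0' !expr1 mul0r; have := mulr_gt0 x0 c0; lra.
have {M0'}M0 : 0 < M by rewrite lt_neqAle eq_sym M0'.
pose q := x / M; have q1 : 0 < q - 1 by rewrite subr_gt0 ltr_pdivlMr ?mul1r.
have bern n : 1 + n%:R * (q - 1) <= q ^+ n.
  elim: n => [|n IH]; first by rewrite mul0r addr0.
  rewrite exprS -natr1; apply: le_trans (_ : q * (1 + n%:R * (q - 1)) <= _).
    by have : 0 <= n%:R * (q - 1) ^+ 2; [rewrite mulr_ge0 ?sqr_ge0|lra].
  by rewrite ler_pM2l // divr_gt0.
have H' n : q ^+ n.+1 <= D / c.
  rewrite ler_pdivlMr // /q expr_div_n mulrAC ler_pdivrMr ?exprn_gt0 //.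
  by rewrite [D * _]mulrC.
have [n nP] : exists n, (D / c) / (q - 1) < n%:R.
  by exists (Num.bound (D / c / (q - 1))); apply: archi_boundP; rewrite divr_ge0 ?ltW ?divr_gt0.
have := H' n; apply/negP; rewrite -ltNge; apply: lt_le_trans (bern _).
move: nP; rewrite ltr_pdivrMr // => nP; rewrite -natr1; nra.
Qed.

Lemma dnbhs_notin (S : seq C) (z : C) : \forall w \near (z : C^o)^', w \notin S.
Proof.
elim: S => [|s S IH]; first exact: filterE.
have : \forall w \near (z : C^o)^', w != s.
  have [->|sz] := eqVneq s z; first by apply/nbhsCP; exists 1.
  apply/nbhsCP; exists (nm (s - z)); first by rewrite nm_gt0 subr_eq0.
  by move=> w ws _; apply: contraTneq ws => ->; rewrite ltxx.
by move=> ns; apply: filterS2 ns IH => w ws wS; rewrite inE negb_or ws.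
Qed.

(* At the points of [S] only continuity is assumed: these are handled by applying
   the previous case to [u ^+ N] times the polynomial with roots [S], and letting
   [N] tend to infinity. *)
Lemma max_modulus (u : C^o -> C^o) (S : seq C) (r M : R) : 0 < r -> 0 <= M ->
  (forall z, square r z -> cont u z) ->
  (forall z, inside r z -> z \notin S -> has_expand2 u z) ->
  (forall z, square r z -> ~ inside r z -> nm (u z) <= M) ->
  forall z, square r z -> nm (u z) <= M.
Proof.
move=> r0 M0 uc uexp ubd z zr.
have [zin|] := pselect (inside r z); last exact: ubd.
pose p (w : C) := \prod_(s <- S) (w - s).
have p0 w : w \notin S -> p w != 0.
  move=> wS; rewrite /p prodf_seq_neq0; apply/allP => s sS.
  by rewrite subr_eq0 implyTb; apply: contraNneq wS => ->.
pose D : R := \prod_(s <- S) (2 * r + nm s).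
have D0 : 0 <= D by apply: prodr_ge0 => s _; rewrite addr_ge0 ?nm_ge0 // mulr_ge0 ?ltW.
have pD w : square r w -> nm (p w) <= D.
  move=> wr; rewrite /p /D; elim: (S) => [|s T IH]; first by rewrite !big_nil nm1.
  rewrite !big_cons nmM ler_pM ?nm_ge0 //.
  by apply: le_trans (nmD _ _) _; rewrite nmN lerD2r square_nm.
have bound w : square r w -> w \notin S -> nm (u w) <= M.
  move=> wr wS; apply: (@geometric_domination _ (nm (p w)) _ D) => //.
    by rewrite nm_gt0 p0.
  move=> n; rewrite -nmX -nmM.
  refine (@max_modulus0 (fun w => u w ^+ n.+1 * p w) r _ r0 _ _ _ _ w wr).
  - by rewrite mulr_ge0 // exprn_ge0.
  - move=> v vr; apply: contM; first by apply: contX; exact: (uc _ vr).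
    by have [l] := has_expand2_prod S v => /has_expand2_cdiff/cdiff_continuous.
  - move=> v vr; have [vS|vS] := boolP (v \in S).
      right; rewrite /p (big_rem v) //= subrr mul0r mulr0 //.
    by left; apply: has_expand2M; [apply: has_expand2X; exact: uexp|exact: has_expand2_prod].
  - move=> v vr vb; rewrite nmM nmX ler_pM ?exprn_ge0 ?nm_ge0 ?pD //.
    by rewrite lerXn2r ?nnegrE ?nm_ge0 ?ubd.
(* The bound holds off [S] and reaches the points of [S] by continuity, since every punctured
   neighbourhood contains points outside the finite [S]. *)
apply/ler_addgt0Pr => e e0.
have /contCP/(_ _ e0)[d d0 H] := uc _ zr.
have : \forall w \near (z : C^o)^', [/\ w \notin S, square r w & nm (u w - u z) < e].
  near=> w; split; near: w; first exact: dnbhs_notin.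
    apply/nbhsCP; case: zin => zx zy.
    exists (Num.min (r - `|complex.Re z|) (r - `|complex.Im z|)); first by rewrite lt_min; lra.
    move=> w; rewrite lt_min => /andP[w1 w2] _.
    have := nm_Re (w - z); have := nm_Im (w - z); rewrite !raddfB.
    have := ler_normD (complex.Re w - complex.Re z) (complex.Re z).
    have := ler_normD (complex.Im w - complex.Im z) (complex.Im z).
    rewrite !subrK /square /=; lra.
  by apply/nbhsCP; exists d => // w wd _; exact: H.
have PF : ProperFilter (z : C^o)^' := @Proper_dnbhs_regular_numFieldType C z.
move=> nz; have [w [wS wr we]] := filter_ex nz.
have := bound _ wr wS; have := nmBD (u z) (u w); rewrite nmB; lra.
Unshelve. all: by end_near. Qed.

Lemma cont_near (f g : C^o -> C^o) (a : C) (d : R) : 0 < d ->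
  (forall z, nm (z - a) < d -> f z = g z) -> cont f a -> cont g a.
Proof.
move=> d0 fg /contCP fc; apply/contCP => e /fc[d' d'0 H].
exists (Num.min d d'); first by rewrite lt_min d0.
move=> z; rewrite lt_min => /andP[zd zd']; rewrite -!fg ?subrr ?nm0 //.
exact: H.
Qed.

Lemma cont_punctured_eq (f g : C^o -> C^o) (a : C) (d : R) : 0 < d ->
  (forall z, nm (z - a) < d -> z != a -> f z = g z) -> cont f a -> cont g a -> f a = g a.
Proof.
move=> d0 fg fc gc; apply/eqP; rewrite -subr_eq0 -nm_eq0 eq_le nm_ge0 andbT.
apply/ler_addgt0Pr => e e0; rewrite add0r.
have e2 : 0 < e / 2 by rewrite divr_gt0.
have /contCP/(_ _ e2)[d1 d10 H1] := fc; have /contCP/(_ _ e2)[d2 d20 H2] := gc.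
pose t := Num.min d (Num.min d1 d2).
have t0 : 0 < t by rewrite !lt_min d0 d10.
pose z : C := a + (t / 2)%:C%C.
have za : nm (z - a) = t / 2 by rewrite /z addrC addKr nmR gtr0_norm ?divr_gt0.
have : nm (z - a) < t by rewrite za; lra.
rewrite !lt_min => /and3P[zd zd1 zd2].
have zneqa : z != a by rewrite -subr_eq0 -nm_gt0 za divr_gt0.
have h1 := H1 _ zd1; have h2 := H2 _ zd2; rewrite (fg _ zd zneqa) in h1.
have -> : f a - g a = (g z - g a) - (g z - f a) by ring.
by apply: le_trans (nmD _ _) _; rewrite nmN; lra.
Qed.

Lemma cdiff_unique f (a l m : C) : cdiff f a l -> cdiff f a m -> l = m.
Proof.
move=> [g [gc <- fg]] [h [hc <- fh]].
apply: (@cont_punctured_eq g h a 1) => // z _ za.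
apply: (@mulfI _ (z - a)); first by rewrite subr_eq0.
by apply: (@addrI _ (f a)); rewrite -fg.
Qed.

Lemma expand2_near (f g : C^o -> C^o) (a l : C) (d : R) : 0 < d ->
  (forall z, nm (z - a) < d -> f z = g z) -> expand2 f a l -> expand2 g a l.
Proof.
move=> d0 fg [k [kc fE]].
exists (fun h => if nm h < d then k h else (g (a + h) - g a - l * h) / h ^+ 2); split.
  apply: cont_near d0 _ kc => z; by rewrite subr0 => ->.
move=> h; case: ifP => hd; first by rewrite -!fg ?fE ?subrr ?nm0 // addrC addKr.
have h0 : h != 0 by apply: contraFneq hd => ->; rewrite nm0.
by rewrite mulrCA divff ?expf_eq0 // mulr1; ring.
Qed.

(** * Divided differences and their bounds *)

Lemma slope_sub (u g : C^o -> C^o) (b w : C) : (forall w, u w = u b + (w - b) * g w) ->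
  u w - u b = (w - b) * g w.
Proof. by move=> uE; rewrite {1}uE addrC addKr. Qed.

Lemma slope_cont (u g : C^o -> C^o) (b z : C) : (forall w, u w = u b + (w - b) * g w) ->
  z != b -> cont u z -> cont g z.
Proof.
move=> uE zb uc; apply: (@cont_near (fun w => (u w - u b) / (w - b)) _ z (nm (z - b))).
- by rewrite nm_gt0 subr_eq0.
- move=> w; rewrite (slope_sub w uE); have [->|wb _] := eqVneq w b.
    by rewrite nmB ltxx.
  by rewrite mulrAC divff ?mul1r // subr_eq0.
- apply: contM; first exact: (contB uc (@contc (u b) z)).
  apply: contV; first by rewrite subr_eq0.
  exact: (contB (@contid z) (@contc b z)).
Qed.

Lemma slope_has_expand2 (u g : C^o -> C^o) (b z : C) : (forall w, u w = u b + (w - b) * g w) ->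
  z != b -> has_expand2 u z -> has_expand2 g z.
Proof.
move=> uE zb ue.
have [l Hl] : has_expand2 (fun w => (u w - u b) * (w - b)^-1) z.
  apply: has_expand2M; last exact: has_expand2_subV.
  by apply: has_expand2B => //; exact: has_expand2_cst.
exists l; apply: (@expand2_near _ _ _ _ (nm (z - b))) Hl.
  by rewrite nm_gt0 subr_eq0.
move=> w; rewrite (slope_sub w uE); have [->|wb _] := eqVneq w b.
  by rewrite nmB ltxx.
by rewrite mulrAC divff ?mul1r // subr_eq0.
Qed.

(** The boundary is at distance at least [r / 2] from [b], so the quotient is at most
    [2 * K / (r / 2)] there, and the maximum principle carries this inside. At [b] only continuity
    of [g] is known, which is why [b] joins the exceptional points. *)
Lemma slope_bound (u g : C^o -> C^o) (S : seq C) (r K : R) (b : C) : 0 < r ->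
  (forall z, square r z -> cont u z) ->
  (forall z, inside r z -> z \notin S -> has_expand2 u z) ->
  (forall z, square r z -> nm (u z) <= K) ->
  square (r / 2) b -> (forall z, u z = u b + (z - b) * g z) -> cont g b ->
  [/\ forall z, square r z -> cont g z,
      forall z, inside r z -> z \notin b :: S -> has_expand2 g z &
      forall z, square r z -> nm (g z) <= 4 * K / r].
Proof.
move=> r0 uc ue uK bs uE gb.
have bsq : square r b by case: bs => ? ?; split; lra.
have K0 : 0 <= K by apply: le_trans (uK _ bsq); exact: nm_ge0.
have gc z : square r z -> cont g z.
  move=> zr; have [->|zb] := eqVneq z b; first exact: gb.
  exact: slope_cont uE zb (uc _ zr).
have ge z : inside r z -> z \notin b :: S -> has_expand2 g z.
  move=> zr; rewrite inE negb_or => /andP[zb zS].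
  exact: slope_has_expand2 uE zb (ue _ zr zS).
split => //; apply: (@max_modulus g (b :: S) r _ r0 _ gc ge).
  by apply: divr_ge0; [rewrite mulr_ge0|exact: ltW].
move=> z zr zb.
have zbr : r / 2 <= nm (z - b).
  have [zx|zx] := ltP `|complex.Re z| r.
    have zy : r <= `|complex.Im z| by rewrite leNgt; apply/negP => zy; apply: zb.
    apply: le_trans (nm_Im _); rewrite raddfB; case: bs => _ by2.
    have := ler_normD (complex.Im z - complex.Im b) (complex.Im b); rewrite subrK; lra.
  apply: le_trans (nm_Re _); rewrite raddfB; case: bs => by2 _.
  have := ler_normD (complex.Re z - complex.Re b) (complex.Re b); rewrite subrK; lra.
have zb0 : 0 < nm (z - b) by lra.
have -> : nm (g z) = nm (u z - u b) / nm (z - b).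
  by rewrite (slope_sub z uE) nmM mulrAC divff ?mul1r // gt_eqF.
rewrite ler_pdivrMr //; apply: le_trans (nmD _ _) _; rewrite nmN.
have := uK _ zr; have := uK _ bsq => h1 h2.
have : 4 * K / r * (r / 2) <= 4 * K / r * nm (z - b).
  by rewrite ler_wpM2l // divr_ge0 ?mulr_ge0 // ltW.
have -> : 4 * K / r * (r / 2) = K + K by field; rewrite gt_eqF.
lra.
Qed.

(** A Cauchy criterion with an explicit rate: the limit at 0 is the supremum of the lower bounds
    [q b - K * nm b]. *)
Lemma limit_of_lipschitz_bound (q : C -> R) (K d : R) : 0 < d ->
  (forall b w, b != 0 -> w != 0 -> nm b < d -> nm w < d -> `|q b - q w| <= K * (nm b + nm w)) ->
  exists l, forall b, b != 0 -> nm b < d -> `|q b - l| <= K * nm b.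
Proof.
move=> d0 H.
pose A : set R := [set x | exists b, [/\ b != 0, nm b < d & x = q b - K * nm b]].
have ub b w : b != 0 -> w != 0 -> nm b < d -> nm w < d -> q b - K * nm b <= q w + K * nm w.
  by move=> b0 w0 bd wd; have := H _ _ b0 w0 bd wd; rewrite ler_norml; lra.
pose c : C := (d / 2)%:C%C.
have nc : nm c = d / 2 by rewrite nmR gtr0_norm ?divr_gt0.
have c0 : c != 0 by rewrite -nm_gt0 nc divr_gt0.
have cd : nm c < d by rewrite nc; lra.
have A0 : A !=set0 by exists (q c - K * nm c), c.
have Aub : has_ubound A by exists (q c + K * nm c) => _ [b [b0 bd ->]]; exact: ub.
exists (sup A) => b b0 bd; rewrite ler_norml; apply/andP; split.
  have : sup A <= q b + K * nm b by apply: ge_sup => // _ [w [w0 wd ->]]; exact: ub.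
  lra.
have : q b - K * nm b <= sup A by apply: ub_le_sup => //; exists b.
lra.
Qed.

(** The class within which division by [z] can be repeated: the quotient [(u z - u 0) / z] keeps its
    expansions away from 0, but at 0 only differentiability is recovered. *)
Definition almost_regular (r : R) (u : C^o -> C^o) :=
  [/\ forall z, square r z -> cont u z,
      forall z, inside r z -> z != 0 -> has_expand2 u z & exists l, cdiff u 0 l].

Lemma square_bounded (u : C^o -> C^o) (r : R) : 0 < r -> (forall z, square r z -> cont u z) ->
  exists K, forall z, square r z -> nm (u z) <= K.
Proof.
move=> r0 uc; have [z0 z0r H] := square_max 0 r0 uc; exists (nm (u z0)) => z zr.
by have := H z zr; rewrite !mul0r !addr0 ler_pXn2r ?nnegrE ?nm_ge0.
Qed.

Lemma nm_square (r : R) (z : C) : nm z <= r -> square r z.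
Proof. by move=> zr; split; apply: le_trans zr; [exact: nm_Re|exact: nm_Im]. Qed.

Lemma nm_inside (r : R) (z : C) : nm z < r -> inside r z.
Proof. by move=> zr; split; apply: le_lt_trans zr; [exact: nm_Re|exact: nm_Im]. Qed.

(* All the divided differences of [u] are bounded, by the maximum principle. *)
Lemma almost_regular_slope (r : R) (u g : C^o -> C^o) : 0 < r -> almost_regular r u ->
  (forall z, u z = u 0 + z * g z) -> cont g 0 ->
  almost_regular r g /\ exists K, forall b z, square (r / 2) b -> b != 0 -> square r z ->
    nm (g z - g b) <= K * nm (z - b).
Proof.
move=> r0 [uc ue _] uE gc0.
have [K uK] := square_bounded r0 uc.
have ue0 z : inside r z -> z \notin [::] -> z != 0 -> has_expand2 u z by move=> ? _; exact: ue.
have s0 : square (r / 2) 0 by apply: nm_square; rewrite nm0; lra.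
have ue1 z : inside r z -> z \notin [:: 0 : C] -> has_expand2 u z by rewrite inE; exact: ue.
have uE0 z : u z = u 0 + (z - 0) * g z by rewrite subr0.
have [gc ge gK] := slope_bound r0 uc ue1 uK s0 uE0 gc0.
(* Bounds for the first, second and third divided differences of [u], taken at 0, then [b], then
   [w]. *)
pose K1 := 4 * K / r; pose K2 := 4 * K1 / r; pose K3 := 4 * K2 / r.
have ge1 z : inside r z -> z \notin [:: 0 : C] -> has_expand2 g z.
  by rewrite inE => zr z0; apply: ge => //; rewrite !inE orbb.
have second b : square (r / 2) b -> b != 0 -> exists gb : C^o -> C^o,
  [/\ forall z, g z = g b + (z - b) * gb z, cont gb b,
      forall z, square r z -> cont gb z,
      forall z, inside r z -> z \notin [:: b; 0] -> has_expand2 gb z &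
      forall z, square r z -> nm (gb z) <= K2].
  move=> bs b0.
  have [l /has_expand2_cdiff[gb [gbc _ gbE]]] : has_expand2 g b.
    by apply: ge1; [case: bs => ? ?; split; lra|rewrite inE].
  by have [h1 h2 h3] := slope_bound r0 gc ge1 gK bs gbE gbc; exists gb.
have third b w : square (r / 2) b -> b != 0 -> square (r / 2) w -> w != 0 -> b != w ->
  nm ((g b - g 0) / b - (g w - g b) / (w - b)) <= K3 * nm w.
  move=> bs b0 ws w0 bw; have [gb [gbE gbb gbc gbe gbK]] := second _ bs b0.
  have [l /has_expand2_cdiff[gw [gwc _ gwE]]] : has_expand2 gb w.
    by apply: gbe; [case: ws => ? ?; split; lra|rewrite !inE negb_or eq_sym bw].
  have [_ _ gwK] := slope_bound r0 gbc gbe gbK ws gwE gwc.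
  have -> : (g b - g 0) / b = gb 0.
    by rewrite (gbE 0); field.
  have -> : (g w - g b) / (w - b) = gb w.
    by rewrite (gbE w); field; rewrite subr_eq0 eq_sym.
  have := slope_sub 0 gwE; rewrite sub0r => ->.
  rewrite nmM nmN mulrC ler_wpM2r ?nm_ge0 //.
  by apply: gwK; apply: nm_square; rewrite nm0 ltW.
pose q (b : C) := (g b - g 0) / b.
have qcauchy b w : b != 0 -> w != 0 -> nm b < r / 2 -> nm w < r / 2 ->
    nm (q b - q w) <= K3 * (nm b + nm w).
  move=> b0 w0 br wr.
  have bs : square (r / 2) b by apply: nm_square; exact: ltW.
  have ws : square (r / 2) w by apply: nm_square; exact: ltW.
  have [->|bw] := eqVneq b w.
    have K30 : 0 <= K3.
      rewrite /K3 /K2 /K1; have K0 : 0 <= K by apply: le_trans (uK 0 _); [exact: nm_ge0|apply: nm_square; rewrite nm0 ltW].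
      by rewrite !(divr_ge0, mulr_ge0) // ltW.
    by rewrite subrr nm0 mulr_ge0 // addr_ge0 ?nm_ge0.
  have h1 := third b w bs b0 ws w0 bw.
  have h2 := third w b ws w0 bs b0; rewrite eq_sym in h2; have {}h2 := h2 bw.
  (* Divided differences are symmetric: [(g w - g b) / (w - b)] is inserted between [q b] and [q w],
     and [third] bounds both gaps. *)
  have -> : q b - q w = ((g b - g 0) / b - (g w - g b) / (w - b)) - ((g w - g 0) / w - (g b - g w) / (b - w)).
    have -> : (g b - g w) / (b - w) = (g w - g b) / (w - b).
      by rewrite -(opprB (g w)) -(opprB w) invrN mulrNN.
    by rewrite /q; ring.
  apply: le_trans (nmD _ _) _; rewrite nmN; lra.
have r2 : 0 < r / 2 by lra.
have [|l1 l1P] := @limit_of_lipschitz_bound (fun b => complex.Re (q b)) K3 _ r2.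
  move=> b w b0 w0 br wr; apply: le_trans (qcauchy b w b0 w0 br wr).
  by rewrite -raddfB; exact: nm_Re.
have [|l2 l2P] := @limit_of_lipschitz_bound (fun b => complex.Im (q b)) K3 _ r2.
  move=> b w b0 w0 br wr; apply: le_trans (qcauchy b w b0 w0 br wr).
  by rewrite -raddfB; exact: nm_Im.
pose l := mkC l1 l2.
have ql b : b != 0 -> nm b < r / 2 -> nm (q b - l) <= 2 * K3 * nm b.
  move=> b0 br; apply: le_trans (nm_ReIm _) _; rewrite !raddfB /=.
  have := l1P b b0 br; have := l2P b b0 br; lra.
split; last first.
  exists K2 => b z bs b0 zr; have [gb [gbE _ _ _ gbK]] := second _ bs b0.
  rewrite (slope_sub z gbE) nmM mulrC; apply: ler_wpM2r; [exact: nm_ge0|exact: gbK].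
split => //; first by move=> z zr z0; apply: ge1 => //; rewrite inE.
exists l, (fun z => if z == 0 then l else q z); split; last 2 first.
- by rewrite eqxx.
- move=> z; rewrite subr0; case: eqVneq => [->|z0]; first by rewrite mul0r addr0.
  by rewrite /q mulrCA divff // mulr1 addrC subrK.
apply/contCP => e e0; pose K' := `|2 * K3| + 1.
have K'0 : 0 < K' by rewrite ltr_wpDl.
exists (Num.min (r / 2) (e / K')); first by rewrite lt_min r2 divr_gt0.
move=> z; rewrite subr0 lt_min eqxx => /andP[z1 z2].
case: eqVneq => [_|z0]; first by rewrite subrr nm0.
apply: le_lt_trans (ql z z0 z1) _; move: z2; rewrite ltr_pdivlMr // mulrC.
apply: le_lt_trans; rewrite ler_wpM2r ?nm_ge0 // /K'; have := ler_norm (2 * K3); lra.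
Qed.

(** * Order of vanishing of a differentiable function *)

Lemma cdiffP f (a l : C) : cdiff f a l -> derivable f a 1.
Proof. by move=> fl; apply/derivableCP; exists l. Qed.

Lemma cdiff_near (f g : C^o -> C^o) (a l : C) (d : R) : 0 < d ->
  (forall z, nm (z - a) < d -> f z = g z) -> cdiff f a l -> cdiff g a l.
Proof.
move=> d0 fg fl; have [m gm] : exists m, cdiff g a m.
  apply/derivableCP; apply: near_eq_derivable (cdiffP fl).
  by apply/nbhsCP; exists d.
suff <- : m = l by [].
move: fl gm => [k [kc <- fE]] [k' [kc' <- gE]].
apply: (cont_punctured_eq d0) => // z zd za.
apply: (@mulfI _ (z - a)); first by rewrite subr_eq0.
by apply: (@addrI _ (g a)); rewrite -gE -!fg ?subrr ?nm0.
Qed.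

Lemma cdiffM (f g : C^o -> C^o) (a l m : C) : cdiff f a l -> cdiff g a m ->
  cdiff (fun z => f z * g z) a (l * g a + f a * m).
Proof.
move=> [k [kc <- fE]] [j [jc <- gE]].
exists (fun z => k z * g a + f a * j z + (z - a) * (k z * j z)); split.
- apply: contD; last by apply: contM; [exact: (contB (@contid a) (@contc a a))|exact: (contM kc jc)].
  exact: (contD (contM kc (@contc (g a) a)) (contM (@contc (f a) a) jc)).
- by rewrite subrr mul0r addr0.
- by move=> z; rewrite [f z]fE [g z]gE; ring.
Qed.

Lemma cdiffX n (a : C) : cdiff (fun z => z ^+ n) a (n%:R * a ^+ n.-1).
Proof.
elim: n => [|n IH].
  by exists (fun=> 0); split; [exact: contc|rewrite mul0r|move=> z; rewrite mulr0 addr0].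
have id1 : cdiff (fun z => z) a 1.
  by exists (fun=> 1); split; [exact: contc| |move=> z; rewrite mulr1 addrC subrK].
have := cdiffM id1 IH; have -> : 1 * a ^+ n + a * (n%:R * a ^+ n.-1) = n.+1%:R * a ^+ n.
  case: n {IH} => [|n]; first by rewrite !expr0 mul0r mulr0 addr0 !mul1r.
  by rewrite /= -[in RHS]natr1 exprS; ring.
by apply: cdiff_near (ltr01) _ => z _; rewrite exprS.
Qed.

Lemma cdiffD (f g : C^o -> C^o) (a l m : C) : cdiff f a l -> cdiff g a m ->
  cdiff (fun z => f z + g z) a (l + m).
Proof.
move=> [k [kc <- fE]] [j [jc <- gE]].
exists (fun z => k z + j z); split; [exact: (contD kc jc)|by []|].
by move=> z; rewrite [f z]fE [g z]gE; ring.
Qed.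

Lemma cdiff_bound f (a l : C) (K d : R) : 0 < d -> cdiff f a l ->
  (forall z, nm (z - a) < d -> nm (f z - f a) <= K * nm (z - a)) -> nm l <= K.
Proof.
move=> d0 [g [gc <- fE]] fK; apply/ler_addgt0Pr => e e0.
have /contCP/(_ _ e0)[d1 d10 H] := gc.
pose t := Num.min d d1; have t0 : 0 < t by rewrite lt_min d0.
pose z : C := a + (t / 2)%:C%C.
have za : nm (z - a) = t / 2 by rewrite /z addrC addKr nmR gtr0_norm ?divr_gt0.
have za0 : 0 < nm (z - a) by rewrite za divr_gt0.
have : nm (z - a) < t by rewrite za; lra.
rewrite lt_min => /andP[zd zd1].
have := fK _ zd; rewrite (slope_sub z fE) nmM mulrC ler_pM2r // => gK.
have := H _ zd1; rewrite nmB; have := nmBD (g a) (g z); lra.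
Qed.

(** Let [F] be the primitive of [f] with [F 0 = 0]. If division by [z] stops at [F = z ^+ m * h]
    with [h 0 != 0], then [f = F'] is [z ^+ m.-1] times a function with value [m * h 0] at 0, which
    is [k]. If it never stops, [F] is dominated by every power of [nm z / r] and vanishes near 0,
    hence so does [f]. *)
Lemma holomorphic_order0 (f : C^o -> C^o) (r : R) : 0 < r ->
  (forall z, square (2 * r) z -> exists l, cdiff f z l) ->
  (exists2 d, 0 < d & forall z, nm z < d -> f z = 0) \/
  exists (m : nat) (k : C^o -> C^o) (d : R), [/\ 0 < d, k 0 != 0,
    forall z, nm z < d -> exists l, cdiff k z l &
    forall z, nm z < d -> f z = z ^+ m * k z].
Proof.
move=> r0 fd; have r2 : 0 < 2 * r by rewrite mulr_gt0.
have [F0 F0E] := holomorphic_primitive r2 fd.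
pose F (z : C) := F0 z - F0 0.
have FE z : square r z -> expand2 F z (f z).
  move=> [zx zy]; have [||k [kc kE]] := F0E z; [lra|lra|].
  by exists k; split => // h; rewrite /F kE; ring.
have F00 : F 0 = 0 by rewrite /F subrr.
have sq z : nm z < r -> square r z by move=> zr; apply: nm_square; exact: ltW.
have ARF : almost_regular r F.
  split; first by move=> z /FE/has_expand2_cdiff/cdiff_continuous.
    by move=> z /inside_square/FE zE _; exists (f z).
  by exists (f 0); apply/has_expand2_cdiff/FE/sq; rewrite nm0.
(* The operator must be total: outside the class [almost_regular r] it returns [u] itself. *)
have /choice[next nextP] (u : C^o -> C^o) : exists g : C^o -> C^o, almost_regular r u ->
    [/\ forall z, u z = u 0 + z * g z, cont g 0 & almost_regular r g].
  have [uAR|] := pselect (almost_regular r u); last by exists u.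
  have [_ _ [l [g [gc _ gE]]]] := uAR.
  have gE0 z : u z = u 0 + z * g z by rewrite gE subr0.
  by exists g => _; have [gAR _] := almost_regular_slope r0 uAR gE0 gc.
pose G n := iter n next F.
have GAR n : almost_regular r (G n) by elim: n => //= n /nextP[].
have GE n z : G n z = G n 0 + z * G n.+1 z by have [] := nextP _ (GAR n).
have Gc n : cont (G n) 0.
  by have [c _ _] := GAR n; apply: c; apply: sq; rewrite nm0.
have [allz|/existsNP[m0 nz]] := pselect (forall n, G n 0 = 0).
  left; exists r => // z zr.
  have FG n w : F w = w ^+ n * G n w.
    elim: n => [|n IH]; first by rewrite expr0 mul1r.
    by rewrite IH GE allz add0r exprSr mulrA.
  have [K FK] : exists K, forall w, square r w -> nm (F w) <= K.
    by apply: square_bounded => // w; have [c _ _] := ARF; exact: c.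
  have F0z w : nm w < r -> F w = 0.
    move=> wr; apply/eqP; apply: contraTT wr => Fw; rewrite -leNgt.
    have [//|wr] := leP r (nm w).
    have Fw0 : 0 < nm (F w) by rewrite nm_gt0.
    suff : r <= nm w by rewrite leNgt wr.
    apply: (@geometric_domination _ _ _ K Fw0); first exact: nm_ge0.
    move=> n; have K0 : 0 <= K by apply: le_trans (FK 0 _); [exact: nm_ge0|apply: sq; rewrite nm0].
    have rn0 : 0 < r ^+ n.+1 by rewrite exprn_gt0.
    have ws := sq _ wr.
    (* On the boundary [r <= nm v], so [G n.+1] is at most [K / r ^+ n.+1] there, and hence at [w]
       by the maximum principle. *)
    rewrite mulrC -ler_pdivlMr // (FG n.+1 w) nmM nmX -mulrA ler_wpM2l ?exprn_ge0 ?nm_ge0 //.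
    have [Gcn Gen _] := GAR n.+1.
    refine (@max_modulus (G n.+1) [:: 0] r _ r0 _ Gcn _ _ w ws); first by rewrite divr_ge0 // ltW.
      by move=> v vr; rewrite inE; exact: Gen.
    move=> v vr vb; rewrite ler_pdivlMr //; apply: le_trans (FK v vr).
    have rv : r <= nm v by rewrite leNgt; apply/negP => /nm_inside.
    by rewrite (FG n.+1 v) nmM nmX mulrC ler_wpM2r ?nm_ge0 // lerXn2r ?nnegrE ?nm_ge0 ?(ltW r0).
  have rz : 0 < r - nm z by rewrite subr_gt0.
  apply: cdiff_unique (has_expand2_cdiff (FE _ (sq _ zr))) _.
  apply: (@cdiff_near (fun=> 0) _ _ _ _ rz).
    move=> w wz; rewrite F0z //; have := nmD (w - z) z; rewrite subrK; lra.
  by exists (fun=> 0); split; [exact: contc| |move=> w; rewrite mulr0 addr0].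
right; have exm : exists m, G m 0 != 0 by exists m0; apply/eqP.
have [m hm0 mmin] := ex_minnP exm.
have Gz n : (n < m)%N -> G n 0 = 0.
  by move=> nm; apply/eqP; apply: contraTT nm => /mmin; rewrite -leqNgt.
have FG n w : (n <= m)%N -> F w = w ^+ n * G n w.
  elim: n => [|n IH] nm; first by rewrite expr0 mul1r.
  by rewrite (IH (ltnW nm)) GE Gz // add0r exprSr mulrA.
have m_gt0 : (0 < m)%N by case: m hm0 {mmin Gz FG} => //; rewrite /= F00 eqxx.
set h := G m in hm0; set h1 := G m.+1.
have hE z : h z = h 0 + z * h1 z by exact: GE.
have [h1AR [K2 h1K]] := almost_regular_slope r0 (GAR m) hE (Gc _).
have [hc he _] := GAR m.
have [h1c h1e _] := GAR m.+1.
(* The Lipschitz bound on [h1] bounds its derivative [l] near 0, so that the term [z * l] in [kE]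
   tends to 0 and [k] is differentiable at 0. *)
have h1d z : square (r / 2) z -> z != 0 -> exists2 l, cdiff h1 z l & nm l <= K2.
  move=> zr z0; have zin : inside r z by case: zr => ? ?; split; lra.
  have [l /has_expand2_cdiff hl] := h1e z zin z0; exists l => //.
  have dz : 0 < r - r / 2 by lra.
  apply: (cdiff_bound dz hl) => w wz; apply: h1K => //.
  case: zr => zx zy; have := nm_Re (w - z); have := nm_Im (w - z); rewrite !raddfB.
  have := ler_normD (complex.Re w - complex.Re z) (complex.Re z).
  have := ler_normD (complex.Im w - complex.Im z) (complex.Im z).
  rewrite !subrK /square /=; lra.
pose k (z : C) := if z == 0 then m%:R * h 0 else f z / z ^+ m.-1.
have sq2 z : nm z < r / 2 -> square (r / 2) z by move=> zr; apply: nm_square; exact: ltW.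
have kE z : nm z < r / 2 -> z != 0 -> exists2 l, nm l <= K2 &
    f z = z ^+ m.-1 * (m%:R * h 0 + z * (m.+1%:R * h1 z + z * l)).
  move=> zr z0; have [l hl lK] := h1d _ (sq2 _ zr) z0; exists l => //.
  have zr' : nm z < r by lra.
  apply: cdiff_unique (has_expand2_cdiff (FE _ (sq _ zr'))) _.
  have id1 : cdiff (fun z => z) z 1.
    by exists (fun=> 1); split; [exact: contc| |move=> w; rewrite mulr1 addrC subrK].
  have cst0 : cdiff (fun=> h 0) z 0.
    by exists (fun=> 0); split; [exact: contc| |move=> w; rewrite mulr0 addr0].
  have -> : z ^+ m.-1 * (m%:R * h 0 + z * (m.+1%:R * h1 z + z * l)) =
      m%:R * z ^+ m.-1 * (h 0 + z * h1 z) + z ^+ m * (0 + (1 * h1 z + z * l)).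
    have -> : z ^+ m = z ^+ m.-1 * z by rewrite -exprSr prednK.
    by rewrite -natr1; ring.
  apply: cdiff_near ltr01 _ (cdiffM (cdiffX m z) (cdiffD cst0 (cdiffM id1 hl))) => w _.
  by rewrite -hE -FG.
have k0 : k 0 = m%:R * h 0 by rewrite /k eqxx.
exists m.-1, k, (r / 2); split; first by rewrite divr_gt0.
- by rewrite k0 mulf_neq0 // pnatr_eq0 -lt0n.
- move=> z zr; have [->|z0] := eqVneq z 0; last first.
    have zr2 : square (2 * r) z by apply: nm_square; lra.
    have [l /cdiffP fl] := fd z zr2; apply/derivableCP.
    have zm0 : z ^+ m.-1 != 0 by rewrite expf_neq0.
    apply: near_eq_derivable (derivableM fl (derivableV zm0 (cdiffP (cdiffX m.-1 z)))).
    apply/nbhsCP; exists (nm z); first by rewrite nm_gt0.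
    move=> w; rewrite /k; case: eqVneq => [->|//]; by rewrite sub0r nmN ltxx.
  exists (m.+1%:R * h1 0), (fun z => if z == 0 then m.+1%:R * h1 0 else (k z - k 0) / z).
  split; last 2 first.
  + by rewrite eqxx.
  + move=> w; rewrite subr0; case: eqVneq => [->|w0]; first by rewrite mul0r addr0.
    by rewrite mulrCA divff // mulr1 addrC subrK.
  apply/contCP => e e0; rewrite eqxx.
  have M0 : 0 < m.+1%:R * 2 :> R by rewrite mulr_gt0 ?ltr0n.
  have e1 : 0 < e / (m.+1%:R * 2) by rewrite divr_gt0.
  have /contCP/(_ _ e1)[d d0 Hd] := Gc m.+1.
  have K0 : 0 < `|K2| + 1 by rewrite ltr_wpDl.
  exists (Num.min d (Num.min (r / 2) (e / 2 / (`|K2| + 1)))).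
    by rewrite !lt_min d0 !divr_gt0.
  move=> w; rewrite subr0 !lt_min => /and3P[wd wr we].
  case: eqVneq => [_|w0]; first by rewrite subrr nm0.
  have [l lK fE] := kE w wr w0.
  have -> : (k w - k 0) / w - m.+1%:R * h1 0 = m.+1%:R * (h1 w - h1 0) + w * l.
    have -> : k w = m%:R * h 0 + w * (m.+1%:R * h1 w + w * l).
      by rewrite /k (negbTE w0) fE mulrAC divff ?expf_neq0 // mul1r.
    by rewrite k0; field.
  apply: le_lt_trans (nmD _ _) _; rewrite !nmM.
  have -> : nm m.+1%:R = m.+1%:R by rewrite -(rmorph_nat (real_complex R)) nmR ger0_norm.
  have := Hd w; rewrite subr0 => /(_ wd); rewrite ltr_pdivlMr // => h1e'.
  move: we; rewrite ltr_pdivlMr // => we.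
  have : nm w * nm l <= nm w * (`|K2| + 1).
    by rewrite ler_wpM2l ?nm_ge0 //; have := ler_norm K2; lra.
  rewrite /h1; lra.
move=> z zr; rewrite /k; case: eqVneq => [->|z0]; last first.
  by rewrite mulrCA divff ?mulr1 // expf_neq0.
(* At 0 the factorisation is read off [F' 0 = G 1 0]: this vanishes when [1 < m], as [0 ^+ m.-1]
   does, and equals [h 0 = k 0] when [m = 1]. *)
have -> : f 0 = G 1%N 0.
  have zr0 : square r 0 by apply: sq; rewrite nm0.
  apply: cdiff_unique (has_expand2_cdiff (FE 0 zr0)) _.
  exists (G 1%N); split; [exact: (Gc 1%N)|by []|].
  by move=> w; rewrite subr0; have := GE 0%N w.
move: m_gt0; rewrite leq_eqVlt => /predU1P[m1|m1]; last first.
  by rewrite Gz // expr0n -subn1 subn_eq0 leqNgt m1 mul0r.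
by rewrite -m1 /= expr0 /h -m1 !mul1r.
Qed.

Lemma holomorphic_order (f : C^o -> C^o) (a : C) :
  (\forall z \near (a : C^o), derivable f z 1) ->
  (\forall z \near (a : C^o), f z = 0) \/
  exists (m : nat) (k : C^o -> C^o), [/\ k a != 0,
    \forall z \near (a : C^o), derivable k z 1 &
    \forall z \near (a : C^o), f z = (z - a) ^+ m * k z].
Proof.
move=> /nbhsCP[d d0 fd].
have shift_cdiff (g : C^o -> C^o) (c z l : C) : cdiff g (c + z) l -> cdiff (fun w => g (c + w)) z l.
  move=> [k [kc kl kE]]; exists (fun w => k (c + w)); split; [|by []|].
  - move: kc => /contCP kc; apply/contCP => e /kc[d' d'0 H]; exists d' => // w wz.
    by apply: H; have -> : c + w - (c + z) = w - z by ring.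
  - by move=> w; rewrite kE; congr (_ + _ * _); ring.
(* With this radius, [square (2 * (d / 8))] lies in the closed ball of radius [d / 2], where [f] is
   differentiable. *)
have r0 : 0 < d / 8 by rewrite divr_gt0.
have [||[d1 d10 f0]|[m [k [d1 [d10 k0 kd fE]]]]] := @holomorphic_order0 (fun z => f (a + z)) (d / 8).
- by [].
- move=> z /square_nm zr; have /fd/derivableCP[l fl] : nm (a + z - a) < d.
    by rewrite addrC addKr; lra.
  by exists l; exact: shift_cdiff.
- left; apply/nbhsCP; exists d1 => // z zd.
  by have := f0 _ zd; rewrite addrC subrK.
right; exists m, (fun z => k (z - a)); split; first by rewrite subrr.
- apply/nbhsCP; exists d1 => // z /kd[l kl]; apply/derivableCP; exists l.
  have := @shift_cdiff k (- a) z l; rewrite addrC => /(_ kl).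
  by apply: cdiff_near ltr01 _ => w _; rewrite addrC.
- apply/nbhsCP; exists d1 => // z zd.
  by have := fE _ zd; rewrite addrC subrK.
Qed.
End ComplexAnalysis.

(** * Meromorphic functions on a Riemann surface *)

Section RiemannSurface.
Variables (R : realType) (X : riemann_surface R).
Local Notation C := (R[i]).
Local Notation D f z := (derivable (f : C^o -> C^o) (z : C^o) 1).
Implicit Types (p x y : X) (i : chart_idx X) (f g h u : X -> C).

Lemma near_chart_inv i x (P : set X) : chart_dom i x ->
  (\forall y \near x, P y) -> \forall z \near (chart i x : C^o), P (chart_inv i z).
Proof.
by move=> ix xP; apply: (chart_inv_continuous ix); rewrite chartK.
Qed.

Lemma near_chart_dom i x : chart_dom i x -> \forall y \near x, chart_dom i y.
Proof. by move=> ix; apply: open_nbhs_nbhs; split=> //; exact: chart_dom_open. Qed.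

Lemma near_chart i x (P : set C^o) : chart_dom i x ->
  (\forall z \near (chart i x : C^o), P z) -> \forall y \near x, P (chart i y).
Proof. by move=> ix zP; exact: (chart_continuous ix). Qed.

Lemma chart_invK i x : chart_dom i x ->
  \forall z \near (chart i x : C^o), chart_dom i (chart_inv i z) /\ chart i (chart_inv i z) = z.
Proof.
move=> ix; have : nbhs (chart i x : C^o) (chart i @` chart_dom i).
  by apply: open_nbhs_nbhs; split; [exact: chart_img_open|exists x].
by apply: filterS => z [y iy <-]; rewrite chartK.
Qed.

Lemma near_chartP i x (P : set X) : chart_dom i x ->
  (\forall y \near x, P y) <-> (\forall z \near (chart i x : C^o), P (chart_inv i z)).
Proof.
move=> ix; split; first exact: near_chart_inv.
move=> /(near_chart ix); apply: filterS2 (near_chart_dom ix) => y iy.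
by rewrite chartK.
Qed.

Lemma near_punctured_chartP i x (P : set X) : chart_dom i x ->
  (\forall y \near x^', P y) <-> (\forall z \near (chart i x : C^o)^', P (chart_inv i z)).
Proof.
move=> ix; apply: (iff_trans (near_chartP (fun y => y != x -> P y) ix)); split;
    apply: filterS2 (chart_invK ix) => z [iz zE] H zx; apply: H.
  by apply: contraNneq zx => <-; rewrite zE.
by apply: contraNneq zx => zx; rewrite -(chartK iz) zE zx chartK.
Qed.

(** No point of a Riemann surface is isolated, because none of [C] is. Every comparison of germs on
    a punctured neighbourhood rests on this. *)
Lemma dnbhs_proper x : ProperFilter x^'.
Proof.
have [i ix] := chart_cover x.
have Fz : ProperFilter ((chart i x : C^o)^') := @Proper_dnbhs_regular_numFieldType C (chart i x).
split; last exact: dnbhs_filter.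
by move=> /(near_punctured_chartP _ ix); exact: (@filter_not_empty _ _ Fz).
Qed.
Local Existing Instance dnbhs_proper.

Lemma punctured_near x (P : set X) : (\forall y \near x, P y) -> \forall y \near x^', P y.
Proof. exact: cvg_within. Qed.

Lemma near_punctured x (P : set X) : P x -> (\forall y \near x^', P y) -> \forall y \near x, P y.
Proof.
move=> Px xP; have {}xP : nbhs x (fun y => y != x -> P y) := xP.
by apply: filterS xP => y H; have [->//|/H] := eqVneq y x.
Qed.

Lemma near_neq x y : y != x -> \forall z \near y, z != x.
Proof.
move=> yx; apply: open_nbhs_nbhs; split => //.
have -> : (fun z : X => is_true (z != x)) = ~` [set x].
  by apply/seteqP; split => z /= /eqP.
apply: closed_openC; apply: accessible_closed_set1.
exact/hausdorff_accessible/rs_hausdorff.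
Qed.

Lemma punctured_near_near x (P : set X) : (\forall y \near x^', P y) ->
  \forall y \near x^', \forall z \near y, P z.
Proof.
move=> xP; have {}xP : nbhs x (fun y => y != x -> P y) := xP.
have : nbhs x (fun y => \forall z \near y, z != x -> P z) by exact: near_join.
apply: filterS => y H yx.
by apply: filterS2 (near_neq yx) H => z zx; exact.
Qed.

(** One chart is enough, since transition maps are differentiable: [holo_chart] passes to any other
    chart. The pointwise form combines well with filters. *)
Definition holo f x := exists2 i, chart_dom i x & D (f \o chart_inv i) (chart i x).

Lemma holo_chart f x i : holo f x -> chart_dom i x -> D (f \o chart_inv i) (chart i x).
Proof.
move=> [j jx fj] ix.
have tr := chart_transition ix jx.
have fj' : D (f \o chart_inv j) ((chart j \o chart_inv i) (chart i x)) by rewrite /= chartK.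
have : D ((f \o chart_inv j) \o (chart j \o chart_inv i)) (chart i x).
  move: tr fj' => /derivable1_diffP tr /derivable1_diffP fj'.
  by apply/derivable1_diffP; exact: (differentiable_comp tr fj').
apply: near_eq_derivable.
have := near_chart_inv ix (near_chart_dom jx).
by apply: filterS => z jz /=; rewrite chartK.
Qed.

Lemma holomorphic_onP (A : set X) f : holomorphic_on A f <-> forall x, A x -> holo f x.
Proof.
split=> [fA x Ax|fA i x Ax ix]; last exact: holo_chart (fA x Ax) ix.
by have [i ix] := chart_cover x; exists i; [exact: ix|]; exact: fA.
Qed.

Lemma holo_near f g x : (\forall y \near x, f y = g y) -> holo f x -> holo g x.
Proof.
move=> fg [i ix fi]; exists i; [exact: ix|]; apply: near_eq_derivable fi.
exact: (near_chart_inv ix fg).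
Qed.

Lemma holo_continuous f x : holo f x -> {for x, continuous (f : X -> C^o)}.
Proof.
move=> [i ix /derivable1_diffP/differentiable_continuous fc].
move=> P; rewrite -[f x]/((fun y => f y) x) -{1}(chartK ix) => /fc H.
have := near_chart ix H; apply: filterS2 (near_chart_dom ix) => y iy /=.
by rewrite chartK.
Qed.

Lemma holo_cst (c : C) x : holo (fun=> c) x.
Proof. by have [i ix] := chart_cover x; exists i; [exact: ix|]; exact: derivable_cst. Qed.

Lemma holoD f g x : holo f x -> holo g x -> holo (fun y => f y + g y) x.
Proof. by move=> [i ix fi] /holo_chart/(_ ix) gi; exists i; [exact: ix|]; exact: (derivableD fi gi). Qed.

Lemma holoM f g x : holo f x -> holo g x -> holo (fun y => f y * g y) x.
Proof. by move=> [i ix fi] /holo_chart/(_ ix) gi; exists i; [exact: ix|]; exact: (derivableM fi gi). Qed.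

Lemma holoV f x : f x != 0 -> holo f x -> holo (fun y => (f y)^-1) x.
Proof. by move=> fx [i ix fi]; exists i; [exact: ix|]; apply: derivableV fi; rewrite /= chartK. Qed.

Lemma holo_sum (I : Type) (r : seq I) (P : pred I) (F : I -> X -> C) x :
  (forall k, P k -> holo (F k) x) -> holo (fun y => \sum_(k <- r | P k) F k y) x.
Proof.
move=> Fx; elim: r => [|a r IH].
  by apply: holo_near (holo_cst 0 x); near=> y; rewrite big_nil.
case Pa : (P a).
  by apply: holo_near (holoD (Fx _ Pa) IH); near=> y; rewrite big_cons Pa.
by apply: holo_near IH; near=> y; rewrite big_cons Pa.
Unshelve. all: by end_near. Qed.

Lemma holo_prod (I : Type) (r : seq I) (P : pred I) (F : I -> X -> C) x :
  (forall k, P k -> holo (F k) x) -> holo (fun y => \prod_(k <- r | P k) F k y) x.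
Proof.
move=> Fx; elim: r => [|a r IH].
  by apply: holo_near (holo_cst 1 x); near=> y; rewrite big_nil.
case Pa : (P a).
  by apply: holo_near (holoM (Fx _ Pa) IH); near=> y; rewrite big_cons Pa.
by apply: holo_near IH; near=> y; rewrite big_cons Pa.
Unshelve. all: by end_near. Qed.

Lemma holoX f n x : holo f x -> holo (fun y => f y ^+ n) x.
Proof.
move=> fx; elim: n => [|n IH].
  by apply: holo_near (holo_cst 1 x); near=> y; rewrite expr0.
by apply: holo_near (holoM fx IH); near=> y; rewrite exprS.
Unshelve. all: by end_near. Qed.

Lemma holoXz f (m : int) x : f x != 0 -> holo f x -> holo (fun y => f y ^ m) x.
Proof.
move=> fx0 fx; case: m => n; first exact: holoX.
by apply: holo_near (holoV _ (holoX n.+1 fx)); [near=> y|rewrite expf_neq0].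
Unshelve. all: by end_near. Qed.

Lemma holo_coord i x : chart_dom i x -> holo (chart i) x.
Proof.
move=> ix; exists i; [exact: ix|]; 
have fi : D (fun z => z) (chart i x) by exact: derivable_id.
by apply: near_eq_derivable fi; apply: filterS (chart_invK ix) => z [_ /= ->].
Qed.

Lemma holo_eq_limit f g x : holo f x -> holo g x -> (\forall y \near x^', f y = g y) -> f x = g x.
Proof.
move=> /holo_continuous fc /holo_continuous gc fg.
have fx : (f : X -> C^o) @ x^' --> (f x : C^o) by apply: cvg_trans fc; apply: cvg_app; exact: cvg_within.
have gx : (g : X -> C^o) @ x^' --> (g x : C^o) by apply: cvg_trans gc; apply: cvg_app; exact: cvg_within.
have fgx : (f : X -> C^o) @ x^' --> (g x : C^o).
  by apply: cvg_trans gx; apply: near_eq_cvg; apply: filterS fg => y ->.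
exact: (@cvg_unique _ (@norm_hausdorff C C^o) _ _ _ _ fx fgx).
Qed.

Lemma holo_neq0_near f x : holo f x -> f x != 0 -> \forall y \near x, f y != 0.
Proof.
move=> /holo_continuous fc fx0.
have o : open [set z : C^o | z != 0].
  have -> : [set z : C^o | z != 0] = ~` [set 0] by apply/seteqP; split => z /= /eqP.
  by apply: closed_openC; apply: accessible_closed_set1; exact/hausdorff_accessible/norm_hausdorff.
exact: (fc [set z : C^o | z != 0] (open_nbhs_nbhs (conj o fx0))).
Qed.

Lemma chart_sub_neq0 i p : chart_dom i p -> \forall x \near p^', chart i x - chart i p != 0.
Proof.
move=> ip; apply: filterS (near_chart_dom ip) => x ix xp.
by rewrite subr_eq0; apply: contraNneq xp => H; rewrite -(chartK ix) H chartK.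
Qed.

Lemma holo_chart_sub i p x : chart_dom i x -> holo (fun y => chart i y - chart i p) x.
Proof. by move=> ix; apply: holoD; [exact: holo_coord|exact: holo_cst]. Qed.

Lemma holo_factor i p f : chart_dom i p -> (\forall x \near p, holo f x) ->
  (\forall x \near p, f x = 0) \/ exists (m : nat) k, [/\ k p != 0,
    \forall x \near p, holo k x & \forall x \near p, f x = (chart i x - chart i p) ^+ m * k x].
Proof.
move=> ip fh; have fd : \forall z \near (chart i p : C^o), D (f \o chart_inv i) z.
  apply: filterS2 (near_chart_inv ip fh) (chart_invK ip) => z zh [iz zE].
  by rewrite -zE; exact: holo_chart.
have [f0|[m [k [k0 kd kE]]]] := holomorphic_order fd.
  left; apply: filterS2 (near_chart ip f0) (near_chart_dom ip) => x + ix.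
  by rewrite /= chartK.
right; exists m, (k \o chart i); split; first exact: k0.
  apply: filterS2 (near_chart ip kd) (near_chart_dom ip) => x kx ix.
  exists i; [exact: ix|]; apply: near_eq_derivable kx.
  by apply: filterS (chart_invK ix) => z [_ /= ->].
apply: filterS2 (near_chart ip kE) (near_chart_dom ip) => x + ix.
by rewrite /= chartK.
Qed.

(** * Local coordinates, meromorphic germs and orders *)

Definition cp p : chart_idx X := projT1 (cid (chart_cover p)).

Lemma cp_dom p : chart_dom (cp p) p. Proof. exact: projT2 (cid (chart_cover p)). Qed.

Definition lc p x : C := chart (cp p) x - chart (cp p) p.

Lemma lc_neq0 p : \forall x \near p^', lc p x != 0.
Proof. exact: chart_sub_neq0 (cp_dom p). Qed.

Lemma lcp p : lc p p = 0. Proof. by rewrite /lc subrr. Qed.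

Lemma holo_lc p : \forall x \near p, holo (lc p) x.
Proof. by apply: filterS (near_chart_dom (cp_dom p)) => x; exact: holo_chart_sub. Qed.

(** The content of [mero_form_at] in one coordinate [lc p], fixed once and for all, so that the
    exponents of two forms at [p] can be compared directly. *)
Definition form p f (m : int) h :=
  (\forall x \near p, holo h x) /\ (\forall x \near p^', f x = lc p x ^ m * h x).

Definition mero p f := exists m h, form p f m h.

Definition ord p f m := exists2 h, form p f m h & h p != 0.

Lemma near_at p (P : set X) : (\forall x \near p, P x) -> P p.
Proof. exact: nbhs_singleton. Qed.

(** If [a < b], dividing by [w ^ a] gives [h = w ^ (b - a) * k] off [p], and [h p = 0] by
    continuity. *)
Lemma exponent_unique_le p (w h k : X -> C) (a b : int) : holo w p -> w p = 0 ->
  (\forall x \near p^', w x != 0) -> holo h p -> holo k p -> h p != 0 ->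
  (\forall x \near p^', w x ^ a * h x = w x ^ b * k x) -> b <= a.
Proof.
move=> wh w0 wn hh kh h0 E; rewrite leNgt; apply/negP => ab.
have [n nE] : exists n : nat, b - a = n.+1%:Z.
  by exists `|b - a|.-1%N; rewrite prednK ?absz_gt0 ?subr_eq0 ?gt_eqF // gez0_abs // subr_ge0 ltW.
have : h p = w p ^+ n.+1 * k p.
  apply: (@holo_eq_limit h (fun x => w x ^+ n.+1 * k x) p hh (holoM (holoX n.+1 wh) kh)).
  near=> x; have wx : w x != 0 by near: x.
  apply: (mulfI (expfz_neq0 a wx)); rewrite mulrA -[w x ^+ n.+1]/(w x ^ n.+1%:Z) -nE -expfzDr //.
  by rewrite addrC subrK; near: x.
by rewrite w0 expr0n mul0r; apply/eqP.
Unshelve. all: by end_near. Qed.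

Lemma exponent_unique p (w h k : X -> C) (a b : int) : holo w p -> w p = 0 ->
  (\forall x \near p^', w x != 0) -> holo h p -> holo k p -> h p != 0 -> k p != 0 ->
  (\forall x \near p^', w x ^ a * h x = w x ^ b * k x) -> a = b.
Proof.
move=> wh w0 wn hh kh h0 k0 E; apply/le_anti/andP; split.
  by apply: (exponent_unique_le wh w0 wn kh hh k0); apply: filterS E => x ->.
exact: (exponent_unique_le wh w0 wn hh kh h0).
Qed.

Lemma ord_unique p f m n : ord p f m -> ord p f n -> m = n.
Proof.
move=> [h [hh fE] h0] [k [kh fE'] k0].
apply: (exponent_unique (near_at (holo_lc p)) (lcp p) (lc_neq0 p) (near_at hh) (near_at kh) h0 k0).
by apply: filterS2 fE fE' => x <- <-.
Qed.

Lemma ordM p f g m n : ord p f m -> ord p g n -> ord p (fun x => f x * g x) (m + n).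
Proof.
move=> [h [hh fE] h0] [k [kh gE] k0]; exists (fun x => h x * k x); last by rewrite mulf_neq0.
split; first by apply: filterS2 hh kh => x; exact: holoM.
near=> x; rewrite (near fE x) // (near gE x) // expfzDr; last by near: x; exact: lc_neq0.
by rewrite mulrACA.
Unshelve. all: by end_near. Qed.

Lemma ordV p f m : ord p f m -> ord p (fun x => (f x)^-1) (- m).
Proof.
move=> [h [hh fE] h0]; exists (fun x => (h x)^-1); last by rewrite invr_eq0.
have hn := holo_neq0_near (near_at hh) h0.
split; first by apply: filterS2 hh hn => x hx hx0; exact: holoV.
by apply: filterS fE => x ->; rewrite invfM invr_expz.
Qed.

Lemma ord_near p f g m : (\forall x \near p^', f x = g x) -> ord p f m -> ord p g m.
Proof.
move=> fg [h [hh fE] h0]; exists h; [split; first exact: hh|exact: h0].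
by apply: filterS2 fg fE => x <- ->.
Qed.

Lemma mero_near p f g : (\forall x \near p^', f x = g x) -> mero p f -> mero p g.
Proof.
move=> fg [m [h [hh fE]]]; exists m, h; split; first exact: hh.
by apply: filterS2 fg fE => x <- ->.
Qed.

Lemma ord_mero p f m : ord p f m -> mero p f. Proof. by move=> [h ?]; exists m, h. Qed.

Lemma holo_mero p f : (\forall x \near p, holo f x) -> mero p f.
Proof.
move=> fh; exists 0, f; split; first exact: fh.
by near=> x; rewrite expr0z mul1r.
Unshelve. all: by end_near. Qed.

Lemma holo_ord0 p f : (\forall x \near p, holo f x) -> f p != 0 -> ord p f 0.
Proof.
move=> fh f0; exists f; [split; first exact: fh|exact: f0].
by near=> x; rewrite expr0z mul1r.
Unshelve. all: by end_near. Qed.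

Lemma holo_ord p f : (\forall x \near p, holo f x) ->
  (\forall x \near p, f x = 0) \/ exists m : nat, ord p f m%:Z.
Proof.
move=> fh; have [?|[m [k [k0 kh fE]]]] := holo_factor (cp_dom p) fh; first by left.
right; exists m, k; [split; [exact: kh|exact: punctured_near]|exact: k0].
Qed.

Lemma mero_ord p f : mero p f -> (\forall x \near p^', f x = 0) \/ exists m, ord p f m.
Proof.
move=> [m [h [hh fE]]]; have [h0|[n [k [kh kE] k0]]] := holo_ord hh.
  by left; apply: filterS2 (punctured_near h0) fE => x -> ->; rewrite mulr0.
right; exists (m + n%:Z), k; [split; first exact: kh|exact: k0].
near=> x; rewrite (near fE x) // (near kE x) // mulrA expfzDr //.
by near: x; exact: lc_neq0.
Unshelve. all: by end_near. Qed.

Lemma mero_cst p (c : C) : mero p (fun=> c).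
Proof. by apply: holo_mero; near=> x; exact: holo_cst. Unshelve. all: by end_near. Qed.

Lemma meroM p f g : mero p f -> mero p g -> mero p (fun x => f x * g x).
Proof.
move=> [m [h [hh fE]]] [n [k [kh gE]]]; exists (m + n), (fun x => h x * k x); split.
  by apply: filterS2 hh kh => x; exact: holoM.
near=> x; rewrite (near fE x) // (near gE x) // expfzDr; last by near: x; exact: lc_neq0.
by rewrite mulrACA.
Unshelve. all: by end_near. Qed.

Lemma meroD p f g : mero p f -> mero p g -> mero p (fun x => f x + g x).
Proof.
move=> [m [h [hh fE]]] [n [k [kh gE]]].
wlog mn : m n h k f g hh kh fE gE / m <= n.
  move=> H; have [mn|/ltW nm] := leP m n; first exact: (H m n h k f g hh kh fE gE mn).
  by apply: mero_near (H n m k h g f kh hh gE fE nm); near=> x; rewrite addrC.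
have [d dE] : exists d : nat, n = m + d%:Z.
  by exists `|n - m|%N; rewrite gez0_abs ?subr_ge0 //; ring.
exists m, (fun x => h x + lc p x ^+ d * k x); split.
  apply: filterS3 hh kh (holo_lc p) => x hx kx lx.
  exact: (holoD hx (holoM (holoX d lx) kx)).
near=> x; rewrite (near fE x) // (near gE x) // dE expfzDr; last by near: x; exact: lc_neq0.
by rewrite mulrDr mulrA.
Unshelve. all: by end_near. Qed.

Lemma mero_sum (I : Type) (r : seq I) (P : pred I) (F : I -> X -> C) p :
  (forall k, P k -> mero p (F k)) -> mero p (fun y => \sum_(k <- r | P k) F k y).
Proof.
move=> Fx; elim: r => [|a r IH].
  by apply: mero_near (mero_cst p 0); near=> y; rewrite big_nil.
case Pa : (P a).
  by apply: mero_near (meroD (Fx _ Pa) IH); near=> y; rewrite big_cons Pa.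
by apply: mero_near IH; near=> y; rewrite big_cons Pa.
Unshelve. all: by end_near. Qed.

Lemma mero_prod (I : Type) (r : seq I) (P : pred I) (F : I -> X -> C) p :
  (forall k, P k -> mero p (F k)) -> mero p (fun y => \prod_(k <- r | P k) F k y).
Proof.
move=> Fx; elim: r => [|a r IH].
  by apply: mero_near (mero_cst p 1); near=> y; rewrite big_nil.
case Pa : (P a).
  by apply: mero_near (meroM (Fx _ Pa) IH); near=> y; rewrite big_cons Pa.
by apply: mero_near IH; near=> y; rewrite big_cons Pa.
Unshelve. all: by end_near. Qed.

Lemma meroV p f : mero p f -> mero p (fun x => (f x)^-1).
Proof.
move=> /mero_ord[f0|[m fm]]; last exact: ord_mero (ordV fm).
by apply: mero_near (mero_cst p 0); apply: filterS f0 => x ->; rewrite invr0.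
Qed.

Lemma mero_holo_near p f : mero p f -> \forall x \near p^', holo f x.
Proof.
move=> [m [h [hh fE]]].
have fE' := punctured_near_near fE; have lc' := punctured_near (holo_lc p).
have hh' := punctured_near hh; have l0 := lc_neq0 p.
apply: filterS3 (filterI fE' l0) lc' hh' => x [fx lx0] lx hx.
apply: (holo_near _ (holoM (holoXz m lx0 lx) hx)).
by apply: filterS fx => y ->.
Qed.

Lemma ord_neq0_near p f m : ord p f m -> \forall x \near p^', f x != 0.
Proof.
move=> [h [hh fE] h0]; have hn := punctured_near (holo_neq0_near (near_at hh) h0).
have l0 := lc_neq0 p.
near=> x; rewrite (near fE x) // mulf_neq0 //; last by near: x.
by apply: expfz_neq0; near: x.
Unshelve. all: by end_near. Qed.

Lemma ord_ge0_extend p f (m : nat) : ord p f m%:Z ->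
  exists2 h, \forall x \near p, holo h x & \forall x \near p^', f x = h x.
Proof.
move=> [h [hh fE] _]; exists (fun x => lc p x ^+ m * h x); last exact: fE.
by apply: filterS2 hh (holo_lc p) => x hx lx; exact: (holoM (holoX m lx) hx).
Qed.

Lemma punctured_absurd p (P : set X) :
  (\forall x \near p^', P x) -> (\forall x \near p^', ~ P x) -> False.
Proof.
move=> Pp nPp; have [x [//]] : exists x, (P `&` ~` P) x.
by apply: (@filter_ex _ (p^') (dnbhs_proper p)); exact: filterI.
Qed.

(** Each of the two coordinates is a power of the other times a unit; composing, the exponents
    satisfy [m * n = 1]. Hence orders do not depend on the chart. *)
Lemma chart_lc i p : chart_dom i p -> exists u, [/\ \forall x \near p, holo u x, u p != 0 &
  \forall x \near p, chart i x - chart i p = lc p x * u x].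
Proof.
move=> ip; have jp := cp_dom p.
have hi : \forall x \near p, holo (fun y => chart i y - chart i p) x.
  by apply: filterS (near_chart_dom ip) => x; exact: holo_chart_sub.
have nz (w v : X -> C) : (\forall x \near p^', w x != 0) -> ~ (\forall x \near p, w x = 0).
  move=> wn /punctured_near w0; apply: punctured_absurd wn _.
  by apply: filterS w0 => x -> /eqP.
have [/nz[]|[m [k [k0 kh kE]]]] := holo_factor jp hi; first exact: (fun=> 0).
  exact: chart_sub_neq0.
have [/nz[]|[n [l [l0 lh lE]]]] := holo_factor ip (holo_lc p); first exact: (fun=> 0).
  exact: lc_neq0.
have E : \forall x \near p^', lc p x ^ 1 * 1 = lc p x ^ (m * n)%N%:Z * (k x ^+ n * l x).
  apply: punctured_near; apply: filterS2 kE lE => x kx lx.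
  by rewrite mulr1 {1}[lc p x]lx kx expr1z exprMn mulrA -exprM.
have h1 := holo_cst 1 p; have hk := holoM (holoX n (near_at kh)) (near_at lh).
have n0 : k p ^+ n * l p != 0 by rewrite mulf_neq0 // expf_neq0.
have [mn] := exponent_unique (near_at (holo_lc p)) (lcp p) (lc_neq0 p) h1 hk (oner_neq0 _) n0 E.
have m1 : m = 1%N by apply/eqP; move: (esym mn) => /eqP; rewrite muln_eq1 => /andP[].
by exists k; split; [exact: kh|exact: k0|apply: filterS kE => x ->; rewrite m1 expr1].
Qed.

Lemma mero_form_at_form p f m h : mero_form_at f p m h ->
  exists2 h', form p f m h' & h p != 0 -> h' p != 0.
Proof.
move=> [i [U [Unb ip hU fE]]]; have [u [uh u0 uE]] := chart_lc ip.
exists (fun x => u x ^ m * h x); last by move=> h0; rewrite mulf_neq0 // expfz_neq0.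
have Un := open_nbhs_nbhs Unb.
have hh : \forall x \near p, holo h x.
  by apply: filterS Un => x; move/holomorphic_onP : hU; exact.
split.
  apply: filterS3 hh uh (holo_neq0_near (near_at uh) u0) => x hx ux ux0.
  exact: (holoM (holoXz m ux0 ux) hx).
have : \forall x \near p, [/\ U x, chart_dom i x & chart i x - chart i p = lc p x * u x].
  by apply: filterS3 Un (near_chart_dom ip) uE => x.
apply: filterS => x [Ux ix ux] /eqP xp.
by rewrite fE // ux expfzMl mulrA.
Qed.

Lemma form_mero_form_at p f m h : form p f m h -> mero_form_at f p m h.
Proof.
move=> [hh fE]; have {}fE : nbhs p (fun x => x != p -> f x = lc p x ^ m * h x) := fE.
have : nbhs p (fun x => holo h x /\ (x != p -> f x = lc p x ^ m * h x)).
  by apply: filterS2 hh fE.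
rewrite nbhsE => -[U Unb UE].
exists (cp p), U; split; [exact: Unb|exact: cp_dom| |].
  by apply/holomorphic_onP => x /UE[].
by move=> x /UE[_ H] _ /eqP; exact: H.
Qed.

Lemma meromorphic_atP f p : meromorphic_at f p <-> mero p f.
Proof.
split=> [[m [h /mero_form_at_form[h' H _]]]|[m [h H]]]; first by exists m, h'.
by exists m, h; exact: form_mero_form_at.
Qed.

Lemma order_atP f p m : order_at f p m <-> ord p f m.
Proof.
split=> [[h /mero_form_at_form[h' H hh'] /hh' h0]|[h H h0]]; first by exists h'.
by exists h; [exact: form_mero_form_at|].
Qed.

(** The identity theorem: the points around which [f] vanishes form an open set, whose complement is
    open because zeros of a function with an order are isolated; [X] is connected. *)
Lemma mero_global_dichotomy f : (forall p, mero p f) ->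
  (forall p, \forall x \near p^', f x = 0) \/ forall p, exists m, ord p f m.
Proof.
move=> fm; pose Z : set X := [set p | \forall x \near p^', f x = 0].
have Zo : open Z.
  rewrite openE => p Zp; apply: near_punctured => //.
  by apply: filterS (punctured_near_near Zp) => y; exact: punctured_near.
have nZ p : ~ Z p -> exists m, ord p f m by move=> nZp; have [|//] := mero_ord (fm p).
have Zc : closed Z.
  rewrite -[Z]setCK; apply: open_closedC; rewrite openE => p Zp.
  have [m pm] := nZ _ Zp; apply: near_punctured => //.
  have := punctured_near_near (ord_neq0_near pm); apply: filterS => y yn Zy.
  by apply: punctured_absurd Zy _; apply: filterS (punctured_near yn) => x /eqP.
have [Z0|Z0] := pselect (Z !=set0).
  have ZT : Z = setT.
    by apply: (@rs_connected _ X) => //; exists Z; rewrite ?setTI.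
  by left=> p; have : Z p by rewrite ZT.
by right=> p; apply: nZ => Zp; apply: Z0; exists p.
Qed.

Lemma near_finType (F : set_system X) {FF : Filter F} (I : finType) (P : I -> X -> Prop) :
  (forall k, \forall x \near F, P k x) -> \forall x \near F, forall k, P k x.
Proof.
move=> H; have : \forall x \near F, forall k, k \in enum I -> P k x.
  elim: (enum I) => [|a s IH]; first by apply: filterE.
  by apply: filterS2 (H a) IH => x Pa Ps k; rewrite inE => /predU1P[->|/Ps].
by apply: filterS => x Px k; apply: Px; rewrite mem_enum.
Qed.

Definition mxholo m n (A : X -> 'M[C]_(m, n)) x := forall a b, holo (fun y => A y a b) x.

Definition mxmero p m n (A : X -> 'M[C]_(m, n)) := forall a b, mero p (fun y => A y a b).

Lemma near_mx (F : set_system X) {FF : Filter F} m n (P : 'I_m -> 'I_n -> X -> Prop) :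
  (forall a b, \forall x \near F, P a b x) -> \forall x \near F, forall a b, P a b x.
Proof. by move=> H; apply: near_finType => a; apply: near_finType => b; exact: H. Qed.

Lemma mxholo_mero p m n (A : X -> 'M[C]_(m, n)) : (\forall x \near p, mxholo A x) -> mxmero p A.
Proof. by move=> H a b; apply: holo_mero; apply: filterS H => x; apply. Qed.

Lemma mxmero_near p m n (A B : X -> 'M[C]_(m, n)) : (\forall x \near p^', A x = B x) ->
  mxmero p A -> mxmero p B.
Proof. by move=> AB Am a b; apply: mero_near (Am a b); apply: filterS AB => x ->. Qed.

Lemma mxholo_near x m n (A B : X -> 'M[C]_(m, n)) : (\forall y \near x, A y = B y) ->
  mxholo A x -> mxholo B x.
Proof. by move=> AB Am a b; apply: holo_near (Am a b); apply: filterS AB => y ->. Qed.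

Lemma mxholo_cst m n (A : 'M[C]_(m, n)) x : mxholo (fun=> A) x.
Proof. by move=> a b; exact: holo_cst. Qed.

Lemma mxholoM m n q (A : X -> 'M[C]_(m, n)) (B : X -> 'M[C]_(n, q)) x :
  mxholo A x -> mxholo B x -> mxholo (fun y => A y *m B y) x.
Proof.
move=> Ax Bx a b; apply: (@holo_near (fun y => \sum_c A y a c * B y c b)).
  by apply: filterE => y; rewrite mxE.
by apply: holo_sum => c _; exact: (holoM (Ax a c) (Bx c b)).
Qed.

Lemma mxmeroM p m n q (A : X -> 'M[C]_(m, n)) (B : X -> 'M[C]_(n, q)) :
  mxmero p A -> mxmero p B -> mxmero p (fun y => A y *m B y).
Proof.
move=> Ax Bx a b; apply: (@mero_near _ (fun y => \sum_c A y a c * B y c b)).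
  by apply: filterE => y; rewrite mxE.
by apply: mero_sum => c _; exact: (meroM (Ax a c) (Bx c b)).
Qed.

Lemma holo_det n (A : X -> 'M[C]_n) x : mxholo A x -> holo (fun y => \det (A y)) x.
Proof.
move=> Ax; rewrite /determinant; apply: holo_sum => s _.
apply: holoM; first exact: holo_cst.
by apply: holo_prod => a _; exact: Ax.
Qed.

Lemma mero_det p n (A : X -> 'M[C]_n) : mxmero p A -> mero p (fun y => \det (A y)).
Proof.
move=> Ax; rewrite /determinant; apply: mero_sum => s _.
apply: meroM; first exact: mero_cst.
by apply: mero_prod => a _; exact: Ax.
Qed.

Lemma mxholo_inv n (A : X -> 'M[C]_n) x : mxholo A x -> \det (A x) != 0 ->
  mxholo (fun y => invmx (A y)) x.
Proof.
move=> Ax A0 a b.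
apply: (@holo_near (fun y => (\det (A y))^-1 * cofactor (A y) b a)).
  apply: filterS (holo_neq0_near (holo_det Ax) A0) => y Ay.
  by rewrite /invmx unitmxE unitfE Ay !mxE.
apply: holoM; first exact: (holoV A0 (holo_det Ax)).
apply: holoM; first exact: holo_cst.
apply: holo_det => c d.
by apply: holo_near (Ax (lift b c) (lift a d)); apply: filterE => y; rewrite !mxE.
Qed.

Lemma mxmero_inv p n (A : X -> 'M[C]_n) m : mxmero p A -> ord p (fun y => \det (A y)) m ->
  mxmero p (fun y => invmx (A y)).
Proof.
move=> Ax Am a b.
apply: (@mero_near _ (fun y => (\det (A y))^-1 * cofactor (A y) b a)).
  apply: filterS (ord_neq0_near Am) => y Ay.
  by rewrite /invmx unitmxE unitfE Ay !mxE.
apply: meroM; first exact: (meroV (mero_det Ax)).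
apply: meroM; first exact: mero_cst.
apply: mero_det => c d.
by apply: mero_near (Ax (lift b c) (lift a d)); apply: filterE => y; rewrite !mxE.
Qed.

(** * Frames and their divisors *)

Section Sections.
Variable V : vbundle X.
Implicit Types (s t : section V) (j : triv_idx V).

Definition hsec s x := exists2 j, triv_dom j x & mxholo (fun y => triv j y (s y)) x.

Lemma near_triv j x : triv_dom j x -> \forall y \near x, triv_dom j y.
Proof. by move=> jx; apply: open_nbhs_nbhs; split => //; exact: triv_dom_open. Qed.

Lemma hsec_triv s x j : hsec s x -> triv_dom j x -> mxholo (fun y => triv j y (s y)) x.
Proof.
move=> [k kx sk] jx; have [g [gh gE]] := triv_transition k j.
apply: (@mxholo_near _ _ _ (fun y => triv k y (s y) *m g y)).
  by apply: filterS2 (near_triv kx) (near_triv jx) => y ky jy; rewrite gE.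
apply: (mxholoM sk) => a b; have /holomorphic_onP := gh a b; exact.
Qed.

Lemma holomorphic_sectionP (A : set X) s : holomorphic_section A s <-> forall x, A x -> hsec s x.
Proof.
split=> [sA x Ax|sA j a].
  have [j jx] := triv_cover V x; exists j; first exact: jx.
  move=> a b; have /holomorphic_onP/(_ x) := sA j b.
  by rewrite (ord1 a) => H; exact: (H (conj Ax jx)).
by apply/holomorphic_onP => x [Ax jx]; exact: (hsec_triv (sA x Ax) jx ord0 a).
Qed.

Lemma hsec_comb r (c : 'I_r -> X -> C) (e : 'I_r -> section V) x :
  (forall b, holo (c b) x) -> (forall b, hsec (e b) x) ->
  hsec (fun y => \sum_b c b y *: e b y) x.
Proof.
move=> ch eh; have [j jx] := triv_cover V x; exists j; first exact: jx.
move=> a d; apply: (@holo_near (fun y => \sum_b c b y * triv j y (e b y) a d)).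
  by apply: filterE => y; rewrite linear_sum summxE; apply: eq_bigr => b _; rewrite linearZ mxE.
by apply: holo_sum => b _; exact: (holoM (ch b) (hsec_triv (eh b) jx a d)).
Qed.

Definition trivmx j r (e : 'I_r -> section V) y : 'M[C]_(r, rk V) :=
  \matrix_(a, b) triv j y (e a y) ord0 b.

Lemma mul_trivmx j r (e : 'I_r -> section V) y (c : 'rV[C]_r) :
  c *m trivmx j e y = triv j y (\sum_a c ord0 a *: e a y).
Proof.
apply/rowP => b; rewrite mxE linear_sum summxE; apply: eq_bigr => a _.
by rewrite linearZ !mxE.
Qed.

Lemma mxholo_trivmx j r (e : 'I_r -> section V) x : triv_dom j x -> (forall a, hsec (e a) x) ->
  mxholo (trivmx j e) x.
Proof.
move=> jx eh a b; apply: (holo_near _ (hsec_triv (eh a) jx ord0 b)).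
by apply: filterE => y; rewrite mxE.
Qed.

Lemma triv_inj j x : triv_dom j x -> injective (triv j x).
Proof. by move=> /triv_bij/bij_inj. Qed.

Lemma triv_eq0 j x (v : V x) : triv_dom j x -> triv j x v = 0 -> v = 0.
Proof. by move=> jx v0; apply: (triv_inj jx); rewrite v0 linear0. Qed.

Definition vals r (e : 'I_r -> section V) y : r.-tuple (V y) := [tuple e a y | a < r].

Lemma free_trivmx j r (e : 'I_r -> section V) y : triv_dom j y ->
  free (vals e y) = row_free (trivmx j e y).
Proof.
move=> jy; have sumE (k : 'I_r -> C) : \sum_(a < r) k a *: (vals e y)`_a = \sum_a k a *: e a y.
  by apply: eq_bigr => a _; rewrite -tnth_nth tnth_mktuple.
apply/freeP/idP => [H|rf k].
  apply: inj_row_free => v; rewrite mul_trivmx => /(triv_eq0 jy) v0.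
  by apply/rowP => a; rewrite mxE (H (fun a => v ord0 a)) // sumE.
rewrite sumE => k0 a.
have : (\row_a k a) *m trivmx j e y = 0.
  by rewrite mul_trivmx (eq_bigr (fun a => k a *: e a y)) ?k0 ?linear0 // => b _; rewrite mxE.
by rewrite -(mul0mx _ (trivmx j e y)) => /(row_free_inj rf)/rowP/(_ a); rewrite !mxE.
Qed.

Definition frame_at r (W : forall x, {vspace V x}) (e : 'I_r -> section V) p :=
  \forall x \near p, (forall a, hsec (e a) x) /\ basis_of (W x) (vals e x).

Lemma frame_at_near r W (e : 'I_r -> section V) p : frame_at W e p -> \forall x \near p, frame_at W e x.
Proof. exact: near_join. Qed.

Lemma frame_at_of_local r W (U : set X) (e : 'I_r -> section V) p : open_nbhs p U ->
  local_frame W U e -> frame_at W e p.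
Proof.
move=> /open_nbhs_nbhs Up [eh eb]; apply: filterS Up => x Ux; split; last exact: eb.
by move=> a; move/holomorphic_sectionP : (eh a); exact.
Qed.

Lemma frame_at_to_local r W (e : 'I_r -> section V) p : frame_at W e p ->
  exists2 U, open_nbhs p U & local_frame W U e.
Proof.
move=> eL.
have : nbhs p (fun x => (forall a, hsec (e a) x) /\ basis_of (W x) (vals e x)) := eL.
rewrite nbhsE => -[U Up UE]; exists U; [exact: Up|split; last by move=> x /UE[]].
by move=> a; apply/holomorphic_sectionP => x /UE[].
Qed.

Definition coordmx q r (e : 'I_r -> section V) (s : 'I_q -> section V) y : 'M[C]_(q, r) :=
  \matrix_(a, b) coord (vals e y) b (s a y).

Definition eqcomb q r (s : 'I_q -> section V) (A : X -> 'M[C]_(q, r)) (e : 'I_r -> section V) y :=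
  forall a, s a y = \sum_b A y a b *: e b y.

Lemma coordmx_comb q r (e : 'I_r -> section V) (s : 'I_q -> section V) y (W : {vspace V y}) :
  basis_of W (vals e y) -> (forall a, s a y \in W) -> eqcomb s (coordmx e s) e y.
Proof.
move=> eW sW a; rewrite {1}(coord_basis eW (sW a)); apply: eq_bigr => b _.
by rewrite mxE -tnth_nth tnth_mktuple.
Qed.

Lemma comb_coordmx q r (A : X -> 'M[C]_(q, r)) (e : 'I_r -> section V) (s : 'I_q -> section V) y :
  free (vals e y) -> eqcomb s A e y -> coordmx e s y = A y.
Proof.
move=> ef sA; apply/matrixP => a b; rewrite mxE sA.
have -> : \sum_b A y a b *: e b y = \sum_b A y a b *: (vals e y)`_b.
  by apply: eq_bigr => c _; rewrite -tnth_nth tnth_mktuple.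
by rewrite coord_sum_free.
Qed.

Lemma trivmx_comb q r j (A : X -> 'M[C]_(q, r)) (e : 'I_r -> section V) (s : 'I_q -> section V) y :
  eqcomb s A e y -> trivmx j s y = A y *m trivmx j e y.
Proof.
move=> sA; apply/matrixP => a b; rewrite mxE sA linear_sum summxE mxE.
by apply: eq_bigr => c _; rewrite linearZ !mxE.
Qed.

Lemma eqcombM q r n (A : X -> 'M[C]_(q, r)) (B : X -> 'M[C]_(r, n)) (s : 'I_q -> section V)
  (t : 'I_r -> section V) (e : 'I_n -> section V) y :
  eqcomb s A t y -> eqcomb t B e y -> eqcomb s (fun y => A y *m B y) e y.
Proof.
move=> sA tB a; rewrite sA.
under eq_bigr do rewrite tB scaler_sumr.
rewrite exchange_big; apply: eq_bigr => b _.
by rewrite mxE scaler_suml; apply: eq_bigr => c _; rewrite scalerA.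
Qed.

(* A constant right inverse [K] of the matrix of [e] at [p] makes the coordinates
   in [e] explicit near [p]. *)
Lemma coordmx_holo q r W (e : 'I_r -> section V) (s : 'I_q -> section V) p : frame_at W e p ->
  (\forall x \near p, forall a, hsec (s a) x /\ s a x \in W x) -> mxholo (coordmx e s) p.
Proof.
move=> eLF sh; have [j jp] := triv_cover V p.
have [eh eb] := near_at eLF.
have /row_freeP[K EK] : row_free (trivmx j e p) by rewrite -free_trivmx //; exact: basis_free eb.
have Nh : mxholo (fun y => trivmx j e y *m K) p.
  by apply: mxholoM; [exact: mxholo_trivmx|exact: mxholo_cst].
have N0 : \det (trivmx j e p *m K) != 0 by rewrite EK det1 oner_eq0.
have Sh : mxholo (trivmx j s) p by apply: mxholo_trivmx => // a; case: (near_at sh a).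
apply: mxholo_near (mxholoM (mxholoM Sh (mxholo_cst K p)) (mxholo_inv Nh N0)).
apply: filterS3 (holo_neq0_near (holo_det Nh) N0) eLF sh => y Ny [_ ey] sy.
have -> : trivmx j s y = coordmx e s y *m trivmx j e y.
  by apply: trivmx_comb; apply: coordmx_comb ey _ => a; case: (sy a).
by rewrite -(mulmxA (coordmx e s y)) mulmxK // unitmxE unitfE.
Qed.

Lemma coordmx_holo_near q r W (e : 'I_r -> section V) (s : 'I_q -> section V) p : frame_at W e p ->
  (\forall x \near p, forall a, hsec (s a) x /\ s a x \in W x) -> \forall x \near p, mxholo (coordmx e s) x.
Proof.
move=> /frame_at_near eLF /near_join sh; apply: filterS2 eLF sh => x; exact: coordmx_holo.
Qed.

Lemma frame_at_sections r W (e : 'I_r -> section V) p : frame_at W e p ->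
  \forall x \near p, forall a, hsec (e a) x /\ e a x \in W x.
Proof.
apply: filterS => x [eh eb] a; split; first exact: eh.
by apply: (basis_mem eb); rewrite -(tnth_mktuple (fun a => e a x)) mem_tnth.
Qed.

Lemma coordmx_frame_at_det r W (e f : 'I_r -> section V) p : frame_at W e p -> frame_at W f p ->
  \det (coordmx e f p) != 0.
Proof.
move=> eL fL; have [_ eb] := near_at eL; have [_ fb] := near_at fL.
have eW := near_at (frame_at_sections eL); have fW := near_at (frame_at_sections fL).
have ef : eqcomb e (coordmx f e) f p by apply: (coordmx_comb fb) => a; case: (eW a).
have fe : eqcomb f (coordmx e f) e p by apply: (coordmx_comb eb) => a; case: (fW a).
have := comb_coordmx (basis_free fb) (eqcombM fe ef).
have -> : coordmx f f p = 1%:M.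
  apply: (comb_coordmx (A := fun=> 1%:M) (basis_free fb)) => a.
  rewrite (bigD1 a) //= mxE eqxx scale1r big1 ?addr0 // => b ba.
  by rewrite mxE eq_sym (negbTE ba) scale0r.
move=> /(congr1 determinant); rewrite det1 det_mulmx => /esym H.
by apply/eqP => d0; move: H; rewrite d0 mul0r => /eqP; rewrite eq_sym oner_eq0.
Qed.

Definition fdiv_at r W (s : 'I_r -> section V) p (m : int) :=
  exists (e : 'I_r -> section V) (A : X -> 'M[C]_r),
    [/\ frame_at W e p, mxmero p A, \forall x \near p^', eqcomb s A e x & ord p (fun x => \det (A x)) m].

Lemma frame_divisorP r W (s : 'I_r -> section V) D :
  frame_divisor W s D <-> forall p, fdiv_at W s p (D p).
Proof.
split=> sD p; have := sD p.
  move=> [U [e [A [Up eL Am sE /order_atP Ao]]]]; exists e, A; split.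
  - exact: frame_at_of_local Up eL.
  - by move=> a b; exact/meromorphic_atP.
  - apply: filterS (open_nbhs_nbhs Up) => x Ux /eqP xp a; exact: sE.
  - exact: Ao.
move=> [e [A [eL Am sE Ao]]].
have sE' : nbhs p (fun x => x != p -> eqcomb s A e x) := sE.
have : nbhs p (fun x => ((forall a, hsec (e a) x) /\ basis_of (W x) (vals e x)) /\ (x != p -> eqcomb s A e x)).
  by apply: filterS2 eL sE'.
rewrite nbhsE => -[U Up UE]; exists U, e, A; split => //.
- split; last by move=> x /UE[[]].
  by move=> a; apply/holomorphic_sectionP => x /UE[[]].
- by move=> a b; apply/meromorphic_atP; exact: Am.
- by move=> x a /UE[_ H] /eqP/H; exact.
- exact/order_atP.
Qed.

(** [fdiv_at] provides some frame and matrix. Any other frame serves as well, because the transition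
    determinant is holomorphic and non-zero at [p], hence of order 0; uniqueness of the divisor
    follows. *)
Lemma fdiv_coordmx r W (s e : 'I_r -> section V) p m : fdiv_at W s p m -> frame_at W e p ->
  [/\ mxmero p (coordmx e s), \forall x \near p^', eqcomb s (coordmx e s) e x &
      ord p (fun x => \det (coordmx e s x)) m].
Proof.
move=> [f [A [fL Am sE Ao]]] eL.
have ch := coordmx_holo_near eL (frame_at_sections fL).
have c0 := coordmx_frame_at_det eL fL.
have E : \forall x \near p^', A x *m coordmx e f x = coordmx e s x /\ eqcomb s (coordmx e s) e x.
  apply: filterS3 sE (punctured_near eL) (punctured_near (frame_at_sections fL)) => x sx [_ ex] fx.
  have fe : eqcomb f (coordmx e f) e x by apply: (coordmx_comb ex) => a; case: (fx a).
  have H := comb_coordmx (basis_free ex) (eqcombM sx fe).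
  by rewrite H; split => // a; rewrite (eqcombM sx fe) H.
split.
- by apply: mxmero_near (mxmeroM Am (mxholo_mero ch)); apply: filterS E => x [].
- by apply: filterS E => x [].
- have dh : \forall x \near p, holo (fun y => \det (coordmx e f y)) x.
    by apply: filterS ch => x; exact: holo_det.
  have := ordM Ao (holo_ord0 dh c0).
  by rewrite addr0; apply: ord_near; apply: filterS E => x [<- _]; rewrite det_mulmx.
Qed.

Lemma fdiv_unique r W (s : 'I_r -> section V) p m n : fdiv_at W s p m -> fdiv_at W s p n -> m = n.
Proof.
move=> sm [f [A [fL Am sE Ao]]]; have [_ _ H] := fdiv_coordmx sm fL.
have [_ _ H'] := @fdiv_coordmx _ _ _ _ _ n (ex_intro _ f (ex_intro _ A (And4 fL Am sE Ao))) fL.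
exact: ord_unique H H'.
Qed.

(** Off [p] the matrix [A] is holomorphic and invertible. The support of the divisor is therefore
    isolated, and compactness will make it finite. *)
Lemma fdiv_near0 r W (s : 'I_r -> section V) p m : fdiv_at W s p m ->
  \forall q \near p^', fdiv_at W s q 0.
Proof.
move=> [e [A [eL Am sE Ao]]].
have Ah : \forall x \near p^', \forall y \near x, mxholo A y.
  by apply: punctured_near_near; apply: near_mx => a b; exact: mero_holo_near.
have L := punctured_near (frame_at_near eL).
have sE' := punctured_near_near sE.
apply: filterS3 (filterI Ah L) sE' (ord_neq0_near Ao) => q [Aq Lq] sq A0.
exists e, A; split; [exact: Lq|exact: mxholo_mero|exact: punctured_near|].
by apply: holo_ord0 => //; apply: filterS Aq => x; exact: holo_det.
Qed.
End Sections.

(** * Finite supports and degrees of divisors *)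

Section FiniteSupport.

Definition fin_supp (D : X -> int) := exists A : seq X, forall p, p \notin A -> D p = 0.

(** Over an infinite support this sum is 0 by convention, which is why additivity is stated for
    finite supports. *)
Definition deg (D : X -> int) : int := \sum_(p \in [set: X]) D p.

Lemma deg_seq (A : seq X) (D : X -> int) : (forall p, p \notin A -> D p = 0) ->
  deg D = \sum_(p <- undup A) D p.
Proof.
move=> DA; rewrite /deg (@fsbigE _ _ _ _ _ (undup A)) ?undup_uniq //.
  by apply: eq_bigl => p; rewrite in_setT.
by move=> p _; rewrite mem_undup; exact: DA.
Qed.

Lemma fin_supp_common (D E : X -> int) : fin_supp D -> fin_supp E ->
  exists A : seq X, (forall p, p \notin A -> D p = 0) /\ (forall p, p \notin A -> E p = 0).
Proof.
move=> [A DA] [B EB]; exists (A ++ B).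
by split=> p; rewrite mem_cat negb_or => /andP[? ?]; [exact: DA|exact: EB].
Qed.

Lemma degD (D E : X -> int) : fin_supp D -> fin_supp E ->
  deg (fun p => D p + E p) = deg D + deg E.
Proof.
move=> Df Ef; have [A [DA EA]] := fin_supp_common Df Ef.
by rewrite !(@deg_seq A) ?big_split // => p pA; rewrite DA ?EA.
Qed.

Lemma degZ (D : X -> int) (c : int) : fin_supp D -> deg (fun p => c * D p) = c * deg D.
Proof.
move=> [A DA]; rewrite !(@deg_seq A) ?mulr_sumr // => p pA.
by rewrite DA ?mulr0.
Qed.

Lemma deg_le (D E : X -> int) : fin_supp D -> fin_supp E -> (forall p, D p <= E p) ->
  deg D <= deg E.
Proof.
move=> Df Ef DE; have [A [DA EA]] := fin_supp_common Df Ef.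
by rewrite !(@deg_seq A) // ler_sum.
Qed.

Lemma fin_suppD (D E : X -> int) : fin_supp D -> fin_supp E -> fin_supp (fun p => D p + E p).
Proof.
move=> Df Ef; have [A [DA EA]] := fin_supp_common Df Ef.
by exists A => p pA; rewrite DA ?EA.
Qed.

Lemma fin_suppZ (D : X -> int) (c : int) : fin_supp D -> fin_supp (fun p => c * D p).
Proof. by move=> [A DA]; exists A => p pA; rewrite DA ?mulr0. Qed.

Hypothesis Xc : compact [set: X].

Lemma compact_fin_supp (D : X -> int) : (forall p, \forall q \near p^', D q = 0) -> fin_supp D.
Proof.
move=> D0; pose S : set X := [set p | D p != 0].
have [Sf|Sinf] := pselect (finite_set S).
  have [A SA] := iffLR (finite_seqP _) Sf; exists A => p pA.
  apply/eqP; apply: contrapT => /negP Dp; have : S p by [].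
  by rewrite SA /= (negbTE pA).
(* For infinite [S], the sets missing only finitely many points of [S] form a proper filter; a
   cluster point of it contradicts the hypothesis on punctured neighbourhoods. *)
pose F : set_system X := [set B | finite_set (S `\` B)].
have FF : ProperFilter F.
  split; first by rewrite /F /= setD0.
  split.
  - by rewrite /F /= setDT; exact: finite_set0.
  - by move=> A B FA FB; rewrite /F /= setDIr finite_setU.
  - by move=> A B AB; apply: sub_finite_set => x [Sx nB]; split => // /AB.
have [|p [_ pcl]] := Xc FF; first by rewrite /F /= setDT; exact: finite_set0.
have FSp : F (S `\ p).
  by apply: (sub_finite_set _ (finite_set1 p)) => x [Sx H]; apply: contrapT => xp; apply: H.
have pD : nbhs p (fun q => q != p -> D q = 0) := D0 p.
have [q [[/= Dq qp] /= Dq0]] := pcl _ _ FSp pD.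
by move: Dq; rewrite /S /= Dq0 ?eqxx //; exact/eqP.
Qed.

Lemma frame_divisor_fin_supp (V : vbundle X) r W (s : 'I_r -> section V) D :
  frame_divisor W s D -> fin_supp D.
Proof.
move=> /frame_divisorP sD; apply: compact_fin_supp => p.
apply: filterS (fdiv_near0 (sD p)) => q; exact: fdiv_unique.
Qed.

Lemma ord_near0 p f m : ord p f m -> \forall q \near p^', ord q f 0.
Proof.
move=> fm; have fh := punctured_near_near (mero_holo_near (ord_mero fm)).
by apply: filterS2 fh (ord_neq0_near fm) => q qh q0; exact: holo_ord0.
Qed.

Lemma divisor_fin_supp f D : (forall p, ord p f (D p)) -> fin_supp D.
Proof.
move=> fD; apply: compact_fin_supp => p.
apply: filterS (ord_near0 (fD p)) => q; exact: ord_unique.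
Qed.

End FiniteSupport.

(** * Change of frame and principal divisors *)

Section ChangeOfFrame.
Variable V : vbundle X.

Lemma fdiv_mul r W (s t : 'I_r -> section V) (T : X -> 'M[C]_r) p m k :
  fdiv_at W s p m -> mxmero p T -> ord p (fun x => \det (T x)) k ->
  (\forall x \near p^', eqcomb t T s x) -> fdiv_at W t p (k + m).
Proof.
move=> [e [A [eL Am sE Ao]]] Tm To tT.
exists e, (fun x => T x *m A x); split; first exact: eL.
- exact: mxmeroM.
- by apply: filterS2 sE tT => x sx tx; exact: eqcombM tx sx.
- apply: ord_near (ordM To Ao).
  by apply: filterE => x; rewrite det_mulmx.
Qed.

Lemma free_mul_unit r (e s : 'I_r -> section V) (A : X -> 'M[C]_r) x :
  free (vals e x) -> A x \in unitmx -> eqcomb s A e x -> free (vals s x).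
Proof.
move=> ef Au sA; have [j jx] := triv_cover V x.
rewrite (free_trivmx _ jx) (trivmx_comb _ sA) /row_free mxrankMfree; last by rewrite -free_trivmx.
by rewrite mxrank_unit.
Qed.

Lemma eqcomb_inv r (e s : 'I_r -> section V) (A : X -> 'M[C]_r) x :
  A x \in unitmx -> eqcomb s A e x -> eqcomb e (fun x => invmx (A x)) s x.
Proof.
move=> Au sA a; under eq_bigr do rewrite sA scaler_sumr.
rewrite exchange_big (bigD1 a) //= [X in _ + X]big1 ?addr0 => [|b ba].
  under eq_bigr do rewrite scalerA.
  have /matrixP/(_ a a) := mulVmx Au; rewrite !mxE eqxx => E.
  by rewrite -scaler_suml E scale1r.
under eq_bigr do rewrite scalerA.
have /matrixP/(_ a b) := mulVmx Au; rewrite !mxE eq_sym (negbTE ba) => E.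
by rewrite -scaler_suml E scale0r.
Qed.

Hypothesis Xc : compact [set: X].

(* Rescaling one section of a frame by a meromorphic function changes the divisor
   by that of the function: as the degree of [V] is well defined, principal
   divisors have degree 0. *)
Lemma principal_degree n W d f D : (0 < n)%N -> @frame_degree _ _ V n W d ->
  (forall p, ord p f (D p)) -> deg D = 0.
Proof.
move=> n0 [[s [E sE]] uniq] fD.
have d1 := uniq _ _ sE; pose a0 : 'I_n := Ordinal n0.
pose dg x : 'rV[C]_n := \row_a (if a == a0 then f x else 1).
pose t (a : 'I_n) : section V := fun x => dg x ord0 a *: s a x.
have tE : frame_divisor W t (fun p => D p + E p).
  apply/frame_divisorP => p; move/frame_divisorP : sE => /(_ p) sE.
  apply: (@fdiv_mul _ _ s _ (fun x => diag_mx (dg x)) _ _ _ sE).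
  - move=> a b; apply: (@mero_near _ (fun x => (if a == a0 then f x else 1) *+ (a == b))).
      by apply: filterE => x; rewrite !mxE.
    case: eqP => _; last exact: mero_cst.
    by case: eqP => _; [exact: ord_mero (fD p)|exact: mero_cst].
  - apply: ord_near (fD p); apply: filterE => x; rewrite det_diag (bigD1 a0) //= mxE eqxx.
    by rewrite big1 ?mulr1 // => b /negbTE ba; rewrite mxE ba.
  - apply: filterE => x a; rewrite (bigD1 a) //= big1 ?addr0.
      by rewrite /t [in RHS]mxE eqxx mulr1n.
    by move=> b ba; rewrite mxE [a == b]eq_sym (negbTE ba) mulr0n scale0r.
have := uniq _ _ tE; rewrite -/(deg _) degD.
- by rewrite -/(deg _) in d1; rewrite d1 => /eqP; rewrite -subr_eq0 addrK => /eqP.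
- exact: divisor_fin_supp fD.
- exact: frame_divisor_fin_supp sE.
Qed.

(** The two frames differ by a global meromorphic matrix whose determinant has divisor [D - E]. This
    gives the kernel subbundle a degree, as [sub_degree] quantifies over all of its frames. *)
Lemma degree_independent r W (s t : 'I_r -> section V) D E :
  (forall f F, (forall p, ord p f (F p)) -> deg F = 0) ->
  frame_divisor W s D -> frame_divisor W t E -> deg D = deg E.
Proof.
move=> pr sD tE; have Df := frame_divisor_fin_supp Xc sD; have Ef := frame_divisor_fin_supp Xc tE.
have := pr (fun x => \det (coordmx t s x)) (fun p => D p + (-1) * E p).
rewrite degD ?degZ //; last exact: fin_suppZ.
rewrite mulN1r => H; apply/eqP; rewrite -subr_eq0; apply/eqP; apply: H => p.
move/frame_divisorP : sD => /(_ p) sp; move/frame_divisorP : tE => /(_ p) tp.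
have [e [A [eL _ _ _]]] := tp.
have [_ sE So] := fdiv_coordmx sp eL; have [_ tE To] := fdiv_coordmx tp eL.
rewrite mulN1r; apply: ord_near (ordM So (ordV To)).
apply: filterS3 (filterI sE tE) (punctured_near eL) (ord_neq0_near To) => x [sx tx] [_ ex] t0.
have tu : coordmx e t x \in unitmx by rewrite unitmxE unitfE.
have tf := free_mul_unit (basis_free ex) tu tx.
by rewrite (comb_coordmx tf (eqcombM sx (eqcomb_inv tu tx))) det_mulmx det_inv.
Qed.

End ChangeOfFrame.

(** * Adapted frames *)

Section Matrices.
Variable F : fieldType.

Lemma row_free_complete k r (A : 'M[F]_(k, k + r)) : row_free A ->
  exists B : 'M[F]_(r, k + r), col_mx A B \in unitmx.
Proof.
move=> Af; exists (row_mx 0 1%:M *m row_ebase A).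
have AE : A = col_ebase A *m row_mx 1%:M 0 *m row_ebase A.
  rewrite -[LHS]mulmx_ebase (eqP Af : \rank A = k); congr (_ *m _ *m _).
  apply/matrixP => i j; rewrite !mxE; case: splitP => j' jj'.
    by rewrite mxE -val_eqE /= jj' ltn_ord andbT.
  rewrite mxE; case: eqP => //= ij; have := ltn_ord i.
  by rewrite ij jj' ltnNge leq_addr.
have -> : col_mx A (row_mx 0 1%:M *m row_ebase A) =
    block_mx (col_ebase A) 0 0 1%:M *m row_ebase A.
  rewrite {1}AE block_mxEv mul_col_mx; congr (col_mx (_ *m _) _).
  by rewrite mul_mx_row mulmx1 mulmx0.
by rewrite unitmx_mul row_ebase_unit andbT unitmxE det_ublock det1 mulr1 -unitmxE col_ebase_unit.
Qed.

Lemma usubmx_row_free k r n (A : 'M[F]_(k + r, n)) : row_free A -> row_free (usubmx A).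
Proof.
move=> Af; apply: inj_row_free => v vA.
have : row_mx v 0 *m A = 0 by rewrite -[A]vsubmxK mul_row_col vA mul0mx addr0.
rewrite -(mul0mx _ A) => /(row_free_inj Af) /(congr1 lsubmx).
by rewrite row_mxKl linear0.
Qed.

Lemma colsub_unit_of_row_free k n (A : 'M[F]_(k, n)) : row_free A ->
  exists f : {ffun 'I_k -> 'I_n}, \det (colsub f A) != 0.
Proof.
move=> Af; have At : row_full A^T by rewrite /row_full mxrank_tr.
exists (finfun (fullrankfun At)); have := fullrowsub_unit At.
rewrite unitmxE unitfE -det_tr; congr (\det _ != 0).
by apply/matrixP => i j; rewrite !mxE [X in _ = A _ X]ffunE.
Qed.

Lemma cramer_entry k n (N : 'M[F]_k) (M : 'M[F]_(k, n)) a b : N \in unitmx ->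
  (invmx N *m M) a b = \det (\matrix_(i, j) (if j == a then M i b else N i j)) / \det N.
Proof.
move=> Nu; rewrite /invmx Nu -scalemxAl mxE mulrC; congr (_ * _).
rewrite mxE (expand_det_col _ a); apply: eq_bigr => c _.
rewrite !mxE eqxx mulrC; congr (_ * (_ * \det _)).
by apply/matrixP => i j; rewrite !mxE eq_sym (negbTE (neq_lift _ _)).
Qed.

Lemma row_base_of_rank m n (A : 'M[F]_(m, n)) k : \rank A = k ->
  exists2 K : 'M[F]_(k, n), row_free K & (K <= A)%MS.
Proof.
by move=> <-; exists (row_base A); [exact: row_base_free|rewrite eq_row_base].
Qed.

(** The first [k] rows of [P] are a basis of the kernel. By symmetry the congruence leaves only the
    lower right block, which then carries the whole rank [r]. *)
Lemma symmetric_normal_form k r (G : 'M[F]_(k + r)) : G^T = G -> \rank G = r ->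
  exists2 P : 'M[F]_(k + r), P \in unitmx &
    drsubmx (P *m G *m P^T) \in unitmx.
Proof.
move=> Gs Gr; have kr : \rank (kermx G) = k by rewrite mxrank_ker Gr addnK.
have [K Kf /sub_kermxP KG] := row_base_of_rank kr.
have [B Pu] := row_free_complete Kf.
exists (col_mx K B) => //; set P := col_mx K B in Pu *.
have GK : G *m K^T = 0 by rewrite -[G]Gs -trmx_mul KG trmx0.
have E : P *m G *m P^T = block_mx 0 0 0 (B *m G *m B^T).
  rewrite /P mul_col_mx KG tr_col_mx mul_col_row mul0mx mul0mx.
  by rewrite -mulmxA GK mulmx0.
have Pf : row_full P^T by rewrite row_full_unit unitmx_tr.
rewrite E block_mxKdr -row_free_unit /row_free; apply/eqP.
have : \rank (P *m G *m P^T) = r.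
  rewrite mxrankMfree; last by rewrite row_free_unit unitmx_tr.
  by rewrite (eqmxMfull _ _) ?row_full_unit.
by rewrite E rank_diag_block_mx mxrank0.
Qed.

(** Block elimination by congruence leaves the Schur complement next to [drsubmx G]. The latter
    already has rank [r], so the former has rank 0. *)
Lemma schur_complement k r (G : 'M[F]_(k + r)) : G^T = G -> drsubmx G \in unitmx ->
  (\rank G <= r)%N ->
  let P := block_mx 1%:M (- (ursubmx G *m invmx (drsubmx G))) 0 1%:M in
  P *m G *m P^T = block_mx 0 0 0 (drsubmx G).
Proof.
move=> Gs Gu Gr; set G12 := ursubmx G; set G22 := drsubmx G in Gu *.
set Y := G12 *m invmx G22 => P.
have Pu : P \in unitmx by rewrite unitmxE det_ublock !det1 mulr1 unitr1.
have G21 : dlsubmx G = G12^T by rewrite /G12 trmx_ursub Gs.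
have G22s : G22^T = G22 by rewrite /G22 trmx_drsub Gs.
have YG : Y *m G22 = G12 by rewrite /Y mulmxKV.
have E : P *m G *m P^T = block_mx (ulsubmx G - Y *m G12^T) 0 0 G22.
  rewrite -{1}[G]submxK G21 -/G12 -/G22 /P tr_block_mx !trmx1 trmx0 !mulmx_block.
  have GY : G22 *m (- Y)^T = - G12^T.
    by rewrite linearN /= mulmxN -{1}G22s -trmx_mul YG.
  rewrite !mul1mx !mul0mx !mulmx1 !mulmx0 !add0r GY !mulNmx YG subrr.
  by rewrite mul0mx subrr !addr0.
rewrite E; suff -> : ulsubmx G - Y *m G12^T = 0 by [].
apply/eqP; rewrite -mxrank_eq0.
have : (\rank (P *m G *m P^T) <= r)%N.
  rewrite mxrankMfree; last by rewrite row_free_unit unitmx_tr.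
  by rewrite (eqmxMfull _ _) ?row_full_unit.
rewrite E rank_diag_block_mx (mxrank_unit Gu).
by move: (\rank _) => q; lia.
Qed.

End Matrices.

(* The first [k] rows [M] of [A] are normalised at the [k x k] minor of smallest
   order at [p]: by Cramer's rule the entries of the normalised [M] are quotients of
   minors by this one, hence holomorphic. *)
Lemma local_triangular p k r (A : X -> 'M[C]_(k + r)) m : mxmero p A ->
  ord p (fun x => \det (A x)) m ->
  exists (A' B : X -> 'M[C]_(k + r)),
    [/\ mxmero p A', \forall x \near p, mxholo B x, \det (B p) != 0,
        \forall x \near p^', A x = A' x *m B x & \forall x \near p^', ursubmx (A' x) = 0].
Proof.
move=> Am Ao; pose M x := usubmx (A x).
have Mm : mxmero p M.
  by move=> a b; apply: mero_near (Am (lshift r a) b); apply: filterE => x; rewrite mxE.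
pose delta (c : {ffun 'I_k -> 'I_(k + r)}) x := \det (colsub c (M x)).
have dm c : mero p (delta c).
  apply: mero_det => a b; apply: mero_near (Mm a (c b)).
  by apply: filterE => x; rewrite !mxE.
pose P c := `[< exists m, ord p (delta c) m >].
pose o c := xget 0 [set m | ord p (delta c) m].
have oP c : P c -> ord p (delta c) (o c).
  by move=> /asboolP[n fn]; rewrite /o; case: xgetP => // /(_ n).
have nP c : ~~ P c -> \forall x \near p^', delta c x = 0.
  by move=> /asboolPn nf; have [|//] := mero_ord (dm c).
(* Some minor of the first [k] rows is not identically zero near [p], for otherwise these rows would
   be dependent and [\det (A x)] would vanish. *)
have [c1 f1P] : exists c, P c.
  apply: contrapT => /forallNP none.
  have all0 : \forall x \near p^', forall c, delta c x = 0.
    by apply: near_finType => c; apply: nP; apply/negP; exact: none.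
  apply: (punctured_absurd all0); apply: filterS (ord_neq0_near Ao) => x Ax H.
  have Mf : row_free (M x).
    by apply: usubmx_row_free; rewrite row_free_unit unitmxE unitfE.
  have [c] := colsub_unit_of_row_free Mf.
  by rewrite -/(delta c x) H eqxx.
have [c0 [f0P f0min]] : exists c0, P c0 /\ forall c, P c -> o c0 <= o c.
  by case: (@Order.TotalTheory.arg_minP _ _ _ c1 P o f1P) => c0 ? ?; exists c0.
have f0ord := oP _ f0P; have f0n := ord_neq0_near f0ord.
pose N x := colsub c0 (M x); pose E x := invmx (N x) *m M x.
have Nu : \forall x \near p^', N x \in unitmx.
  by apply: filterS f0n => x x0; rewrite unitmxE unitfE; exact: x0.
(* By Cramer's rule the entry [(a, b)] is the minor in which the selected column [a] is replaced by
   column [b], divided by the selected minor. *)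
pose g (a : 'I_k) (b : 'I_(k + r)) : {ffun 'I_k -> 'I_(k + r)} :=
  [ffun j => if j == a then b else c0 j].
have EE a b : \forall x \near p^', E x a b = delta (g a b) x / delta c0 x.
  apply: filterS Nu => x x0; rewrite /E (cramer_entry _ _ _ x0).
  congr (\det _ / _); apply/matrixP => i j; rewrite !mxE ffunE.
  by case: eqP.
have /choice[h hP] (ab : 'I_k * 'I_(k + r)) : exists h : X -> C,
    (\forall x \near p, holo h x) /\ (\forall x \near p^', E x ab.1 ab.2 = h x).
  have [gP|/nP g0] := boolP (P (g ab.1 ab.2)); last first.
    exists (fun=> 0); split; first by apply: filterE => x; exact: holo_cst.
    by apply: filterS2 (EE ab.1 ab.2) g0 => x -> ->; rewrite mul0r.
  have [n nE] : exists n : nat, o (g ab.1 ab.2) - o c0 = n%:Z.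
    by exists `|o (g ab.1 ab.2) - o c0|%N; rewrite gez0_abs // subr_ge0 f0min.
  have := ordM (oP _ gP) (ordV f0ord); rewrite nE => /ord_ge0_extend[h hh hE].
  by exists h; split; [exact: hh|apply: filterS2 (EE ab.1 ab.2) hE => x -> ->].
pose Eh x : 'M[C]_(k, k + r) := \matrix_(a, b) h (a, b) x.
have Ehh : \forall x \near p, mxholo Eh x.
  apply: near_mx => a b; apply: filterS (hP (a, b)).1 => x.
  by apply: holo_near; apply: filterE => y; rewrite mxE.
have EEh : \forall x \near p^', E x = Eh x.
  have : \forall x \near p^', forall a b, E x a b = h (a, b) x.
    by apply: near_mx => a b; exact: (hP (a, b)).2.
  by apply: filterS => x H; apply/matrixP => a b; rewrite H mxE.
(* The selected columns form the identity off [p], hence also at [p]: the holomorphic extension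
   keeps full rank at [p]. *)
have Ehp : colsub c0 (Eh p) = 1%:M.
  apply/matrixP => a b; rewrite !mxE.
  apply: (holo_eq_limit (near_at (hP (a, c0 b)).1) (holo_cst ((a == b)%:R) p)).
  apply: filterS2 EEh Nu => x Ex x0.
  have : colsub c0 (E x) a b = (1%:M : 'M[C]_k) a b.
    by rewrite -mulmx_colsub mulVmx.
  by rewrite Ex !mxE.
have Ehf : row_free (Eh p).
  apply/row_freeP; exists (colsub c0 1%:M).
  by rewrite mulmx_colsub mulmx1.
(* The completion is chosen at [p], with constant rows, and stays invertible nearby. *)
have [B0 B0u] := row_free_complete Ehf.
pose B x := col_mx (Eh x) B0.
have Bh : \forall x \near p, mxholo B x.
  apply: filterS Ehh => x Ex a b; case: (split_ordP a) => a' ->.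
    by apply: holo_near (Ex a' b); apply: filterE => y; rewrite col_mxEu.
  by apply: holo_near (holo_cst (B0 a' b) x); apply: filterE => y; rewrite col_mxEd.
have B0d : \det (B p) != 0 by rewrite -unitfE -unitmxE.
have Bn := holo_neq0_near (holo_det (near_at Bh)) B0d.
exists (fun x => A x *m invmx (B x)), B; split.
- apply: mxmeroM Am (mxholo_mero _).
  have Bh' := near_join Bh; apply: filterS2 Bh Bn => x; exact: mxholo_inv.
- exact: Bh.
- exact: B0d.
- by apply: filterS (punctured_near Bn) => x Bx; rewrite mulmxKV // unitmxE unitfE.
- apply: filterS3 EEh Nu (punctured_near Bn) => x Ex x0 Bx.
  have Bu : B x \in unitmx by rewrite unitmxE unitfE.
  have ME : M x = row_mx (N x) 0 *m B x.
    by rewrite mul_row_col mul0mx addr0 -Ex /E mulKVmx.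
  by rewrite /ursubmx -mul_usub_mx -/(M x) ME mulmxK // row_mxKr.
Qed.

Section MoreFrames.
Variable V : vbundle X.

Lemma basis_mul_unit r (e s : 'I_r -> section V) (A : X -> 'M[C]_r) x (W : {vspace V x}) :
  basis_of W (vals e x) -> A x \in unitmx -> eqcomb s A e x -> basis_of W (vals s x).
Proof.
move=> eW Au sA; have sf := free_mul_unit (basis_free eW) Au sA.
have sW a : s a x \in W.
  rewrite sA; apply: memv_suml => b _; apply: memvZ; apply: (basis_mem eW).
  by rewrite -(tnth_mktuple (fun a => e a x)) mem_tnth.
rewrite basisEfree sf (size_basis eW) size_tuple leqnn andbT /=.
by apply/span_subvP => v /mapP[a _ ->].
Qed.

Lemma coord_single (l : 'I_1 -> section V) x (c : C) : free (vals l x) ->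
  coord (vals l x) ord0 (c *: l ord0 x) = c.
Proof.
move=> lf; rewrite linearZ /= -[l ord0 x](tnth_mktuple (fun a => l a x)) (tnth_nth 0).
by rewrite coord_free // mulr1.
Qed.

End MoreFrames.

(** * Gram matrices of the quadratic form *)

Section GammaMatrix.
Variables (L : vbundle X) (Q : quadric_bundle L).
Local Notation fullQ := (fun x => fullv : {vspace Q x}).
Local Notation fullL := (fun x => fullv : {vspace L x}).

Definition gram n (e : 'I_n -> section Q) (l : 'I_1 -> section L) x : 'M[C]_n :=
  \matrix_(a, b) coord (vals l x) ord0 (gamma Q x (e a x) (e b x)).

Lemma gamma_gram n (e : 'I_n -> section Q) (l : 'I_1 -> section L) x a b :
  basis_of fullv (vals l x) ->
  gamma Q x (e a x) (e b x) = gram e l x a b *: l ord0 x.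
Proof.
move=> lb; rewrite {1}(coord_basis lb (memvf (gamma Q x (e a x) (e b x)))).
by rewrite big_ord1 mxE -tnth_nth tnth_mktuple.
Qed.

Lemma gram_sym n (e : 'I_n -> section Q) l x : (gram e l x)^T = gram e l x.
Proof. by apply/matrixP => a b; rewrite !mxE gamma_sym. Qed.

Lemma gamma_sumr r x (u : Q x) (c : 'I_r -> C) (v : 'I_r -> Q x) :
  gamma Q x u (\sum_a c a *: v a) = \sum_a c a *: gamma Q x u (v a).
Proof. by rewrite linear_sum; apply: eq_bigr => a _; rewrite linearZ. Qed.

Lemma gamma_suml r x (u : Q x) (c : 'I_r -> C) (v : 'I_r -> Q x) :
  gamma Q x (\sum_a c a *: v a) u = \sum_a c a *: gamma Q x (v a) u.
Proof. by rewrite gamma_sym gamma_sumr; apply: eq_bigr => a _; rewrite gamma_sym. Qed.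

Lemma gram_comb n r (e : 'I_r -> section Q) (s : 'I_n -> section Q) l (A : X -> 'M[C]_(n, r)) x :
  eqcomb s A e x -> gram s l x = A x *m gram e l x *m (A x)^T.
Proof.
move=> sA; apply/matrixP => a b; rewrite mxE (sA a) (sA b) gamma_sumr linear_sum mxE.
apply: eq_bigr => d _; rewrite gamma_suml linearZ /= linear_sum !mxE mulrC; congr (_ * _).
by apply: eq_bigr => c _; rewrite linearZ /= !mxE.
Qed.

Lemma gram_change n (e : 'I_n -> section Q) (l t : 'I_1 -> section L) (T : X -> 'M[C]_1) x :
  basis_of fullv (vals t x) -> free (vals l x) -> eqcomb t T l x ->
  gram e l x = T x ord0 ord0 *: gram e t x.
Proof.
move=> tb lf tT; apply/matrixP => a b; rewrite mxE (gamma_gram e a b tb) tT big_ord1 scalerA.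
by rewrite (coord_single _ lf) [RHS]mxE mulrC.
Qed.

Lemma gamma_hsec (s t : section Q) x : (\forall y \near x, hsec s y) -> (\forall y \near x, hsec t y) ->
  \forall y \near x, hsec (fun z => gamma Q z (s z) (t z)) y.
Proof.
move=> sh th; have : nbhs x (fun y => hsec s y /\ hsec t y) by apply: filterS2 sh th => y.
rewrite nbhsE => -[U [Uo Ux] UE].
have := @gamma_holo _ _ _ Q U s t Uo _ _ => /(_ _ _)/holomorphic_sectionP H.
apply: filterS (open_nbhs_nbhs (conj Uo Ux)) => y Uy; apply: H => //.
  by apply/holomorphic_sectionP => z /UE[].
by apply/holomorphic_sectionP => z /UE[].
Qed.

Lemma gram_holo n (e : 'I_n -> section Q) (l : 'I_1 -> section L) p :
  (\forall x \near p, forall a, hsec (e a) x) -> frame_at fullL l p ->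
  \forall x \near p, mxholo (gram e l) x.
Proof.
move=> eh lL; apply: near_mx => a b.
have h a' : \forall x \near p, hsec (e a') x by apply: filterS eh => x; apply.
have := @coordmx_holo_near _ _ _ fullL l (fun _ : 'I_1 => fun z => gamma Q z (e a z) (e b z)) p lL.
have hs : \forall x \near p, forall _ : 'I_1,
    hsec (fun z => gamma Q z (e a z) (e b z)) x /\ gamma Q x (e a x) (e b x) \in fullL x.
  by apply: filterS (gamma_hsec (h a) (h b)) => x H _; split; [exact: H|exact: memvf].
move=> /(_ hs); apply: filterS => x H.
by apply: holo_near (H ord0 ord0); apply: filterE => y; rewrite !mxE.
Qed.

Lemma gram_lower n (e : 'I_n -> section Q) (l : 'I_1 -> section L) x a :
  basis_of fullv (vals e x) -> basis_of fullv (vals l x) ->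
  row a (gram e l x) = 0 -> gamma Q x (e a x) = 0.
Proof.
move=> eb lb /rowP r0; apply/lfunP => v; rewrite zero_lfunE.
have -> : v = \sum_b coord (vals e x) b v *: e b x.
  rewrite {1}(coord_basis eb (memvf v)); apply: eq_bigr => b _.
  by rewrite -tnth_nth tnth_mktuple.
rewrite gamma_sumr big1 // => b _; rewrite (gamma_gram e a b lb).
by have := r0 b; rewrite mxE [RHS]mxE => ->; rewrite scale0r scaler0.
Qed.

End GammaMatrix.

Lemma mxmeroZ p m n (c : X -> C) (A : X -> 'M[C]_(m, n)) : mero p c -> mxmero p A ->
  mxmero p (fun x => c x *: A x).
Proof.
move=> cm Am a b; apply: mero_near (meroM cm (Am a b)).
by apply: filterE => x; rewrite mxE.
Qed.

Lemma mxmeroT p m n (A : X -> 'M[C]_(m, n)) : mxmero p A -> mxmero p (fun x => (A x)^T).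
Proof. by move=> Am a b; apply: mero_near (Am b a); apply: filterE => x; rewrite mxE. Qed.

Lemma mxmero_cst p m n (A : 'M[C]_(m, n)) : mxmero p (fun=> A).
Proof. by move=> a b; exact: mero_cst. Qed.

Lemma mxmero_holo_near p m n (A : X -> 'M[C]_(m, n)) : mxmero p A -> \forall x \near p^', mxholo A x.
Proof. by move=> Am; apply: near_mx => a b; exact: mero_holo_near. Qed.

Lemma mxmero_dr p k r (A : X -> 'M[C]_(k + r)) : mxmero p A -> mxmero p (fun x => drsubmx (A x)).
Proof.
move=> Am a b; apply: mero_near (Am (rshift k a) (rshift k b)).
by apply: filterE => x; rewrite !mxE.
Qed.

Lemma mxmero_ur p k r (A : X -> 'M[C]_(k + r)) : mxmero p A -> mxmero p (fun x => ursubmx (A x)).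
Proof.
move=> Am a b; apply: mero_near (Am (lshift r a) (rshift k b)).
by apply: filterE => x; rewrite !mxE.
Qed.

Lemma mxmero_ul p k r (A : X -> 'M[C]_(k + r)) : mxmero p A -> mxmero p (fun x => ulsubmx (A x)).
Proof.
move=> Am a b; apply: mero_near (Am (lshift r a) (lshift r b)).
by apply: filterE => x; rewrite !mxE.
Qed.

Lemma mxmeroN p m n (A : X -> 'M[C]_(m, n)) : mxmero p A -> mxmero p (fun x => - A x).
Proof.
move=> Am a b; apply: mero_near (meroM (mero_cst p (-1)) (Am a b)).
by apply: filterE => x; rewrite mxE mulN1r.
Qed.

Lemma mxmero_block p k r (A : X -> 'M[C]_k) (B : X -> 'M[C]_(k, r)) (A' : X -> 'M[C]_(r, k))
  (B' : X -> 'M[C]_r) : mxmero p A -> mxmero p B -> mxmero p A' -> mxmero p B' ->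
  mxmero p (fun x => block_mx (A x) (B x) (A' x) (B' x)).
Proof.
move=> Am Bm Am' Bm' a b.
case: (split_ordP a) => a' ->; case: (split_ordP b) => b' ->.
- by apply: mero_near (Am a' b'); apply: filterE => x; rewrite block_mxEul.
- by apply: mero_near (Bm a' b'); apply: filterE => x; rewrite block_mxEur.
- by apply: mero_near (Am' a' b'); apply: filterE => x; rewrite block_mxEdl.
- by apply: mero_near (Bm' a' b'); apply: filterE => x; rewrite block_mxEdr.
Qed.

(** * Generic normal form of the Gram matrix *)

Section GlobalFrames.
Variables (L : vbundle X) (Q : quadric_bundle L).
Local Notation fullQ := (fun x => fullv : {vspace Q x}).
Local Notation fullL := (fun x => fullv : {vspace L x}).

Lemma fdiv_basis (V : vbundle X) r W (s : 'I_r -> section V) p m : fdiv_at W s p m ->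
  \forall x \near p^', basis_of (W x) (vals s x).
Proof.
move=> [e [A [eL _ sE Ao]]].
apply: filterS3 (punctured_near eL) sE (ord_neq0_near Ao) => x [_ ex] sx A0.
by apply: basis_mul_unit ex _ sx; rewrite unitmxE unitfE.
Qed.

(** In holomorphic frames [e], [l] the Gram matrix is holomorphic; passing to [s], [t] multiplies it
    by [A] and its transpose and divides it by the entry of [T], all meromorphic. *)
Lemma gram_mero n (s : 'I_n -> section Q) (t : 'I_1 -> section L) p m k :
  fdiv_at fullQ s p m -> fdiv_at fullL t p k -> mxmero p (gram s t).
Proof.
move=> [e [A [eL Am sE Ao]]] tp; have [l [T [lL Tm tE To]]] := tp.
have eh : \forall x \near p, forall a, hsec (e a) x by apply: filterS eL => x [].
have Gm := mxholo_mero (gram_holo eh lL).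
have T0m : mero p (fun x => (T x ord0 ord0)^-1) by apply: meroV; exact: Tm.
apply: mxmero_near (mxmeroM (mxmeroM Am (mxmeroZ T0m Gm)) (mxmeroT Am)).
apply: filterS3 (filterI sE tE) (filterI (fdiv_basis tp) (punctured_near lL)) (ord_neq0_near To) =>
  x [sx tx] [tb [_ lb]] T0.
rewrite (gram_comb t sx) (gram_change e tb (basis_free lb) tx) scalerA mulVf ?scale1r //.
by move: T0; rewrite det_mx11 !(ord1 (0 : 'I_1)).
Qed.

(** Only points where the entries are holomorphic compete, as values at poles are arbitrary. Such
    points fill a punctured neighbourhood of every point, so the maximum bounds the rank there. *)
Lemma max_rank_point n (G : X -> 'M[C]_n) : (forall p, mxmero p G) ->
  exists x0, mxholo G x0 /\ forall p, \forall x \near p^', (\rank (G x) <= \rank (G x0))%N.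
Proof.
move=> Gm; pose P m := `[< exists2 x, mxholo G x & \rank (G x) = m >].
have [p0 _] := @rs_nonempty _ X.
have exP : exists m, P m.
  have [x Gx] := @filter_ex _ _ (dnbhs_proper p0) _ (mxmero_holo_near (Gm p0)).
  by exists (\rank (G x)); apply/asboolP; exists x.
have ubP m : P m -> (m <= n)%N by move=> /asboolP[x _ <-]; exact: rank_leq_row.
have [m /asboolP[x0 Gx0 <-] mmax] := ex_maxnP exP ubP.
exists x0; split=> // p; apply: filterS (mxmero_holo_near (Gm p)) => x Gx.
by apply: mmax; apply/asboolP; exists x.
Qed.

(** A constant congruence makes the lower right block invertible at [x0]. Its determinant is
    holomorphic at [x0] and so not identically zero; by the identity theorem it has an order
    everywhere. The Schur elimination, with meromorphic entries, then clears the other blocks. *)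
Lemma generic_normal_form k r (s : 'I_(k + r) -> section Q) (t : 'I_1 -> section L) D E x0 :
  frame_divisor fullQ s D -> frame_divisor fullL t E ->
  mxholo (gram s t) x0 -> \rank (gram s t x0) = r ->
  (forall p, \forall x \near p^', (\rank (gram s t x) <= r)%N) ->
  exists2 s' : 'I_(k + r) -> section Q, frame_divisor fullQ s' D & forall p,
    (\forall x \near p^', gram s' t x = block_mx 0 0 0 (drsubmx (gram s' t x))) /\
    exists m, ord p (fun x => \det (drsubmx (gram s' t x))) m.
Proof.
move=> sD tE Gh Gr Gle; set G := gram s t in Gh Gr Gle.
have Gm p : mxmero p G.
  by move/frame_divisorP: sD => /(_ p) sp; move/frame_divisorP: tE => /(_ p); exact: gram_mero sp.
have [Cm Cu H0] := symmetric_normal_form (gram_sym s t x0) Gr.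
pose G' x := Cm *m G x *m Cm^T.
have Gm' p : mxmero p G'.
  by apply: mxmeroM (mxmeroM _ (Gm p)) _; exact: mxmero_cst.
have G's x : (G' x)^T = G' x.
  by rewrite /G' !trmx_mul trmxK gram_sym mulmxA.
have dm p : mero p (fun x => \det (drsubmx (G' x))).
  by apply: mero_det; exact: mxmero_dr.
have dord p : exists m, ord p (fun x => \det (drsubmx (G' x))) m.
  have [H|H] := mero_global_dichotomy dm; last exact: H.
  have dh : holo (fun x => \det (drsubmx (G' x))) x0.
    apply: holo_det => a b.
    have : mxholo G' x0 by apply: mxholoM (mxholoM (mxholo_cst _ _) Gh) (mxholo_cst _ _).
    by move=> /(_ (rshift k a) (rshift k b)); apply: holo_near; apply: filterE => y; rewrite !mxE.
  have := holo_eq_limit dh (holo_cst 0 x0) (H x0) => d0.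
  by have := H0; rewrite unitmxE unitfE => /eqP; case; exact: d0.
pose P x : 'M[C]_(k + r) := block_mx 1%:M (- (ursubmx (G' x) *m invmx (drsubmx (G' x)))) 0 1%:M.
pose T x := P x *m Cm.
(* The elimination matrix is block unipotent, so [T] has constant non-zero determinant and the
   divisor of the frame is unchanged. *)
have Tdet x : \det (T x) = \det Cm by rewrite det_mulmx det_ublock !det1 !mul1r.
pose s' (a : 'I_(k + r)) : section Q := fun x => \sum_b T x a b *: s b x.
have s'T x : eqcomb s' T s x by [].
have gE p : \forall x \near p^', gram s' t x = block_mx 0 0 0 (drsubmx (G' x)).
  have [m pm] := dord p.
  apply: filterS2 (Gle p) (ord_neq0_near pm) => x Gx d0.
  rewrite (gram_comb t (s'T x)) /T trmx_mul -/(G x).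
  have -> : P x *m Cm *m G x *m (Cm^T *m (P x)^T) = P x *m G' x *m (P x)^T.
    by rewrite /G' !mulmxA.
  apply: schur_complement; [exact: G's|by rewrite unitmxE unitfE|].
  rewrite /G' mxrankMfree ?row_free_unit ?unitmx_tr //.
  by rewrite eqmxMfull ?row_full_unit.
exists s'.
  apply/frame_divisorP => p; rewrite -[D p]add0r.
  move/frame_divisorP: sD => /(_ p) sp.
  have [m pm] := dord p.
  apply: (fdiv_mul sp (T := T)); last exact: filterE.
    apply: mxmeroM (mxmero_block _ _ _ _) _; try exact: mxmero_cst.
    apply: mxmeroN; apply: mxmeroM (mxmero_ur (Gm' p)) _.
    exact: mxmero_inv (mxmero_dr (Gm' p)) pm.
  apply: ord_near (holo_ord0 _ _ (f := fun=> \det Cm)).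
  - by apply: filterE => x; rewrite Tdet.
  - by apply: filterE => x; exact: holo_cst.
  - by rewrite -unitfE -unitmxE.
move=> p; have [m pm] := dord p; split.
  by apply: filterS (gE p) => x ->; rewrite block_mxKdr.
by exists m; apply: ord_near pm; apply: filterS (gE p) => x ->; rewrite block_mxKdr.
Qed.

End GlobalFrames.

Lemma ordX p f m n : ord p f m -> ord p (fun x => f x ^+ n) (n%:Z * m).
Proof.
move=> fm; elim: n => [|n IH].
  rewrite mul0r; apply: ord_near (holo_ord0 (f := fun=> 1) _ _).
  - exact: filterE.
  - by apply: filterE => x; exact: holo_cst.
  - exact: oner_neq0.
have := ordM fm IH; have -> : m + n%:Z * m = n.+1%:Z * m by rewrite intS; ring.
by apply: ord_near; apply: filterE => x; rewrite exprS.
Qed.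

(** The upper left block of [A] is invertible and cancels from the first [k] rows of the equation;
    symmetry of [G] then kills its first [k] columns. *)
Lemma block_kernel (F : fieldType) k r (A G : 'M[F]_(k + r)) (H : 'M[F]_r) :
  A \in unitmx -> ursubmx A = 0 -> G^T = G -> A *m G *m A^T = block_mx 0 0 0 H ->
  usubmx G = 0 /\ drsubmx A *m drsubmx G *m (drsubmx A)^T = H.
Proof.
move=> Au A0 Gs E.
have A11u : ulsubmx A \in unitmx.
  move: Au; rewrite -{1}[A]submxK A0 unitmxE det_lblock unitrM => /andP[? _].
  by rewrite unitmxE.
have G0 : usubmx G = 0.
  have : usubmx (A *m (G *m A^T)) = 0 by rewrite mulmxA E block_mxEv col_mxKu row_mx0.
  rewrite -{1}[A]submxK A0 -[G *m A^T]vsubmxK mul_block_col col_mxKu mul0mx addr0.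
  rewrite -mul_usub_mx mulmxA => /(congr1 (fun M => M *m invmx A^T)).
  rewrite mul0mx mulmxK ?unitmx_tr // => /(congr1 (mulmx (invmx (ulsubmx A)))).
  by rewrite mulmx0 mulKmx.
split=> //.
have Gul : ulsubmx G = 0 by rewrite /ulsubmx G0 linear0.
have Gur : ursubmx G = 0 by rewrite /ursubmx G0 linear0.
have Gdl : dlsubmx G = 0 by rewrite -[in LHS]Gs -trmx_ursub Gur trmx0.
move/(congr1 drsubmx): E; rewrite block_mxKdr => <-.
have AE : A = block_mx (ulsubmx A) 0 (dlsubmx A) (drsubmx A) by rewrite -A0 submxK.
have GE : G = block_mx 0 0 0 (drsubmx G) by rewrite -[LHS]submxK Gul Gur Gdl.
move: AE GE; move: (ulsubmx A) (dlsubmx A) (drsubmx A) (drsubmx G) => a1 a2 a3 g -> ->.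
rewrite tr_block_mx trmx0 !mulmx_block block_mxKdr.
by rewrite !(mul0mx, mulmx0, add0r, addr0).
Qed.

(** * The local inequality between divisors *)

Section LocalKernel.
Variables (L : vbundle X) (Q : quadric_bundle L).
Local Notation fullQ := (fun x => fullv : {vspace Q x}).
Local Notation fullL := (fun x => fullv : {vspace L x}).

Lemma frame_at_change (V : vbundle X) r W (e0 : 'I_r -> section V) (B : X -> 'M[C]_r) p :
  frame_at W e0 p -> (\forall x \near p, mxholo B x) -> \det (B p) != 0 ->
  frame_at W (fun a x => \sum_b B x a b *: e0 b x) p.
Proof.
move=> eL Bh B0; have Bn := holo_neq0_near (holo_det (near_at Bh)) B0.
apply: filterS3 eL Bh Bn => x [eh eb] Bx Bn; split.
  by move=> a; apply: (hsec_comb (c := fun b y => B y a b)) => b; [exact: Bx|exact: eh].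
by apply: (basis_mul_unit (A := B) eb) => //; rewrite unitmxE unitfE.
Qed.

Lemma local_kernel_frame k r (s : 'I_(k + r) -> section Q) (t : 'I_1 -> section L) p mV mL mG :
  fdiv_at fullQ s p mV -> fdiv_at fullL t p mL ->
  (\forall x \near p^', gram s t x = block_mx 0 0 0 (drsubmx (gram s t x))) ->
  ord p (fun x => \det (drsubmx (gram s t x))) mG ->
  exists (e : 'I_(k + r) -> section Q) (A : X -> 'M[C]_(k + r)) (mN : int),
    [/\ frame_at fullQ e p /\ mxmero p A,
        \forall x \near p^', [/\ eqcomb s A e x, ursubmx (A x) = 0 & \det (A x) != 0],
        ord p (fun x => \det (ulsubmx (A x))) mN,
        2 * (mV - mN) <= r%:Z * mL + mG &
        \forall x \near p, forall a, gamma Q x (e (lshift r a) x) = 0].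
Proof.
move=> [e0 [A0 [eL0 Am0 sE0 Ao0]]] tp GE Go.
have [A [B [Am Bh B0 AB Aur]]] := local_triangular Am0 Ao0.
pose e (a : 'I_(k + r)) : section Q := fun x => \sum_b B x a b *: e0 b x.
have eL : frame_at fullQ e p by exact: frame_at_change.
have Bd : \forall x \near p, holo (fun y => \det (B y)) x.
  by apply: filterS Bh => x; exact: holo_det.
have Bo := holo_ord0 Bd B0.
have Bn := punctured_near (holo_neq0_near (near_at Bd) B0).
have Ao : ord p (fun x => \det (A x)) mV.
  have := ordM Ao0 (ordV Bo); rewrite oppr0 addr0; apply: ord_near.
  by apply: filterS2 AB Bn => x -> Bx; rewrite det_mulmx mulfK.
have sE : \forall x \near p^', eqcomb s A e x.
  apply: filterS2 sE0 AB => x sx Ax a; rewrite sx Ax.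
  have := @eqcombM Q _ _ _ A B (fun a x => \sum_c A x a c *: e c x) e e0 x.
  by move=> H; rewrite -(H _ _ a).
have dA : \forall x \near p^', \det (A x) = \det (ulsubmx (A x)) * \det (drsubmx (A x)).
  by apply: filterS Aur => x A12; rewrite -{1}[A x]submxK A12 det_lblock.
have An := ord_neq0_near Ao.
(* The two diagonal blocks have determinants with product [\det (A x)], so neither vanishes
   identically and both have an order. *)
have [H|[mN No]] := mero_ord (mero_det (mxmero_ul Am)).
  case: (punctured_absurd An); apply: filterS2 H dA => x H ->.
  by rewrite H mul0r eqxx.
have [H|[m2 Do]] := mero_ord (mero_det (mxmero_dr Am)).
  case: (punctured_absurd An); apply: filterS2 H dA => x H ->.
  by rewrite H mulr0 eqxx.
have mVE : mV = mN + m2.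
  by apply: ord_unique Ao (ord_near _ (ordM No Do)); apply: filterS dA => x ->.
have [l [T [lL Tm tE To]]] := tp.
have eh : \forall x \near p, forall a, hsec (e a) x by apply: filterS eL => x [].
have Gh := gram_holo eh lL.
have key : \forall x \near p^', usubmx (gram e l x) = 0 /\
    drsubmx (A x) *m drsubmx (gram e l x) *m (drsubmx (A x))^T = T x ord0 ord0 *: drsubmx (gram s t x).
  have st : \forall x \near p^', eqcomb s A e x /\ eqcomb t T l x by apply: filterS2 sE tE.
  have An' : \forall x \near p^', \det (A x) != 0 /\ ursubmx (A x) = 0 by apply: filterS2 An Aur.
  have lb : \forall x \near p^', basis_of fullv (vals t x) /\ free (vals l x).
    by apply: filterS2 (fdiv_basis tp) (punctured_near lL) => x tb [_ /basis_free].
  have GA : \forall x \near p^', (\det (A x) != 0 /\ ursubmx (A x) = 0) /\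
      gram s t x = block_mx 0 0 0 (drsubmx (gram s t x)) by apply: filterS2 An' GE.
  apply: filterS3 st lb GA => x [sx tx] [tb lf] [[Ax A12] Gx].
  apply: block_kernel; [by rewrite unitmxE unitfE|exact: A12|exact: gram_sym|].
  rewrite (gram_change e tb lf tx) -scalemxAr -scalemxAl -(gram_comb t sx) Gx.
  by rewrite scale_block_mx !scaler0 block_mxKdr.
exists e, A, mN; split.
- by split.
- by apply: filterS3 sE Aur An => x.
- exact: No.
- have dGh : \forall x \near p, holo (fun y => \det (drsubmx (gram e l y))) x.
    apply: filterS Gh => x Gx; apply: holo_det => a b.
    by apply: holo_near (Gx (rshift k a) (rshift k b)); apply: filterE => y; rewrite !mxE.
  have dE : \forall x \near p^', \det (T x) ^+ r * \det (drsubmx (gram s t x)) =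
      \det (drsubmx (A x)) ^+ 2 * \det (drsubmx (gram e l x)).
    apply: filterS key => x [_ /(congr1 determinant)].
    by rewrite detZ !det_mulmx det_tr det_mx11 => <-; ring.
  have lhs := ordM (ordX r To) Go.
  (* The left side of [dE] has an order, so the Gram determinant on the right is not identically
     zero. Being holomorphic it has a natural order [mg], and dropping it from
     [r * mL + mG = 2 * m2 + mg] gives the inequality. *)
  have [H|[mg dGo]] := holo_ord dGh.
    case: (punctured_absurd (ord_neq0_near lhs)).
    by apply: filterS2 dE (punctured_near H) => x -> ->; rewrite mulr0 eqxx.
  have := ord_unique lhs (ord_near _ (ordM (ordX 2 Do) dGo)).
  rewrite mVE => -> //; first by lia.
  by apply: filterS dE => x ->.
(* The rows are known to vanish off [p] only; by continuity they vanish at [p], so [gamma] kills the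
   kernel in that fibre as well. *)
- have u0 : \forall x \near p, usubmx (gram e l x) = 0.
    have kp : \forall x \near p^', usubmx (gram e l x) = 0 by apply: filterS key => x [].
    apply: (near_punctured _ kp); apply/matrixP => a b; rewrite [RHS]mxE.
    have := holo_eq_limit (near_at Gh (lshift r a) b) (holo_cst 0 p).
    move=> H; rewrite mxE; apply: H.
    by apply: filterS kp => x /matrixP/(_ a b); rewrite !mxE.
  apply: filterS3 u0 eL lL => x ux [_ ex] [_ lx] a.
  apply: (gram_lower ex lx); apply/rowP => b.
  by have /matrixP/(_ a b) := ux; rewrite !mxE.
Qed.

End LocalKernel.

(** * The kernel subbundle and its degree *)

Definition low (V : vbundle X) k r (e : 'I_(k + r) -> section V) (a : 'I_k) : section V :=
  e (lshift r a).

Section Saturation.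
Variable V : vbundle X.
Local Notation fullV := (fun x => fullv : {vspace V x}).

Lemma vals_nth n (e : 'I_n -> section V) x a : e a x = (vals e x)`_a.
Proof. by rewrite -tnth_nth tnth_mktuple. Qed.

Lemma mem_vals n (e : 'I_n -> section V) x a : e a x \in <<vals e x>>%VS.
Proof. by apply: memv_span; rewrite -(tnth_mktuple (fun a => e a x)) mem_tnth. Qed.

Lemma free_low k r (e : 'I_(k + r) -> section V) x : free (vals e x) -> free (vals (low e) x).
Proof.
have [j jx] := triv_cover V x; rewrite !(free_trivmx _ jx) => /usubmx_row_free.
by congr (row_free _ ); apply/matrixP => a b; rewrite !mxE.
Qed.

Lemma low_coord0 k r (e : 'I_(k + r) -> section V) x v b : free (vals e x) ->
  v \in <<vals (low e) x>>%VS -> coord (vals e x) (rshift k b) v = 0.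
Proof.
move=> ef /coord_span ->; rewrite linear_sum big1 // => a _.
rewrite linearZ /= -vals_nth /low (vals_nth e) coord_free // -val_eqE /=.
by rewrite ltn_eqF ?mulr0 // ltn_addr.
Qed.

Lemma coord0_low k r (e : 'I_(k + r) -> section V) x v : basis_of fullv (vals e x) ->
  (forall b, coord (vals e x) (rshift k b) v = 0) -> v \in <<vals (low e) x>>%VS.
Proof.
move=> eb v0; rewrite (coord_basis eb (memvf v)) big_split_ord /=.
rewrite [X in _ + X]big1 ?addr0 => [|b _]; last by rewrite v0 scale0r.
apply: memv_suml => a _; apply: memvZ; rewrite -(vals_nth e x (lshift r a)).
exact: (mem_vals (low e) x a).
Qed.

Lemma dim_low k r (e : 'I_(k + r) -> section V) x : free (vals e x) ->
  \dim <<vals (low e) x>> = k.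
Proof. by move=> /free_low; rewrite /free size_tuple => /eqP. Qed.

Lemma eqcomb_low k r (s e : 'I_(k + r) -> section V) (A : X -> 'M[C]_(k + r)) x :
  eqcomb s A e x -> ursubmx (A x) = 0 -> eqcomb (low s) (fun x => ulsubmx (A x)) (low e) x.
Proof.
move=> sA A0 a; rewrite /low sA big_split_ord /= [X in _ + X]big1 ?addr0 => [|b _].
  by apply: eq_bigr => b _; rewrite !mxE.
by have /matrixP/(_ a b) := A0; rewrite !mxE => ->; rewrite scale0r.
Qed.

Lemma low_span k r (s e : 'I_(k + r) -> section V) (A : X -> 'M[C]_(k + r)) x :
  free (vals e x) -> eqcomb s A e x -> ursubmx (A x) = 0 -> \det (A x) != 0 ->
  <<vals (low s) x>>%VS = <<vals (low e) x>>%VS.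
Proof.
move=> ef sA A0 Ad; apply/eqP.
have eb : basis_of <<vals (low e) x>>%VS (vals (low e) x).
  by rewrite /basis_of eqxx free_low.
have := basis_mul_unit eb _ (eqcomb_low sA A0).
rewrite unitmxE unitfE => /(_ _)/andP[] //.
move: Ad; rewrite -{1}[A x]submxK A0 det_lblock.
by apply: contraNneq => ->; rewrite mul0r.
Qed.

(* The span of the low part is a closed condition: the coordinates of [f] in [e] that
   vanish near [y] also vanish at [y]. *)
Lemma span_limit k r (e f : 'I_(k + r) -> section V) y : frame_at fullV e y -> frame_at fullV f y ->
  (\forall x \near y^', <<vals (low f) x>>%VS = <<vals (low e) x>>%VS) ->
  <<vals (low f) y>>%VS = <<vals (low e) y>>%VS.
Proof.
move=> eL fL E; have [_ eb] := near_at eL; have [_ fb] := near_at fL.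
apply/eqP; rewrite eqEdim !dim_low ?(basis_free eb) ?(basis_free fb) // leqnn andbT.
apply/span_subvP => v /mapP[a _ ->]; apply: (coord0_low eb) => b.
have ch := coordmx_holo_near eL (frame_at_sections fL).
have h1 := near_at ch (lshift r a) (rshift k b).
have := holo_eq_limit h1 (holo_cst 0 y); rewrite mxE; apply.
apply: filterS2 E (punctured_near eL) => x E [_ ex].
rewrite mxE; apply: (low_coord0 _ (basis_free ex)); rewrite -E.
exact: (mem_vals (low f) x a).
Qed.

End Saturation.

Section KernelBundle.
Variables (L : vbundle X) (Q : quadric_bundle L).
Local Notation fullQ := (fun x => fullv : {vspace Q x}).
Local Notation fullL := (fun x => fullv : {vspace L x}).

Lemma kernel_subbundle k r (s : 'I_(k + r) -> section Q) (t : 'I_1 -> section L) D E G :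
  frame_divisor fullQ s D -> frame_divisor fullL t E ->
  (forall p, \forall x \near p^', gram s t x = block_mx 0 0 0 (drsubmx (gram s t x))) ->
  (forall p, ord p (fun x => \det (drsubmx (gram s t x))) (G p)) ->
  exists (N : subbundle Q) DN, [/\ sub_rk N = k, gamma_null N, frame_divisor N (low s) DN &
    forall p, 2 * (D p - DN p) <= r%:Z * E p + G p].
Proof.
move=> /frame_divisorP sD /frame_divisorP tE GE Go.
have /choice[e H] p := local_kernel_frame (sD p) (tE p) (GE p) (Go p).
have {H}/choice[A H] := H.
have {H}/choice[DN H] := H.
(* The fibre at [x] comes from the frame centred at [x]. For [y] near [p], the frames centred at [y]
   and [p] both give the span of [low s] around [y] except perhaps at [y], where [span_limit] closes
   the gap; so [e p] describes [N] around [p]. *)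
pose N x := <<vals (low (e x)) x>>%VS.
have eL p : frame_at fullQ (e p) p by have [[]] := H p.
have sE p : \forall x \near p^', <<vals (low s) x>>%VS = <<vals (low (e p)) x>>%VS.
  have [_ sA _ _ _] := H p.
  by apply: filterS2 sA (punctured_near (eL p)) => x [sA A0 Ad] [_ /basis_free ef]; exact: low_span sA A0 Ad.
have NE p : \forall y \near p, N y = <<vals (low (e p)) y>>%VS.
  apply: (@near_punctured p (fun y => N y = <<vals (low (e p)) y>>%VS)); first by [].
  apply: filterS2 (punctured_near_near (sE p)) (punctured_near (frame_at_near (eL p))) => y sy ey.
  apply: (span_limit ey (eL y)).
  by apply: filterS2 (punctured_near sy) (sE y) => x -> ->.
have NL p : frame_at N (low (e p)) p.
  apply: filterS2 (NE p) (eL p) => x NxE [eh /basis_free ef]; split.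
    by move=> a; exact: eh.
  by rewrite /basis_of NxE eqxx free_low.
have frN p : exists (U : set X) (f : 'I_k -> section Q), open_nbhs p U /\ local_frame N U f.
  by have [U Up UL] := frame_at_to_local (NL p); exists U, (low (e p)).
exists (SubBundle frN), DN; split.
- by [].
- move=> x u /= /coord_span ->; have [_ _ _ _ gx] := H x.
  rewrite linear_sum big1 // => a _; rewrite linearZ /= -vals_nth.
  by rewrite /low (near_at gx) scaler0.
- apply/frame_divisorP => p; have [[_ Am] sA No _ _] := H p.
  exists (low (e p)), (fun x => ulsubmx (A p x)); split.
  + exact: NL.
  + exact: mxmero_ul.
  + by apply: filterS sA => x [sA A0 _]; exact: eqcomb_low.
  + exact: No.
- by move=> p; have [] := H p.
Qed.

End KernelBundle.

(** * The degree inequality *)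

Section DegreeBound.
Variables (L : vbundle X) (Q : quadric_bundle L).
Local Notation fullQ := (fun x => fullv : {vspace Q x}).
Local Notation fullL := (fun x => fullv : {vspace L x}).

Lemma normal_frame n (s : 'I_n -> section Q) (t : 'I_1 -> section L) D E :
  frame_divisor fullQ s D -> frame_divisor fullL t E ->
  exists k r, (k + r = n)%N /\ exists (s' : 'I_(k + r) -> section Q) (G : X -> int),
    [/\ frame_divisor fullQ s' D,
        forall p, \forall x \near p^', gram s' t x = block_mx 0 0 0 (drsubmx (gram s' t x)) &
        forall p, ord p (fun x => \det (drsubmx (gram s' t x))) (G p)].
Proof.
move=> sD tE.
have Gm p : mxmero p (gram s t).
  by move/frame_divisorP: sD => /(_ p) sp; move/frame_divisorP: tE => /(_ p); exact: gram_mero sp.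
have [x0 [Gh]] := max_rank_point Gm.
have := rank_leq_row (gram s t x0); move Er : (\rank (gram s t x0)) => r rn Gle.
have [k nE] : exists k, n = (k + r)%N by exists (n - r)%N; rewrite subnK.
subst n; exists k, r; split=> //.
have [s' s'D H] := generic_normal_form sD tE Gh Er Gle.
have /choice[G Go] p : exists m, ord p (fun x => \det (drsubmx (gram s' t x))) m by have [] := H p.
by exists s', G; split=> // p; have [] := H p.
Qed.

(** As the lower right block is invertible, the kernel of [gamma Q x] is spanned by the first [k]
    vectors of the frame; rank-nullity concludes. *)
Lemma gamma_dim k r (s : 'I_(k + r) -> section Q) (t : 'I_1 -> section L) x :
  basis_of fullv (vals s x) -> basis_of fullv (vals t x) ->
  gram s t x = block_mx 0 0 0 (drsubmx (gram s t x)) -> \det (drsubmx (gram s t x)) != 0 ->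
  \dim (limg (gamma Q x)) = r.
Proof.
move=> sb tb GE G0; have dQ : \dim (fullv : {vspace Q x}) = (k + r)%N.
  by rewrite (size_basis sb).
have kerE : lker (gamma Q x) = <<vals (low s) x>>%VS.
  apply/eqP; rewrite eqEsubv; apply/andP; split; last first.
    apply/span_subvP => v /mapP[a _ ->]; rewrite memv_ker; apply/eqP.
    apply: (gram_lower sb tb); apply/rowP => b; rewrite mxE GE /= [RHS]mxE.
    by case: (split_ordP b) => c ->; rewrite ?block_mxEul ?block_mxEur mxE.
  apply/subvP => v; rewrite memv_ker => /eqP v0; apply: (coord0_low sb).
  pose c : 'rV[C]_(k + r) := \row_a coord (vals s x) a v.
  have vE : v = \sum_a c ord0 a *: s a x.
    rewrite {1}(coord_basis sb (memvf v)); apply: eq_bigr => a _.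
    by rewrite mxE -tnth_nth tnth_mktuple.
  have c0 : c *m gram s t x = 0.
    apply/rowP => b; rewrite [RHS]mxE.
    have : gamma Q x v (s b x) = 0 by rewrite v0 zero_lfunE.
    rewrite vE gamma_suml => /(congr1 (coord (vals t x) ord0)).
    rewrite linear0 linear_sum => H; rewrite mxE -[RHS]H.
    by apply: eq_bigr => a _; rewrite linearZ /= !mxE.
  have : rsubmx c *m drsubmx (gram s t x) = 0.
    move: c0; rewrite GE -{1}[c]hsubmxK mul_row_block !mulmx0 !add0r block_mxKdr.
    by move=> /(congr1 rsubmx); rewrite row_mxKr linear0.
  move=> /(congr1 (fun M => M *m invmx (drsubmx (gram s t x)))).
  rewrite mul0mx mulmxK ?unitmxE ?unitfE // => /rowP H b.
  by have := H b; rewrite !mxE.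
have := limg_ker_dim (gamma Q x) fullv.
rewrite dQ capfv kerE dim_low ?(basis_free sb) //.
by move=> /eqP; rewrite eqn_add2l => /eqP.
Qed.

(** The interior of the set where the dimension is [r] is dense, and it meets any other dense open
    set, so no other value is possible for the choice in [qrk]. *)
Lemma qrk_eq r : (forall p, \forall x \near p^', \dim (limg (gamma Q x)) = r) -> qrk Q = r.
Proof.
move=> H; pose A : set X := [set x | \forall y \near x, \dim (limg (gamma Q y)) = r].
have Ao : open A by rewrite openE => x; exact: near_join.
have Ad : dense A.
  move=> O [p Op] Oo.
  have On : \forall x \near p^', O x by apply: punctured_near; exact: open_nbhs_nbhs.
  have OA : \forall x \near p^', O x /\ A x by apply: filterS2 On (punctured_near_near (H p)).
  by have [x [Ox Ax]] := @filter_ex _ _ (dnbhs_proper p) _ OA; exists x.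
pose S : set nat := [set m | exists B : set X,
  [/\ open B, dense B & forall x, B x -> \dim (limg (gamma Q x)) = m]].
have Sr : S r by exists A; split=> // x /near_at.
have [B [Bo Bd Bm]] : S (qrk Q) by exact: (xgetPex 0%N (ex_intro _ r Sr)).
have [p _] := @rs_nonempty _ X.
have [x0 [_ Bx0]] : setT `&` B !=set0 by apply: Bd => //; [exists p|exact: openT].
have [x [Bx Ax]] : B `&` A !=set0 by apply: Ad => //; exists x0.
by rewrite -(Bm x Bx) (near_at Ax).
Qed.

Lemma sub_dim (V : vbundle X) (W : subbundle V) x : \dim (W x) = sub_rk W.
Proof.
have [U [e [Ux We]]] := sub_frame W x.
by have [_ eb] := near_at (frame_at_of_local Ux We); rewrite (size_basis eb).
Qed.

(** Meant for the case [k = 0], where the kernel is not a proper subbundle and semistability says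
    nothing about it; an empty determinant is 1. *)
Lemma deg_rank0 (V : vbundle X) W (s : 'I_0 -> section V) D :
  frame_divisor W s D -> deg D = 0.
Proof.
move=> /frame_divisorP sD; have D0 p : D p = 0.
  have [e [A [_ _ _ Ao]]] := sD p; apply: (ord_unique Ao).
  apply: (ord_near (f := fun=> 1)); first by apply: filterE => x; rewrite det_mx00.
  apply: holo_ord0; last exact: oner_neq0.
  by apply: filterE => x; exact: holo_cst.
by rewrite (@deg_seq [::]) ?big_nil // => p _; exact: D0.
Qed.

Hypothesis Xc : compact [set: X].

Lemma degree_bound alpha n d (dL : int) : rk L = 1%N -> has_degree L dL ->
  semistable alpha n d Q -> (0 < qrk Q <= n)%N /\
  d%:~R <= (qrk Q)%:R * dL%:~R / 2 + (n%:R - (qrk Q)%:R) * alpha.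
Proof.
move=> L1; rewrite /has_degree L1 => -[[t [E tE]] Luniq] [[nE Qd] _ ss _].
have n0 := qb_rk_gt0 Q.
(* [Q] itself, having positive rank and a degree, serves to show that principal divisors have degree
   0. *)
have pr := principal_degree Xc n0 Qd.
have [[s0 [D sD0]] Quniq] := Qd; have dD := Quniq _ _ sD0; have dE := Luniq _ _ tE.
have [k [r [krE [s [G [sD GE Go]]]]]] := normal_frame sD0 tE.
have [N [DN [Nk Nnull sN ineq]]] := kernel_subbundle sD tE GE Go.
have qr : qrk Q = r.
  apply: qrk_eq => p; have sp := iffLR (frame_divisorP _ _ _) sD p.
  have tp := iffLR (frame_divisorP _ _ _) tE p.
  have st : \forall x \near p^', basis_of fullv (vals s x) /\ basis_of fullv (vals t x).
    by apply: filterS2 (fdiv_basis sp) (fdiv_basis tp).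
  by apply: filterS3 st (GE p) (ord_neq0_near (Go p)) => x [sb tb]; exact: gamma_dim.
(* For [r = 0] the kernel would be the whole bundle and [gamma] would vanish. Positivity also makes
   the kernel subbundle proper as soon as [0 < k]. *)
have r0 : (0 < r)%N.
  rewrite lt0n; apply/eqP => r0; have [x /eqP[]] := gamma_neq0 Q.
  apply/lfunP => v; rewrite zero_lfunE; apply: Nnull.
  suff -> : N x = fullv by rewrite memvf.
  have [e [_ [eL _ _ _]]] := iffLR (frame_divisorP _ _ _) sD x.
  have [_ eb] := near_at eL; apply/eqP.
  by rewrite eqEdim subvf sub_dim Nk (size_basis eb) r0 addn0 leqnn.
have Df := frame_divisor_fin_supp Xc sD; have Ef := frame_divisor_fin_supp Xc tE.
have Nf := frame_divisor_fin_supp Xc sN; have Gf := divisor_fin_supp Xc Go.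
have dG := pr _ _ Go.
have dI : 2 * (d - deg DN) <= r%:Z * dL.
  have Nf' := fin_suppZ (-1) Nf; have DNf := fin_suppD Df Nf'.
  have := deg_le (fin_suppZ 2 DNf) (fin_suppD (fin_suppZ r%:Z Ef) Gf).
  rewrite degZ // !degD //; last exact: fin_suppZ.
  rewrite !degZ // dG addr0 [deg D]dD [deg E]dE mulN1r; apply => p.
  by rewrite mulN1r; exact: ineq.
have dN : (deg DN)%:~R <= alpha * k%:R.
  have [k0|k0] := posnP k.
    rewrite k0 mulr0 (_ : deg DN = 0) //.
    by move: (low s) sN; rewrite k0 => ls; exact: deg_rank0.
  have pN : Defs.proper_sub N by rewrite /Defs.proper_sub Nk k0 -krE -addn1 leq_add2l.
  have sdN : sub_degree N (deg DN).
    split; first by rewrite Nk; exists (low s), DN.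
    rewrite Nk => s' D' s'D'; exact: degree_independent pr s'D' sN.
  by have [_ _ /(_ Nnull)] := ss N _ pN sdN; rewrite /bound_c Nk.
rewrite qr r0 -nE -krE leq_addl natrD; split=> //.
have dI' : 2 * (d%:~R - (deg DN)%:~R) <= r%:R * dL%:~R :> R.
  by move: dI; rewrite -(ler_int R) !intrM intrD mulrNz.
by lra.
Qed.

End DegreeBound.

End RiemannSurface.

Theorem proposition3p3 (R : realType) (X : riemann_surface R) (g : nat)
    (L : vbundle X) (dL : int) (alpha : R) :
  compact [set: X] -> has_genus X g -> (2 <= g)%N ->
  rk L = 1%N -> has_degree L dL ->
  [/\ forall (n : nat) (d : int) (Q : quadric_bundle L),
        semistable alpha n d Q ->
        n%:R * alpha <= d%:~R
        /\ d%:~R <= (qrk Q)%:R * dL%:~R / 2 + (n%:R - (qrk Q)%:R) * alpha,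
      dL%:~R / 2 < alpha ->
        forall (n : nat) (d : int), moduli_empty L alpha n d &
      alpha <= dL%:~R / 2 ->
        forall (n : nat) (d : int), n%:R * dL%:~R / 2 < d%:~R :> R ->
        moduli_empty L alpha n d].
Proof.
move=> Xc _ _ L1 dL0.
have bound n d (Q : quadric_bundle L) : semistable alpha n d Q ->
    [/\ (0 < n)%N, n%:R * alpha <= d%:~R, (0 < qrk Q <= n)%N &
    d%:~R <= (qrk Q)%:R * dL%:~R / 2 + (n%:R - (qrk Q)%:R) * alpha].
  move=> ss; have [rn db] := degree_bound Xc L1 dL0 ss; have [[nE _] an _ _] := ss.
  have n0 : (0 < n)%N by rewrite -nE; exact: qb_rk_gt0.
  by split=> //; move: an; rewrite ler_pdivlMr ?ltr0n // mulrC.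
split=> [n d Q /bound[]//|da|da] n d; [|move=> nd] => -[_ [Q [/bound[n0 an rn dr] _ _] _]].
(* The two bounds on [d] together give [qrk Q * (alpha - dL / 2) <= 0], impossible for a positive
   rank. *)
- have r0 : 0 < (qrk Q)%:R :> R by rewrite ltr0n; case/andP: rn.
  have : 0 < (qrk Q)%:R * (alpha - dL%:~R / 2) by rewrite mulr_gt0 ?subr_gt0.
  by lra.
(* As [qrk Q <= n], replacing [alpha] by the larger [dL / 2] weakens the upper bound to
   [n * dL / 2]. *)
- have rn' : 0 <= n%:R - (qrk Q)%:R :> R by rewrite subr_ge0 ler_nat; case/andP: rn.
  have : 0 <= (n%:R - (qrk Q)%:R) * (dL%:~R / 2 - alpha) by apply: mulr_ge0 => //; rewrite subr_ge0.
  by lra.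
Qed.
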